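(* Let $k$ be an algebraically closed field and $G$ an algebraic group over $k$. Let $X$ be a closed node-surface with $l$ singular (conic) points which, locally, are cones over disjoint unions of $r_1, r_2, \ldots, r_l$ circles, respectively, and let $Q$ be a parabolic structure on $X$. If $f:\Sigma\to X$ is the normalization of $X$, with $\Sigma$ connected, and $Q' = f^*Q$ is the parabolic structure induced on $\Sigma$ via $f$, then, in the localized Grothendieck ring of algebraic varieties described in the context, $$ [\mathfrak{X}_G(X,Q)] = [\mathfrak{X}_G(\Sigma,Q')]\cdot [G]^{\,r_1+\cdots+r_l-1}. $$
   Context: For a non-empty closed manifold $B$, $\mathrm{Cone}(B)=(B\times[0,1))/(B\times\{0\})$ with vertex $v_B$. A nodefold is a second countable, paracompact space in which every point $p$ has an open neighbourhood homeomorphic to some $\mathrm{Cone}(B)$ with $p\mapsto v_B$; its dimension is $\dim B+1$. A point is smooth if one can take $B$ a sphere, and conic (singular) otherwise. A node-surface is a nodefold of dimension $2$; closed means compact without boundary. A continuous map $f:X_1\to X_2$ of nodefolds is a conic degeneration if there is a finite subset $S$ of the conic points of $X_2$ such that $f^{-1}(s)$ is finite for all $s\in S$ and $f:X_1-f^{-1}(S)\to X_2-S$ is a homeomorphism. A normalization of a node-surface $X$ is a conic degeneration $f:\Sigma\to X$ with $\Sigma$ a smooth surface (compact when $X$ is); it exists and is unique up to homeomorphism. A parabolic structure on a closed node-surface $X$ is a finite set $Q=\{(p_1,\lambda_1),\dots,(p_s,\lambda_s)\}$ of pairwise distinct smooth points $p_i\in X$ (punctures), each with a chosen local orientation (co-orientation),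 and subvarieties $\lambda_i\subseteq G$ invariant under conjugation (holonomies). The induced structure is $f^*Q=\{(f^{-1}(p_i),\lambda_i)\}$. For $X$ connected, $\mathfrak{X}_G(X,Q)$ is the set of group homomorphisms $\rho:\pi_1(X-\{p_1,\dots,p_s\})\to G$ such that $\rho(\gamma)\in\lambda_i$ for every positively oriented loop (meridian) $\gamma$ around $p_i$, with the algebraic structure induced by embedding it into a power of $G$ by evaluating at a finite set of generators. The Grothendieck ring of algebraic varieties over $k$ is generated by the isomorphism classes $[Z]$ of algebraic varieties, subject to $[Z_1\sqcup Z_2]=[Z_1]+[Z_2]$ and $[Z_1\times Z_2]=[Z_1]\cdot[Z_2]$. The identity is understood in its localization in which $q=[k]$ (the class of the affine line), $q+1$, $q-1$ and $[G]$ are inverted.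
   Formalization: The exponent of [G] is corrected from r_1+...+r_l-1 to r_1+...+r_l-l (the number l of conic points); the printed one fails, e.g. for a sphere with two pairs of points identified and G the multiplicative group, and both agree when l=1. *)

(* Defs.v *)
From HB Require Import structures.
From mathcomp Require Import all_boot all_order all_algebra.
From mathcomp Require mpoly.
From mathcomp Require Import all_classical all_reals all_analysis.
From mathcomp Require Import homotopy.
From mathcomp Require Import ring lra.

Set Implicit Arguments.
Unset Strict Implicit.
Unset Printing Implicit Defensive.

Import Order.TTheory GRing.Theory Num.Theory.
Import numFieldNormedType.Exports.

Local Open Scope classical_set_scope.
Local Open Scope ring_scope.
Local Open Scope quotient_scope.

Definition unit_interval (R : realType) : Type := set_type `[(0 : R), 1]%classic.

HB.instance Definition _ (R : realType) := Topological.on (unit_interval R).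

Section UnitInterval.
Variable R : realType.
Local Notation I := (unit_interval R).

Definition ival (t : I) : R := set_val t.

Fact clamp_subproof (t : R) :
  Num.max 0 (Num.min t 1) \in `[(0 : R), 1]%classic.
Proof.
by rewrite inE /= in_itv /= le_max lexx /= ge_max ler01 /= ge_min lexx orbT.
Qed.

Definition clamp (t : R) : I := SigSub (clamp_subproof t).

Lemma ival_clamp t : 0 <= t <= 1 -> ival (clamp t) = t.
Proof.
by case/andP=> t0 t1; rewrite /ival set_valE /= min_l // max_r.
Qed.

Lemma ival_bounds (t : I) : 0 <= ival t <= 1.
Proof. by have := set_valP t; rewrite /= in_itv. Qed.

Lemma ivalK (t : I) : clamp (ival t) = t.
Proof. by apply: val_inj; rewrite -[LHS]/(ival _) ival_clamp ?ival_bounds. Qed.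

Fact zero_neq_one : clamp 0 != clamp 1.
Proof.
apply/eqP => /(congr1 ival); rewrite !ival_clamp ?lexx ?ler01 // => /eqP.
by rewrite eq_sym oner_eq0.
Qed.

HB.instance Definition _ := Choice.on I.
HB.instance Definition _ := @isBiPointed.Build I (clamp 0) (clamp 1) zero_neq_one.

Lemma ival0 : ival zero = 0.
Proof. by rewrite ival_clamp // lexx ler01. Qed.

Lemma ival1 : ival one = 1.
Proof. by rewrite ival_clamp // lexx ler01. Qed.

Lemma ival_continuous : continuous ival.
Proof. exact: initial_continuous. Qed.

Lemma clamp_continuous : continuous clamp.
Proof.
apply: continuous_comp_initial => t.
have -> : (set_val \o clamp) = (fun t => Num.max (0 : R) (Num.min t 1)).
  by apply/funext => u /=; rewrite set_valE.
apply: (@continuous_max _ _ (cst (0 : R)) (fun u : R => Num.min u 1)).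
  exact: cst_continuous.
apply: (@continuous_min _ _ id (cst (1 : R))); first exact: (fun x => x).
exact: cst_continuous.
Qed.
End UnitInterval.

Lemma continuous_glue (R : realType) (X T : topologicalType) (u : X -> R) (c : R)
    (f g : X -> T) :
  continuous u -> continuous f -> continuous g -> (forall x, u x = c -> f x = g x) ->
  continuous (fun x => if u x <= c then f x else g x).
Proof.
move=> cu cf cg fg.
set h := fun x => _.
have cA : closed [set x | u x <= c].
  by have := @closed_le R c; move/closed_comp => /(_ _ u); apply=> x _; exact: cu.
have cB : closed [set x | c <= u x].
  by have := @closed_ge R c; move/closed_comp => /(_ _ u); apply=> x _; exact: cu.
apply/continuous_subspace_setT.
have -> : [set: X] = [set x | u x <= c] `|` [set x | c <= u x].
  by apply/seteqP; split=> x //= _; case/orP: (le_total (u x) c); [left|right].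
apply: withinU_continuous => //.
- apply: (@subspace_eq_continuous _ _ _ f); last exact: continuous_subspaceT.
  by move=> x; rewrite inE /= /from_subspace /h => ->.
- apply: (@subspace_eq_continuous _ _ _ g); last exact: continuous_subspaceT.
  move=> x; rewrite inE /= /from_subspace /h => cx.
  by case: ifPn => // xc; rewrite fg //; apply/eqP; rewrite eq_le xc cx.
Qed.

Lemma continuous_post (X Y Z : topologicalType) (g : Y -> Z) (f : X -> Y) :
  continuous g -> continuous f -> continuous (fun x => g (f x)).
Proof. by move=> cg cf x; apply: (@continuous_comp _ _ _ f g); [exact: cf|exact: cg]. Qed.

Section Homotopy.
Variables (R : realType) (T : topologicalType).
Local Notation I := (unit_interval R).
Local Notation pth x y := {path I from x to y in T}.

Definition homotopic (x y : T) (p q : pth x y) : Prop :=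
  exists H : I * I -> T,
    [/\ continuous H,
        forall t, H (zero, t) = p t /\ H (one, t) = q t &
        forall s, H (s, zero) = x /\ H (s, one) = y].

Fact path_concat_continuous (x y z : T) (p : pth x y) (q : pth y z) :
  continuous (fun t : I => if ival t <= 2^-1 then p (clamp (2 * ival t))
                           else q (clamp (2 * ival t - 1))).
Proof.
have cv : continuous (fun t : I => 2 * ival t).
  move=> t; apply: (@continuousM _ _ (cst 2) (@ival R)); first exact: cst_continuous.
  exact: ival_continuous.
apply: continuous_glue.
- exact: ival_continuous.
- apply: (continuous_post (g := p)); first exact: cts_fun.
  by apply: (continuous_post (g := @clamp R)); first exact: clamp_continuous.
- apply: (continuous_post (g := q)); first exact: cts_fun.
  apply: (continuous_post (g := @clamp R)); first exact: clamp_continuous.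
  move=> t; apply: (@continuousB _ _ _ (fun t : I => 2 * ival t) (cst 1)); first exact: cv.
  exact: cst_continuous.
- move=> t ->; rewrite mulfV ?pnatr_eq0 // subrr.
  by rewrite [LHS](@path_one _ _ _ _ p) [RHS](@path_zero _ _ _ _ q).
Qed.

Fact path_concat_zero (x y z : T) (p : pth x y) (q : pth y z) :
  (fun t : I => if ival t <= 2^-1 then p (clamp (2 * ival t))
                           else q (clamp (2 * ival t - 1))) zero = x.
Proof. by cbv beta; rewrite ival0 invr_ge0 ler0n mulr0 [LHS](@path_zero _ _ _ _ p). Qed.

Fact path_concat_one (x y z : T) (p : pth x y) (q : pth y z) :
  (fun t : I => if ival t <= 2^-1 then p (clamp (2 * ival t))
                           else q (clamp (2 * ival t - 1))) one = z.
Proof.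
cbv beta; rewrite ival1 ifF; last by apply/negbTE; rewrite -ltNge; lra.
by rewrite mulr1 (_ : 2 - 1 = 1) ?[LHS](@path_one _ _ _ _ q)//; lra.
Qed.

Definition path_concat (x y z : T) (p : pth x y) (q : pth y z) : pth x z :=
  mk_path (@path_concat_continuous x y z p q)
    (path_concat_zero p q) (path_concat_one p q).

Fact path_rev_continuous (x y : T) (p : pth x y) :
  continuous (fun t : I => p (clamp (1 - ival t))).
Proof.
apply: (continuous_post (g := p)); first exact: cts_fun.
apply: (continuous_post (g := @clamp R)); first exact: clamp_continuous.
move=> t; apply: (@continuousB _ _ _ (fun=> 1 : R) (@ival R)); first exact: cst_continuous.
exact: ival_continuous.
Qed.

Fact path_rev_zero (x y : T) (p : pth x y) :
  (fun t : I => p (clamp (1 - ival t))) zero = y.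
Proof. by cbv beta; rewrite ival0 subr0 [LHS](@path_one _ _ _ _ p). Qed.

Fact path_rev_one (x y : T) (p : pth x y) :
  (fun t : I => p (clamp (1 - ival t))) one = x.
Proof. by cbv beta; rewrite ival1 subrr [LHS](@path_zero _ _ _ _ p). Qed.

Definition path_rev (x y : T) (p : pth x y) : pth y x :=
  mk_path (@path_rev_continuous x y p) (path_rev_zero p) (path_rev_one p).

Definition path_cst (x : T) : pth x x := cst x.

Lemma path_concatE (x y z : T) (p : pth x y) (q : pth y z) t :
  path_concat p q t = if ival t <= 2^-1 then p (clamp (2 * ival t))
                           else q (clamp (2 * ival t - 1)).
Proof. by []. Qed.

Lemma homotopic_refl (x y : T) (p : pth x y) : homotopic p p.
Proof.
exists (p \o snd); split=> //=.
  by move=> t; apply: continuous_comp; [exact: cvg_snd|exact: cts_fun].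
by move=> s; rewrite path_zero path_one.
Qed.

Lemma continuous_pair_comp (X Y Z W : topologicalType) (H : Y * Z -> W)
    (f : X -> Y) (g : X -> Z) :
  continuous H -> continuous f -> continuous g ->
  continuous (fun x => H (f x, g x)).
Proof.
move=> cH cf cg t; apply: (@continuous_comp _ _ _ (fun x => (f x, g x)) H).
  by apply: cvg_pair; [exact: cf|exact: cg].
exact: cH.
Qed.

Lemma clamp_comp_continuous (X : topologicalType) (f : X -> R) :
  continuous f -> continuous (fun x => clamp (f x)).
Proof.
move=> cf t; apply: continuous_comp; first exact: cf.
exact: clamp_continuous.
Qed.

Lemma ival_fst_continuous (X : topologicalType) :
  continuous (fun u : I * X => ival u.1).
Proof.
by move=> t; apply: continuous_comp; [exact: cvg_fst|exact: ival_continuous].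
Qed.

Lemma ival_snd_continuous (X : topologicalType) :
  continuous (fun u : X * I => ival u.2).
Proof.
by move=> t; apply: continuous_comp; [exact: cvg_snd|exact: ival_continuous].
Qed.

Lemma affine_continuous (X : topologicalType) (a b : R) (f : X -> R) :
  continuous f -> continuous (fun x => a * f x + b).
Proof.
move=> cf x; apply: (@continuousD _ _ _ (fun x => a * f x) (cst b)).
  apply: (@continuousM _ _ (cst a) f); first exact: cst_continuous.
  exact: cf.
exact: cst_continuous.
Qed.

Lemma homotopic_sym (x y : T) (p q : pth x y) : homotopic p q -> homotopic q p.
Proof.
case=> H [cH H01 Hs]; exists (fun u => H (clamp (- 1 * ival u.1 + 1), u.2)); split.
- apply: continuous_pair_comp => //.
    apply/clamp_comp_continuous/affine_continuous; exact: ival_fst_continuous.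
  by move=> u; exact: cvg_snd.
- move=> t /=; rewrite ival0 ival1 mulr0 add0r mulr1 addNr.
  by have [-> ->] := H01 t.
- by move=> s /=; exact: Hs.
Qed.

Lemma homotopic_trans (x y : T) (q p r : pth x y) :
  homotopic p q -> homotopic q r -> homotopic p r.
Proof.
move=> [H [cH H01 Hs]] [K [cK K01 Ks]].
exists (fun u => if ival u.1 <= 2^-1 then H (clamp (2 * ival u.1 + 0), u.2)
                 else K (clamp (2 * ival u.1 + - 1), u.2)); split.
- apply: continuous_glue; first exact: ival_fst_continuous.
  + apply: continuous_pair_comp => //.
      apply/clamp_comp_continuous/affine_continuous; exact: ival_fst_continuous.
    by move=> u; exact: cvg_snd.
  + apply: continuous_pair_comp => //.
      apply/clamp_comp_continuous/affine_continuous; exact: ival_fst_continuous.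
    by move=> u; exact: cvg_snd.
  + move=> [s t] /= ->; rewrite mulfV ?pnatr_eq0 // subrr addr0.
    by rewrite [LHS](H01 t).2 [RHS](K01 t).1.
- move=> t /=; rewrite ival0 ival1 invr_ge0 ler0n mulr0 addr0 ifF; last first.
    by apply/negbTE; rewrite -ltNge; lra.
  rewrite mulr1 (_ : 2 + - 1 = 1); last by lra.
  by split; [exact: (H01 t).1|exact: (K01 t).2].
- by move=> s /=; case: ifP => _; [exact: Hs|exact: Ks].
Qed.

Lemma homotopic_reparam (x y : T) (g : I -> T) (phi psi : I -> I)
    (p q : pth x y) :
  continuous g -> continuous phi -> continuous psi ->
  phi zero = psi zero -> phi one = psi one ->
  (forall t, p t = g (phi t)) -> (forall t, q t = g (psi t)) -> homotopic p q.
Proof.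
move=> cg cphi cpsi e0 e1 pE qE.
exists (fun u => g (clamp (ival (phi u.2) +
    ival u.1 * (ival (psi u.2) - ival (phi u.2))))); split.
- have ci (f : I -> I) : continuous f -> continuous (fun u : I * I => ival (f u.2)).
    move=> cf u; apply: (@continuous_comp _ _ _ (fun u : I * I => f u.2)).
      by apply: continuous_comp; [exact: cvg_snd|exact: cf].
    exact: ival_continuous.
  apply: (continuous_post cg); apply: clamp_comp_continuous => u.
  apply: (@continuousD _ _ _ (fun u => ival (phi u.2))
    (fun u => ival u.1 * (ival (psi u.2) - ival (phi u.2)))); first exact: ci.
  apply: (@continuousM _ _ (fun u => ival u.1)
    (fun u => ival (psi u.2) - ival (phi u.2))); first exact: ival_fst_continuous.
  by apply: (@continuousB _ _ _ (fun u => ival (psi u.2))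
    (fun u => ival (phi u.2))); exact: ci.
- move=> t /=; rewrite ival0 ival1 mul0r addr0 mul1r addrC subrK !ivalK.
  by rewrite pE qE.
- move=> s /=; rewrite -e0 -e1 !subrr !mulr0 !addr0 !ivalK -!pE.
  by split; [exact: (@path_zero _ _ _ _ p)|exact: (@path_one _ _ _ _ p)].
Qed.


Lemma clamp_le0 (t : R) : t <= 0 -> clamp t = zero.
Proof.
move=> t0; apply: val_inj; rewrite -[LHS]/(ival _) -[RHS]/(ival _) ival0.
by rewrite /ival set_valE /= min_l ?max_l// (le_trans t0).
Qed.

Lemma clamp_ge1 (t : R) : 1 <= t -> clamp t = one.
Proof.
move=> t1; apply: val_inj; rewrite -[LHS]/(ival _) -[RHS]/(ival _) ival1.
by rewrite /ival set_valE /= min_r ?max_r.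
Qed.

Lemma homotopic_concat (x y z : T) (p p' : pth x y) (q q' : pth y z) :
  homotopic p p' -> homotopic q q' ->
  homotopic (path_concat p q) (path_concat p' q').
Proof.
move=> [H [cH H01 Hs]] [K [cK K01 Ks]].
exists (fun u => if ival u.2 <= 2^-1 then H (u.1, clamp (2 * ival u.2 + 0))
                 else K (u.1, clamp (2 * ival u.2 + - 1))); split.
- apply: continuous_glue; first exact: ival_snd_continuous.
  + apply: continuous_pair_comp => //; first by move=> u; exact: cvg_fst.
    apply/clamp_comp_continuous/affine_continuous; exact: ival_snd_continuous.
  + apply: continuous_pair_comp => //; first by move=> u; exact: cvg_fst.
    apply/clamp_comp_continuous/affine_continuous; exact: ival_snd_continuous.
  + move=> [s t] /= ->; rewrite mulfV ?pnatr_eq0 // subrr addr0.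
    by rewrite [LHS](Hs s).2 [RHS](Ks s).1.
- move=> t; rewrite !path_concatE /= addr0.
  by case: ifP => _; [exact: H01|exact: K01].
- move=> s /=; rewrite ival0 ival1 invr_ge0 ler0n mulr0 addr0 ifF; last first.
    by apply/negbTE; rewrite -ltNge; lra.
  rewrite mulr1 (_ : 2 + - 1 = 1); last by lra.
  by split; [exact: (Hs s).1|exact: (Ks s).2].
Qed.

Lemma homotopic_rev (x y : T) (p p' : pth x y) :
  homotopic p p' -> homotopic (path_rev p) (path_rev p').
Proof.
move=> [H [cH H01 Hs]].
exists (fun u => H (u.1, clamp (- 1 * ival u.2 + 1))); split.
- apply: continuous_pair_comp => //; first by move=> u; exact: cvg_fst.
  apply/clamp_comp_continuous/affine_continuous; exact: ival_snd_continuous.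
- move=> t; rewrite /path_rev /mk_path /=.
  by rewrite mulN1r addrC; exact: H01.
- move=> s /=; rewrite ival0 ival1 mulr0 add0r mulr1 addNr.
  by split; [exact: (Hs s).2|exact: (Hs s).1].
Qed.

Lemma homotopic_cst_concat (x y : T) (p : pth x y) :
  homotopic (path_concat (path_cst x) p) p.
Proof.
apply: (@homotopic_reparam x y p (fun t => clamp (2 * ival t + - 1)) id).
- exact: cts_fun.
- apply/clamp_comp_continuous/affine_continuous; exact: ival_continuous.
- by move=> t; exact: cvg_id.
- by rewrite ival0 mulr0 add0r clamp_le0 // oppr_le0 ler01.
- by rewrite ival1 mulr1 clamp_ge1 //; lra.
- move=> t; rewrite path_concatE; case: ifP => // t2.
  rewrite [in RHS]clamp_le0; last by lra.
  by rewrite [RHS]path_zero.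
- by [].
Qed.

Lemma homotopic_concat_cst (x y : T) (p : pth x y) :
  homotopic (path_concat p (path_cst y)) p.
Proof.
apply: (@homotopic_reparam x y p (fun t => clamp (2 * ival t + 0)) id).
- exact: cts_fun.
- apply/clamp_comp_continuous/affine_continuous; exact: ival_continuous.
- by move=> t; exact: cvg_id.
- by rewrite ival0 mulr0 add0r.
- by rewrite ival1 mulr1 clamp_ge1 //; lra.
- move=> t; rewrite path_concatE addr0; case: ifPn => // t2.
  rewrite [in RHS]clamp_ge1; last by move: t2; rewrite -ltNge; lra.
  by rewrite [RHS]path_one.
- by [].
Qed.

Lemma homotopic_concat_rev (x y : T) (p : pth x y) :
  homotopic (path_concat p (path_rev p)) (path_cst x).
Proof.
apply: (@homotopic_reparam x x p (fun t => if ival t <= 2^-1 then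
  clamp (2 * ival t + 0) else clamp (- 2 * ival t + 2)) (cst zero)).
- exact: cts_fun.
- apply: continuous_glue; first exact: ival_continuous.
  + apply/clamp_comp_continuous/affine_continuous; exact: ival_continuous.
  + apply/clamp_comp_continuous/affine_continuous; exact: ival_continuous.
  + by move=> t ->; congr (clamp _); lra.
- exact: cst_continuous.
- by rewrite ival0 invr_ge0 ler0n mulr0 addr0.
- rewrite ival1 ifF; last by apply/negbTE; rewrite -ltNge; lra.
  by rewrite clamp_le0 //; lra.
- move=> t; rewrite path_concatE addr0; case: ifPn => //; rewrite -ltNge => t2.
  rewrite /path_rev /mk_path /=; congr (p (clamp _)); rewrite ival_clamp.
    by lra.
  by have /andP[] := ival_bounds t; lra.
- by move=> t; rewrite [RHS]path_zero.
Qed.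

Lemma homotopic_rev_concat (x y : T) (p : pth x y) :
  homotopic (path_concat (path_rev p) p) (path_cst y).
Proof.
apply: (@homotopic_reparam y y p (fun t => if ival t <= 2^-1 then
  clamp (- 2 * ival t + 1) else clamp (2 * ival t + - 1)) (cst one)).
- exact: cts_fun.
- apply: continuous_glue; first exact: ival_continuous.
  + apply/clamp_comp_continuous/affine_continuous; exact: ival_continuous.
  + apply/clamp_comp_continuous/affine_continuous; exact: ival_continuous.
  + by move=> t ->; congr (clamp _); lra.
- exact: cst_continuous.
- by rewrite ival0 invr_ge0 ler0n mulr0 add0r.
- rewrite ival1 ifF; last by apply/negbTE; rewrite -ltNge; lra.
  by rewrite clamp_ge1 //; lra.
- move=> t; rewrite path_concatE; case: ifPn => // t2.
  rewrite /path_rev /mk_path /=; congr (p (clamp _)); rewrite ival_clamp.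
    by lra.
  by have /andP[] := ival_bounds t; lra.
- by move=> t; rewrite [RHS]path_one.
Qed.

Lemma homotopic_concatA (x y z w : T) (p : pth x y) (q : pth y z) (r : pth z w) :
  homotopic (path_concat p (path_concat q r)) (path_concat (path_concat p q) r).
Proof.
apply: (@homotopic_reparam x w (path_concat (path_concat p q) r)
  (fun t => if ival t <= 2^-1 then clamp (2^-1 * ival t + 0) else
    if ival t <= 3/4 then clamp (1 * ival t + - (1/4)) else
    clamp (2 * ival t + - 1)) id).
- exact: cts_fun.
- apply: continuous_glue; first exact: ival_continuous.
  + apply/clamp_comp_continuous/affine_continuous; exact: ival_continuous.
  + apply: continuous_glue; first exact: ival_continuous.
    * apply/clamp_comp_continuous/affine_continuous; exact: ival_continuous.
    * apply/clamp_comp_continuous/affine_continuous; exact: ival_continuous.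
    * by move=> t ->; congr (clamp _); lra.
  + move=> t ->; rewrite ifT; last by lra.
    by congr (clamp _); lra.
- by move=> t; exact: cvg_id.
- by rewrite ival0 invr_ge0 ler0n mulr0 addr0.
- rewrite ival1 !ifF; [|by apply/negbTE; rewrite -ltNge; lra..].
  by congr clamp; lra.
- move=> t; have /andP[t0 t1] := ival_bounds t.
  rewrite path_concatE; case: (leP (ival t) 2^-1) => h1.
    rewrite path_concatE ival_clamp; last by apply/andP; split; lra.
    rewrite ifT; last by lra.
    rewrite path_concatE ival_clamp; last by apply/andP; split; lra.
    rewrite ifT; last by lra.
    by congr (p (clamp _)); lra.
  rewrite path_concatE ival_clamp; last by apply/andP; split; lra.
  case: (leP (ival t) (3/4)) => h2.
    rewrite ifT; last by lra.
    rewrite path_concatE ival_clamp; last by apply/andP; split; lra.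
    rewrite ifT; last by lra.
    rewrite path_concatE ival_clamp; last by apply/andP; split; lra.
    rewrite ifF; last by apply/negbTE; rewrite -ltNge; lra.
    by congr (q (clamp _)); lra.
  rewrite ifF; last by apply/negbTE; rewrite -ltNge; lra.
  rewrite path_concatE ival_clamp; last by apply/andP; split; lra.
  rewrite ifF; last by apply/negbTE; rewrite -ltNge; lra.
  by congr (r (clamp _)); lra.
- by [].
Qed.

End Homotopy.

Section FundamentalGroup.
Variables (R : realType) (T : topologicalType) (x0 : T).
Local Notation I := (unit_interval R).
Local Notation loop := {path I from x0 to x0 in T}.

Definition homotopicb (p q : loop) : bool := `[< homotopic p q >].

Fact homotopicb_equiv : equiv_class_of homotopicb.
Proof.
split.
- by move=> p; apply/asboolP; exact: homotopic_refl.
- by move=> p q; apply/asboolP/asboolP; exact: homotopic_sym.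
- by move=> q p r /asboolP pq /asboolP qr; apply/asboolP/(homotopic_trans pq).
Qed.

Definition homotopic_equiv : equiv_rel loop := EquivRelPack homotopicb_equiv.

(* The group law is concatenation, [a] * [b] running through [a] first. *)
Definition pi1 : Type := {eq_quot homotopic_equiv}.

HB.instance Definition _ := Choice.on pi1.
HB.instance Definition _ := EqQuotient.on pi1.

Definition loop_class (p : loop) : pi1 := \pi p.

Lemma loop_classP (p q : loop) : loop_class p = loop_class q <-> homotopic p q.
Proof.
split=> [/eqquotP/asboolP //|pq]; exact/eqquotP/asboolP.
Qed.

Lemma loop_class_ind (P : pi1 -> Prop) :
  (forall p, P (loop_class p)) -> forall a, P a.
Proof. by move=> HP a; rewrite -[a]reprK; exact: HP. Qed.

Definition pi1_one : pi1 := loop_class (path_cst R x0).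
Definition pi1_mul (a b : pi1) : pi1 :=
  loop_class (path_concat (repr a) (repr b)).
Definition pi1_inv (a : pi1) : pi1 := loop_class (path_rev (repr a)).

Lemma homotopic_repr (p : loop) : homotopic (repr (loop_class p)) p.
Proof. by apply/loop_classP; rewrite /loop_class reprK. Qed.

Lemma pi1_mulE p q :
  pi1_mul (loop_class p) (loop_class q) = loop_class (path_concat p q).
Proof. by apply/loop_classP/homotopic_concat; exact: homotopic_repr. Qed.

Lemma pi1_invE p : pi1_inv (loop_class p) = loop_class (path_rev p).
Proof. by apply/loop_classP/homotopic_rev; exact: homotopic_repr. Qed.

Fact pi1_mulA : associative pi1_mul.
Proof.
elim/loop_class_ind=> p; elim/loop_class_ind=> q; elim/loop_class_ind=> r.
by rewrite !pi1_mulE; apply/loop_classP; exact: homotopic_concatA.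
Qed.

Fact pi1_mul1 : left_id pi1_one pi1_mul.
Proof.
elim/loop_class_ind=> p; rewrite pi1_mulE; apply/loop_classP.
exact: homotopic_cst_concat.
Qed.

Fact pi1_1mul : right_id pi1_one pi1_mul.
Proof.
elim/loop_class_ind=> p; rewrite pi1_mulE; apply/loop_classP.
exact: homotopic_concat_cst.
Qed.

Fact pi1_mulV : left_inverse pi1_one pi1_inv pi1_mul.
Proof.
elim/loop_class_ind=> p; rewrite pi1_invE pi1_mulE; apply/loop_classP.
exact: homotopic_rev_concat.
Qed.

Fact pi1_Vmul : right_inverse pi1_one pi1_inv pi1_mul.
Proof.
elim/loop_class_ind=> p; rewrite pi1_invE pi1_mulE; apply/loop_classP.
exact: homotopic_concat_rev.
Qed.

HB.instance Definition _ := isGroup.Build pi1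
  pi1_mulA pi1_mul1 pi1_1mul pi1_mulV pi1_Vmul.
End FundamentalGroup.

Definition generates (G : groupType) n (g : 'I_n -> G) :=
  forall H : set G,
    H 1%g -> (forall a b, H a -> H b -> H (a * b)%g) ->
    (forall a, H a -> H a^-1%g) -> (forall i, H (g i)) -> H = setT.

Definition homeomorphism (X Y : topologicalType) (f : X -> Y) :=
  exists g : Y -> X,
    [/\ continuous f, continuous g, cancel f g & cancel g f].

Definition homeomorphic (X Y : topologicalType) :=
  exists f : X -> Y, homeomorphism f.

Definition paracompact (X : topologicalType) :=
  forall U : set (set X), U `<=` open -> \bigcup_(A in U) A = setT ->
  exists V : set (set X),
    [/\ V `<=` open, \bigcup_(A in V) A = setT,
        (forall A, V A -> exists2 B, U B & A `<=` B) &
        (forall x : X, exists2 N, nbhs x N &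
           finite_set [set A | V A /\ A `&` N !=set0])].

Definition closed_manifold (R : realType) n (B : topologicalType) :=
  [/\ hausdorff_space B, @second_countable B, compact [set: B] &
      forall x : B, exists U : set B,
        [/\ open U, U x & homeomorphic (set_type U) 'rV[R]_n]].

Section Cone.
Variables (R : realType) (B : topologicalType).

Definition cone_cylinder := (B * set_type `[(0 : R), 1[%classic)%type.

Definition cone_rel : rel cone_cylinder := fun u v =>
  (u == v) || ((set_val u.2 == 0) && (set_val v.2 == 0)).

Fact cone_equiv_class : equiv_class_of cone_rel.
Proof.
split=> [u|u v|v u w]; rewrite /cone_rel.
- by rewrite eqxx.
- by rewrite eq_sym andbC.
- case/orP=> [/eqP->//|/andP[u0 v0]] /orP[/eqP<-|/andP[_ w0]].
    by rewrite u0 v0 orbT.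
  by rewrite u0 w0 orbT.
Qed.

Definition cone_equiv : equiv_rel cone_cylinder := EquivRelPack cone_equiv_class.

Definition cone : topologicalType := quotient_topology {eq_quot cone_equiv}.

Definition cone_pi (u : cone_cylinder) : cone := \pi_{eq_quot cone_equiv} u.
End Cone.

(* [p] has an open neighbourhood homeomorphic to Cone(B) with [p] sent to the *)
(* vertex, the common image of the points of B x {0}.                         *)
Definition cone_neighbourhood (R : realType) (B X : topologicalType) (p : X) :=
  exists (U : set X) (h : cone R B -> set_type U),
    [/\ open U, U p, homeomorphism h &
        forall u : cone_cylinder R B, set_val u.2 = 0 ->
          set_val (h (cone_pi u)) = p].

(* [nodefold R n X]: X is a nodefold of dimension n + 1. *)
Definition nodefold (R : realType) n (X : topologicalType) :=
  [/\ hausdorff_space X, @second_countable X, paracompact X &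
      forall p : X, exists B : topologicalType,
        [/\ inhabited B, closed_manifold R n B & cone_neighbourhood R B p]].

Definition sphere (R : realType) n : topologicalType :=
  set_type [set v : 'rV[R]_n.+1 | \sum_i v ord0 i ^+ 2 = 1].

Definition smooth_point (R : realType) n (X : topologicalType) (p : X) :=
  cone_neighbourhood R (sphere R n) p.

Definition conic_point (R : realType) n (X : topologicalType) (p : X) :=
  ~ smooth_point R n p.

Definition node_surface (R : realType) (X : topologicalType) := nodefold R 1 X.

Definition closed_node_surface (R : realType) (X : topologicalType) :=
  node_surface R X /\ compact [set: X].

Definition smooth_surface (R : realType) (X : topologicalType) :=
  node_surface R X /\ forall p : X, smooth_point R 1 p.

Definition circles (R : realType) (r : nat) : topologicalType :=
  {_ : 'I_r & sphere R 1}.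

Definition conic_degeneration (R : realType) n (X1 X2 : topologicalType)
    (f : X1 -> X2) :=
  continuous f /\
  exists S : set X2,
    [/\ finite_set S, (forall p, S p -> conic_point R n p),
        (forall p, S p -> finite_set (f @^-1` [set p])) &
        exists g : set_type (~` (f @^-1` S)) -> set_type (~` S),
          homeomorphism g /\ forall x, set_val (g x) = f (set_val x)].

Definition normalization (R : realType) (Sigma X : topologicalType)
    (f : Sigma -> X) :=
  [/\ smooth_surface R Sigma, (compact [set: X] -> compact [set: Sigma]) &
      conic_degeneration R 1 f].

(* Varieties are taken in the classical sense: a space of closed points with  *)
(* its Zariski topology and, in place of the structure sheaf, the k-valued    *)
(* functions that are regular at (i.e. in a neighbourhood of) each point;     *)
(* f is regular on an open U when it is regular at every point of U.          *)
HB.mixin Record hasRegularFunctions (k : closedFieldType) T of Topological T := {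
  regular_at : T -> (T -> k) -> Prop;
  regular_at_germ : forall (x : T) (f g : T -> k),
    (\forall y \near x, f y = g y) -> regular_at x f -> regular_at x g }.

#[short(type="funSpaceType")]
HB.structure Definition FunSpace (k : closedFieldType) :=
  {T of Topological T & hasRegularFunctions k T}.

Section Induced.
Variables (k : closedFieldType) (X : funSpaceType k) (A : set X).

Definition induced_regular_at (x : set_type A) (f : set_type A -> k) :=
  exists2 F : X -> k, regular_at (set_val x) F &
    \forall y \near x, f y = F (set_val y).

Fact induced_regular_at_germ x (f g : set_type A -> k) :
  (\forall y \near x, f y = g y) ->
  induced_regular_at x f -> induced_regular_at x g.
Proof.
move=> fg [F rF fF]; exists F => //.
by near=> y; rewrite -(near fg y) ?(near fF y).
Unshelve. all: by end_near. Qed.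

HB.instance Definition _ :=
  hasRegularFunctions.Build k (set_type A) induced_regular_at_germ.
End Induced.

Definition alg_morphism (k : closedFieldType) (X Y : funSpaceType k)
    (f : X -> Y) :=
  continuous f /\
  forall x (h : Y -> k), regular_at (f x) h -> regular_at x (h \o f).

Definition alg_isomorphic (k : closedFieldType) (X Y : funSpaceType k) :=
  exists (f : X -> Y) (g : Y -> X),
    [/\ alg_morphism f, alg_morphism g, cancel f g & cancel g f].

Definition zero_locus (k : closedFieldType) n (J : set (mpoly.mpoly n k)) :
    set ('I_n -> k) :=
  [set v | forall p, J p -> mpoly.meval v p = 0].

(* [xi] identifies X, as a space with functions, with its image in k^n, where *)
(* the latter carries the Zariski topology and local quotients of polynomials.*)
Definition zariski_coordinates (k : closedFieldType) (X : funSpaceType k) n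
    (xi : X -> 'I_n -> k) :=
  [/\ injective xi,
      (forall A : set X, closed A <-> exists J, A = xi @^-1` zero_locus J) &
      (forall x f, regular_at x f <-> exists p q : mpoly.mpoly n k,
         mpoly.meval (xi x) q != 0 /\
         \forall y \near x, f y * mpoly.meval (xi y) q = mpoly.meval (xi y) p)].

Definition affine (k : closedFieldType) (X : funSpaceType k) :=
  exists n (xi : X -> 'I_n -> k) J,
    zariski_coordinates xi /\ range xi = zero_locus J.

Definition affine_line (k : closedFieldType) (X : funSpaceType k) :=
  exists xi : X -> 'I_1 -> k, zariski_coordinates xi /\ range xi = setT.

Definition prevariety (k : closedFieldType) (X : funSpaceType k) :=
  exists n (U : 'I_n -> set X),
    [/\ forall i, open (U i), \bigcup_i U i = setT &
        forall i, affine (set_type (U i) : funSpaceType k)].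

Definition separated (k : closedFieldType) (X : funSpaceType k) :=
  forall (Y : funSpaceType k) (f g : Y -> X), prevariety Y ->
    alg_morphism f -> alg_morphism g -> closed [set y | f y = g y].

Definition is_variety (k : closedFieldType) (X : funSpaceType k) :=
  prevariety X /\ separated X.

Record variety (k : closedFieldType) := Variety {
  variety_space :> funSpaceType k;
  varietyP : is_variety variety_space }.

Definition alg_product (k : closedFieldType) n (X : 'I_n -> funSpaceType k)
    (P : funSpaceType k) (pr : forall i, P -> X i) :=
  [/\ is_variety P, forall i, alg_morphism (@pr i) &
      forall (Y : funSpaceType k) (f : forall i, Y -> X i), is_variety Y ->
        (forall i, alg_morphism (f i)) ->
        exists! h : Y -> P, alg_morphism h /\ forall i, @pr i \o h = f i].

(* Locally closed rather than closed: holonomies are typically conjugacy       *)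
(* classes, which need not be closed.                                         *)
Definition subvariety (k : closedFieldType) (X : funSpaceType k) (A : set X) :=
  exists U C : set X, [/\ open U, closed C & A = U `&` C].

HB.mixin Record isAlgGroup (k : closedFieldType) G
    of FunSpace k G & Group G := {
  alg_group_is_variety : is_variety (G : FunSpace.type k);
  alg_group_mul : exists (P : funSpaceType k) (pr : 'I_2 -> P -> G),
    alg_product pr /\ alg_morphism (fun x : P => (pr ord0 x * pr ord_max x)%g : G);
  alg_group_inv : alg_morphism (fun x : G => (x^-1)%g : G) }.

#[short(type="algGroupType")]
HB.structure Definition AlgGroup (k : closedFieldType) :=
  {G of FunSpace k G & Group G & isAlgGroup k G}.

Definition alg_group_variety (k : closedFieldType) (G : algGroupType k) :
  variety k := Variety (alg_group_is_variety (s := G)).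

(* The ring is presented by generators and relations: its elements are the    *)
(* terms below and equality in the ring is the congruence [motive_eq]. It is  *)
(* not packaged as a quotient type because the carrier of a choiceType cannot *)
(* live in the universe of the type of all varieties.                         *)
Inductive inverted : Type := inv_q | inv_qD1 | inv_qB1 | inv_G.

Inductive motive (k : closedFieldType) : Type :=
| motive_class of variety k
| motive_zero
| motive_one
| motive_add of motive k & motive k
| motive_opp of motive k
| motive_mul of motive k & motive k
| motive_inv of inverted.

Arguments motive_zero {k}.
Arguments motive_one {k}.
Arguments motive_inv {k}.

Declare Scope motive_scope.
Delimit Scope motive_scope with motive.
Bind Scope motive_scope with motive.
Notation "[ 'class' Z ]" := (motive_class Z) (format "[ 'class'  Z ]") : motive_scope.
Notation "0" := motive_zero : motive_scope.
Notation "1" := motive_one : motive_scope.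
Notation "a + b" := (motive_add a b) : motive_scope.
Notation "- a" := (motive_opp a) : motive_scope.
Notation "a - b" := (motive_add a (motive_opp b)) : motive_scope.
Notation "a * b" := (motive_mul a b) : motive_scope.
Notation "a ^+ n" := (iter n (motive_mul a) motive_one) : motive_scope.

(* No relation [point] = 1 is imposed: it follows from [L x point] = [L] once *)
(* the class of the affine line L is inverted.                                *)
Inductive motive_eq (k : closedFieldType) (G : algGroupType k) :
    motive k -> motive k -> Prop :=
| meq_refl a : motive_eq G a a
| meq_sym a b : motive_eq G a b -> motive_eq G b a
| meq_trans a b c : motive_eq G a b -> motive_eq G b c -> motive_eq G a c
| meq_add a a' b b' : motive_eq G a a' -> motive_eq G b b' ->
    motive_eq G (a + b) (a' + b')
| meq_opp a a' : motive_eq G a a' -> motive_eq G (- a) (- a')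
| meq_mul a a' b b' : motive_eq G a a' -> motive_eq G b b' ->
    motive_eq G (a * b) (a' * b')
| meq_addA a b c : motive_eq G (a + (b + c)) ((a + b) + c)
| meq_addC a b : motive_eq G (a + b) (b + a)
| meq_add0 a : motive_eq G (0 + a) a
| meq_addN a : motive_eq G (- a + a) 0
| meq_mulA a b c : motive_eq G (a * (b * c)) ((a * b) * c)
| meq_mulC a b : motive_eq G (a * b) (b * a)
| meq_mul1 a : motive_eq G (1 * a) a
| meq_mulDl a b c : motive_eq G ((a + b) * c) (a * c + b * c)
| meq_iso (Z Z' : variety k) :
    alg_isomorphic Z Z' -> motive_eq G [class Z] [class Z']
| meq_union (Z Z1 Z2 : variety k) (U : set Z) :
    open U -> closed U ->
    alg_isomorphic (set_type U : funSpaceType k) Z1 ->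
    alg_isomorphic (set_type (~` U) : funSpaceType k) Z2 ->
    motive_eq G [class Z] ([class Z1] + [class Z2])
| meq_prod (Z Z1 Z2 : variety k)
    (pr : forall i : 'I_2, Z -> if i == ord0 then Z1 else Z2) :
    alg_product (X := fun i => if i == ord0 then Z1 else Z2) pr ->
    motive_eq G [class Z] ([class Z1] * [class Z2])
| meq_inv_q (L : variety k) : affine_line L ->
    motive_eq G ([class L] * motive_inv inv_q) 1
| meq_inv_qD1 (L : variety k) : affine_line L ->
    motive_eq G (([class L] + 1) * motive_inv inv_qD1) 1
| meq_inv_qB1 (L : variety k) : affine_line L ->
    motive_eq G (([class L] - 1) * motive_inv inv_qB1) 1
| meq_inv_G :
    motive_eq G ([class (alg_group_variety G)] * motive_inv inv_G) 1.

Definition open_embedding (X Y : topologicalType) (f : X -> Y) :=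
  [/\ continuous f, injective f & forall U : set X, open U -> open (f @` U)].

(* The local orientation at the i-th puncture is given by a coordinate disc   *)
(* centred there; it enters only through the sense of its small circles.      *)
Record parabolic (R : realType) (k : closedFieldType) (G : algGroupType k)
    (X : topologicalType) (s : nat) := Parabolic {
  puncture : 'I_s -> X;
  disc : 'I_s -> 'rV[R]_2 -> X;
  holonomy : 'I_s -> set G;
  puncture_inj : injective puncture;
  puncture_smooth : forall i, smooth_point R 1 (puncture i);
  disc_embedding : forall i, open_embedding (disc i);
  disc_center : forall i, disc i 0 = puncture i;
  holonomy_subvariety : forall i, subvariety (holonomy i);
  holonomy_conj : forall i (a b : G), holonomy i a -> holonomy i (a ^ b)%g }.

Definition is_pullback (R : realType) (k : closedFieldType) (G : algGroupType k)
    (X1 X2 : topologicalType) s (f : X1 -> X2)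
    (Q : parabolic R G X2 s) (Q' : parabolic R G X1 s) :=
  [/\ forall i, f (puncture Q' i) = puncture Q i,
      forall i v, f (disc Q' i v) = disc Q i v &
      forall i, holonomy Q' i = holonomy Q i].

Definition circle_point (R : realType) (rho t : R) : 'rV[R]_2 :=
  \row_j (if j == ord0 then rho * cos (2 * pi * t) else rho * sin (2 * pi * t)).

Section Representations.
Variables (R : realType) (k : closedFieldType) (G : algGroupType k).
Variables (X : topologicalType) (s : nat) (Q : parabolic R G X s).
Local Notation I := (unit_interval R).

Definition punctured : topologicalType := set_type (~` range (puncture Q)).

(* Classes of the loops a . c . a^-1, with c the counterclockwise circle of   *)
(* some radius rho in the i-th disc, small enough to enclose no other         *)
(* puncture, and a a path from the base point to c.                           *)
Definition meridian (x0 : punctured) (i : 'I_s) : set (pi1 R x0) :=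
  [set g | exists (rho : R) (x1 : punctured)
      (a : {path I from x0 to x1 in punctured})
      (c : {path I from x1 to x1 in punctured}),
    [/\ 0 < rho,
        (forall (v : 'rV[R]_2) j, \sum_m v ord0 m ^+ 2 <= rho ^+ 2 ->
           disc Q i v = puncture Q j -> j = i),
        (forall t, set_val (c t) = disc Q i (circle_point rho (ival t))) &
        g = loop_class (path_concat a (path_concat c (path_rev a)))]].

Definition representation (x0 : punctured) (rho : pi1 R x0 -> G) :=
  {morph rho : a b / (a * b)%g} /\
  forall i g, meridian i g -> holonomy Q i (rho g).

(* X_G(X, Q) inside the power P = G^n, with projections [pr], by evaluation   *)
(* at [g]. As a variety it is [set_type] of this set, with the induced        *)
(* structure.                                                                 *)
Definition representation_set (x0 : punctured) n (g : 'I_n -> pi1 R x0)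
    (P : funSpaceType k) (pr : 'I_n -> P -> G) : set P :=
  [set v | exists2 rho, representation rho & forall i, pr i v = rho (g i)].
End Representations.

(* Main.v *)
From HB Require Import structures.
Require Import Defs.
From mathcomp Require Import all_boot all_order all_algebra.
From mathcomp Require mpoly.
From mathcomp Require Import all_classical all_reals all_analysis.
From mathcomp Require Import homotopy.
From mathcomp Require Import ring lra zify.

(** A node-surface X is its normalization Sigma with finitely many points
    identified: over a conic point whose link consists of r circles lie r points of
    Sigma, one for each end of the punctured neighbourhood ([fibre_sheets]).  Call
    extra the preimages left after one has been chosen over each point of X; a
    conic point contributes r - 1 of them.  Identifying points of a path connected
    space makes its fundamental group the free product of the old one with a free
    group on the extra points.  So a representation of the group of X is a
    representation of the group of Sigma together with one arbitrary element of G
    for each extra point.  The conditions at the punctures do not notice the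
    identification: meridians of X are images of meridians of Sigma, up to
    conjugation ([meridian_pullback]), and holonomies are conjugation invariant.
    This correspondence is algebraic in both directions, so the representation
    variety of X is the product of that of Sigma and a power of G.

    The free product is obtained without decomposing paths.  A homomorphism from
    the fundamental group to a group K is recorded as a transport, a functor from
    paths to K, and a transport is the same as a flat structure: a sheaf of local
    K-valued primitives, unique up to left translation.  A flat structure has global
    primitives along paths and over squares ([flat_line], [flat_square]), hence a
    holonomy, which is a transport ([transport_hol]).  On a space that is locally
    simple, as node-surfaces are because cones contract ([locally_simple_charts]),
    every transport is the holonomy of the flat structure it defines ([hol_germs]).
    Flat structures push forward along the identification map
    ([flat_push_germs]), which extends every transport of Sigma to X
    ([hol_push_germs]), and the extension is unique ([transport_ext]).  In terms of
    groups this is the universal property [pi1_glued].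

    The universal property holds for every target group K, and that is what makes
    the correspondence algebraic: for a variety T, a family of representations
    parametrized by T is one representation in the group K of morphisms from T to G
    ([representations_power_product]).

    It remains to see that the representation sets are varieties and to compute
    classes.  A representation set is cut out of a power of G by the relations,
    which are closed conditions, and by one condition for each puncture, since
    all meridians of a puncture are conjugate ([meridian_conj]); so it is locally
    closed ([subvariety_representation_set]).  Locally closed subsets of varieties
    are varieties ([variety_sub]), by the Hilbert basis theorem and the Rabinowitsch
    trick.  Finally a product with a power of G has the expected class, by splitting
    off one factor at a time ([power_product_class]). *)

Set Implicit Arguments.
Unset Strict Implicit.
Unset Printing Implicit Defensive.

Import Order.TTheory GRing.Theory Num.Theory.
Import numFieldNormedType.Exports.

Local Open Scope classical_set_scope.

(** * Flat structures and their primitives *)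

Section Flat.
Local Open Scope ring_scope.

Lemma le_itv_l (R : realType) (a b : R) : a <= b -> a <= a <= b.
Proof. by rewrite lexx. Qed.

Lemma le_itv_r (R : realType) (a b : R) : a <= b -> a <= b <= b.
Proof. by move=> ->; rewrite lexx. Qed.

(** The germs of K-valued functions selected by P form a torsor under K acting by
    left translation: P is the sheaf of flat sections of a flat K-bundle, written in
    local trivializations. Primitives are total functions of which only germs matter. *)
Record flat (T : topologicalType) (K : groupType) (P : T -> (T -> K) -> Prop) := Flat {
  flat_ex : forall z, exists phi, P z phi;
  flat_open : forall z phi, P z phi -> \forall w \near z, P w phi;
  flat_uniq : forall z phi psi, P z phi -> P z psi ->
    exists c, \forall w \near z, psi w = (c * phi w)%g;
  flat_shift : forall z phi psi c, P z phi ->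
    (\forall w \near z, psi w = (c * phi w)%g) -> P z psi }.

Lemma flat_eq (T : topologicalType) (K : groupType) (P : T -> (T -> K) -> Prop)
    z phi psi : flat P -> P z phi -> (\forall w \near z, psi w = phi w) -> P z psi.
Proof.
move=> fP Pz e; apply: (flat_shift fP (c := 1%g) Pz).
by near=> w; rewrite mul1g; near: w.
Unshelve. all: by end_near. Qed.

Definition pull_germs (T T' : topologicalType) (K : groupType) (p : T' -> T)
    (P : T -> (T -> K) -> Prop) (t : T') (psi : T' -> K) :=
  exists2 phi, P (p t) phi & \forall w \near t, psi w = phi (p w).

Lemma flat_pull_germs (T T' : topologicalType) (K : groupType) (p : T' -> T)
    (P : T -> (T -> K) -> Prop) : continuous p -> flat P -> flat (pull_germs p P).
Proof.
move=> cp fP; split.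
- move=> z; have [phi Pphi] := flat_ex fP (p z).
  by exists (phi \o p), phi => //; near=> w.
- move=> z psi [phi Pphi e].
  have := near_join e; have := cp _ _ (flat_open fP Pphi) => /= n1 n2.
  near=> w; exists phi; first by near: w.
  by near: w.
- move=> z phi psi [phi' P1 e1] [psi' P2 e2].
  have [c cE] := flat_uniq fP P1 P2; exists c.
  have n := cp _ _ cE; near=> w.
  rewrite (near e1 w)// (near e2 w)//; near: w; exact: n.
- move=> z phi psi c [phi' P1 e1] e2.
  exists (fun w => c * phi' w)%g.
    by apply: (flat_shift fP (c := c) P1); near=> w.
  by near=> w; rewrite (near e2 w)// (near e1 w).
Unshelve. all: by end_near. Qed.

(** Two primitives that differ by a constant along the wall u = b become one after
    translating the second by that constant. *)
Lemma flat_glue (R : realType) (T : topologicalType) (K : groupType)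
    (P : T -> (T -> K) -> Prop) (u : T -> R) (b : R) (psi psi' : T -> K) c (D : set T) :
  flat P -> continuous u ->
  (forall z, D z -> u z <= b -> P z psi) ->
  (forall z, D z -> b <= u z -> P z psi') ->
  (forall z, D z -> u z = b -> \forall w \near z, psi w = (c * psi' w)%g) ->
  exists chi, forall z, D z -> P z chi.
Proof.
move=> fP cu h1 h2 h3.
exists (fun w => if u w <= b then psi w else (c * psi' w)%g) => z Dz.
have [uz|uz|uz] := ltgtP (u z) b.
- apply: (flat_eq fP (h1 z Dz (ltW uz))).
  have n : \forall w \near z, u w < b by exact: (cu z _ (lt_nbhsl uz)).
  by near=> w; rewrite ifT //; apply: ltW; near: w.
- apply: (flat_shift fP (c := c) (h2 z Dz (ltW uz))).
  have n : \forall w \near z, b < u w by exact: (cu z _ (lt_nbhsr uz)).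
  by near=> w; rewrite ifF //; apply/negbTE; rewrite -ltNge; near: w.
- apply: (flat_eq fP (h1 z Dz _)); first by rewrite uz.
  have n := h3 z Dz uz.
  by near=> w; case: ifP => // _; apply/esym; near: w.
Unshelve. all: by end_near. Qed.

(** Compactness of the unit interval in the form used throughout: a property of
    subintervals that holds locally and is additive holds for the whole interval. *)
Lemma interval_chain (R : realType) (E : R -> R -> Prop) :
  (forall a b c, 0 <= a -> a <= b -> b <= c -> c <= 1 -> E a b -> E b c -> E a c) ->
  (forall t : R, 0 <= t -> t <= 1 -> exists2 e : R, 0 < e & forall a b,
    0 <= a -> a <= b -> b <= 1 -> `|a - t| < e -> `|b - t| < e -> E a b) ->
  E 0 1.
Proof.
move=> trE locE.
pose A := [set b | [/\ 0 <= b, b <= 1 & E 0 b]].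
have A0 : A 0.
  split; rewrite ?ler01// .
  have [e e0 h] := locE 0 (lexx _) ler01.
  by apply: h; rewrite ?ler01 ?subrr ?normr0.
have hA : has_sup A.
  by split; [exists 0|exists 1 => b [_ +]].
have s0 : 0 <= sup A by apply: ub_le_sup; first exact: hA.2.
have s1 : sup A <= 1 by apply: ge_sup; [exists 0|move=> b []].
have [e e0 h] := locE _ s0 s1.
have [b [b0 b1 Eb] sb] := sup_adherent e0 hA.
have bs : b <= sup A by apply: ub_le_sup; [exact: hA.2|split].
(* a point of the neighbourhood beyond the supremum, unless the supremum is 1 *)
pose c := Num.min 1 (sup A + e / 2).
have sc : sup A <= c by rewrite /c le_min s1 /=; lra.
have c1 : c <= 1 by rewrite /c ge_min lexx.
have ce : c <= sup A + e / 2 by rewrite /c ge_min lexx orbT.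
have Ec : E 0 c.
  apply: (trE _ b) => //; first exact: le_trans sc.
  apply: h => //; first exact: le_trans sc.
    by rewrite ler0_norm; lra.
  by rewrite ger0_norm; lra.
have cs : c <= sup A.
  apply: ub_le_sup; first exact: hA.2.
  by split => //; exact: le_trans sc.
suff c1' : c = 1 by rewrite -c1'.
rewrite /c; case: leP => // h2; exfalso.
by have := cs; rewrite /c min_r; [lra|exact: ltW].
Qed.

Lemma near_line (R : realType) (t : R) (Q : R -> Prop) :
  (\forall w \near t, Q w) -> exists2 e : R, 0 < e & forall w, `|w - t| < e -> Q w.
Proof.
move/nbhs_ballP => [e e0 h]; exists e => // w wt; apply: h.
by rewrite /ball /= distrC.
Qed.

Lemma near_plane (R : realType) (s t : R) (Q : R * R -> Prop) :
  (\forall w \near (s, t), Q w) ->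
  exists2 e : R, 0 < e & forall a b, `|a - s| < e -> `|b - t| < e -> Q (a, b).
Proof.
move/nbhs_ballP => [e e0 h]; exists e => // a b ha hb; apply: h.
by split; rewrite /ball /= distrC.
Qed.

Lemma line_near (R : realType) (t : R) (Q : R -> Prop) (e : R) : 0 < e ->
  (forall w, `|w - t| < e -> Q w) -> (\forall w \near t, Q w).
Proof.
move=> e0 h; apply/nbhs_ballP; exists e => // w; rewrite /ball /= distrC; exact: h.
Qed.

Lemma flat_line (R : realType) (K : groupType) (P : R -> (R -> K) -> Prop) :
  flat P -> exists psi, forall t : R, 0 <= t <= 1 -> P t psi.
Proof.
move=> fP.
apply: (@interval_chain R (fun a b : R => exists psi, forall t : R, a <= t <= b -> P t psi)).
- move=> a b c a0 ab bc c1 [psi h1] [psi' h2].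
  have [d dE] := flat_uniq fP (h2 b (le_itv_l bc))
    (h1 b (le_itv_r ab)).
  apply: (@flat_glue R _ K P id b psi psi' d [set t | a <= t <= c]) => //.
  + by move=> z; exact: cvg_id.
  + by move=> z /= /andP[az zc] zb; apply: h1; rewrite az.
  + by move=> z /= /andP[az zc] zb; apply: h2; rewrite zb.
  + by move=> z _ ->.
- move=> t t0 t1; have [psi h] := flat_ex fP t.
  have [e e0 he] := near_line (flat_open fP h); exists e => // a b a0 ab b1 ha hb.
  exists psi => w /andP[aw wb]; apply: he.
  by move: ha hb; rewrite !ltr_norml; lra.
Qed.

Lemma flat_line_uniq (R : realType) (K : groupType) (P : R -> (R -> K) -> Prop) psi psi' :
  flat P -> (forall t : R, 0 <= t <= 1 -> P t psi) -> (forall t : R, 0 <= t <= 1 -> P t psi') ->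
  exists c : K, forall t : R, 0 <= t <= 1 -> psi' t = (c * psi t)%g.
Proof.
move=> fP h1 h2.
apply: (@interval_chain R (fun a b : R => exists c : K, forall t : R, a <= t <= b ->
  psi' t = (c * psi t)%g)).
- move=> a b c a0 ab bc c1 [d hd] [d' hd']; exists d => t /andP[ta tc].
  case: (leP t b) => tb; first by apply: hd; rewrite ta.
  have := hd b; have := hd' b; rewrite lexx ab bc => -> // /(_ isT) /mulIg <-.
  by apply: hd'; rewrite (ltW tb).
- move=> t t0 t1; have t01 : 0 <= t <= 1 by rewrite t0.
  have [c cE] := flat_uniq fP (h1 t t01) (h2 t t01).
  have [e e0 he] := near_line cE; exists e => // a b a0 ab b1 ha hb.
  exists c => w /andP[aw wb]; apply: he.
  by move: ha hb; rewrite !ltr_norml; lra.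
Qed.

(** Stage one propagates a primitive along the segment over s, together with a strip
    around it; stage two glues the strips. The translation constant between two strips
    is locally constant along the common wall, hence constant. *)
Lemma flat_square (R : realType) (K : groupType) (P : R * R -> (R * R -> K) -> Prop) :
  flat P -> exists psi, forall s t : R, 0 <= s <= 1 -> 0 <= t <= 1 -> P (s, t) psi.
Proof.
move=> fP.
have strip s : exists psi, exists2 e : R, 0 < e & forall s' t : R,
    `|s' - s| < e -> 0 <= t <= 1 -> P (s', t) psi.
  apply: (@interval_chain R (fun a b : R => exists psi, exists2 e : R, 0 < e &
    forall s' t : R, `|s' - s| < e -> a <= t <= b -> P (s', t) psi)).
  - move=> a b c a0 ab bc c1 [psi [e e0 h1]] [psi' [e' e'0 h2]].
    have ss x : 0 < x -> `|s - s| < x by rewrite subrr normr0.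
    have [d dE] := flat_uniq fP (h2 s b (ss _ e'0) (le_itv_l bc))
      (h1 s b (ss _ e0) (le_itv_r ab)).
    have [f f0 hf] := near_plane (near_join dE).
    pose D := [set w : R * R |
      [/\ `|w.1 - s| < e, `|w.1 - s| < e', `|w.1 - s| < f & a <= w.2 <= c]].
    have [||||chi hchi] := @flat_glue R _ K P snd b psi psi' d D fP.
    + by move=> w; exact: cvg_snd.
    + by move=> [x y] /= [xe _ _ /andP[ay _]] yb; apply: h1; rewrite ?ay.
    + by move=> [x y] /= [_ xe _ /andP[_ yc]] yb; apply: h2; rewrite ?yb.
    + by move=> [x y] /= [_ _ xf _] ->; apply: hf => //; rewrite subrr normr0.
    exists chi, (Num.min e (Num.min e' f)); first by rewrite !lt_min e0 e'0.
    move=> s' t; rewrite !lt_min => /and3P[h3 h4 h5] h6; apply: hchi; split => //.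
  - move=> t t0 t1; have [psi h] := flat_ex fP (s, t).
    have [e e0 he] := near_plane (flat_open fP h); exists e => // a b a0 ab b1 ha hb.
    exists psi, e => // s' w hs /andP[aw wb]; apply: he => //.
    by move: ha hb; rewrite !ltr_norml; lra.
suff [psi h] : exists psi, forall s t : R, 0 <= s <= 1 -> 0 <= t <= 1 -> P (s, t) psi.
  by exists psi.
apply: (@interval_chain R (fun a b : R => exists psi, forall s t : R, a <= s <= b ->
   0 <= t <= 1 -> P (s, t) psi)).
- move=> a b c a0 ab bc c1 [psi h1] [psi' h2].
  have [d hd] : exists d : K, forall t : R, 0 <= t <= 1 ->
      \forall w \near (b, t), psi w = (d * psi' w)%g.
    apply: (@interval_chain R (fun a' b' : R => exists d : K, forall t : R, a' <= t <= b' ->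
      \forall w \near (b, t), psi w = (d * psi' w)%g)).
    + move=> a' b' c' _ ab' bc' _ [d hd] [d' hd']; exists d => t /andP[ta tc].
      case: (leP t b') => tb; first by apply: hd; rewrite ta.
      have := nbhs_singleton (hd b' (le_itv_r ab')).
      have /= -> := nbhs_singleton (hd' b' (le_itv_l bc')).
      by move/mulIg <-; apply: hd'; rewrite (ltW tb).
    + move=> t t0 t1.
      have [] := flat_uniq fP (h2 b t _ _) (h1 b t _ _); rewrite ?ab ?lexx ?t0 ?bc//.
      move=> d dE; have [e e0 he] := near_plane (near_join dE).
      exists e => // a' b' a0' ab' b1' ha hb.
      exists d => w /andP[aw wb]; apply: he; first by rewrite subrr normr0.
      by move: ha hb; rewrite !ltr_norml; lra.
  have [||||chi hchi] := @flat_glue R _ K P fst b psi psi' d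
    [set w | a <= w.1 <= c /\ 0 <= w.2 <= 1] fP.
  + by move=> w; exact: cvg_fst.
  + by move=> [x y] /= [/andP[ax xc] y01] xb; apply: h1 => //; rewrite ax.
  + by move=> [x y] /= [/andP[ax xc] y01] xb; apply: h2 => //; rewrite xb.
  + by move=> [x y] /= [_ y01] ->; exact: hd.
  by exists chi => s t hs ht; exact: hchi.
- move=> s s0 s1; have [psi [e e0 h]] := strip s.
  exists e => // a b a0 ab b1 ha hb; exists psi => s' t /andP[as' bs'] ht.
  by apply: h => //; move: ha hb; rewrite !ltr_norml; lra.
Qed.

End Flat.

(** * Transport along paths and holonomy *)

Section Transport.
Local Open Scope ring_scope.
Variable R : realType.
Local Notation I := (unit_interval R).

(** Paths are handled as plain functions, so that two paths can be composed when
    their ends are equal without being convertible; joinp and revp compute like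
    concatenation and reversal of paths with prescribed ends. *)
Definition joinp (T : Type) (p q : I -> T) : I -> T := fun t =>
  if ival t <= 2^-1 then p (clamp (2 * ival t)) else q (clamp (2 * ival t - 1)).

Definition revp (T : Type) (p : I -> T) : I -> T := fun t => p (clamp (1 - ival t)).

Definition homotopic_fun (T : topologicalType) (p q : I -> T) :=
  exists H : I * I -> T,
    [/\ continuous H, forall t, H (zero, t) = p t, forall t, H (one, t) = q t &
        forall s, H (s, zero) = p zero /\ H (s, one) = p one].

(** A functor from the fundamental groupoid of T to K: composable paths multiply,
    homotopic paths have equal values. *)
Record transport (T : topologicalType) (K : groupType) (h : (I -> T) -> K) := Transport {
  transport_join : forall p q, continuous p -> continuous q -> p one = q zero ->
    h (joinp p q) = (h p * h q)%g;
  transport_homotopic : forall p q, homotopic_fun p q -> h p = h q }.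

Lemma clampK (t : R) : 0 <= t <= 1 -> ival (clamp t) = t.
Proof. exact: ival_clamp. Qed.

Lemma clamp0 : @clamp R 0 = zero. Proof. exact: clamp_le0. Qed.
Lemma clamp1 : @clamp R 1 = one. Proof. exact: clamp_ge1. Qed.

Lemma continuous_aff (T : topologicalType) (u : T -> R) a b :
  continuous u -> continuous (fun x => a * u x + b).
Proof. exact: affine_continuous. Qed.

Lemma continuous_pair (X Y Z : topologicalType) (f : X -> Y) (g : X -> Z) :
  continuous f -> continuous g -> continuous (fun x => (f x, g x)).
Proof. by move=> cf cg x; apply: cvg_pair; [exact: cf|exact: cg]. Qed.

Lemma continuous_fstf (X Y Z : topologicalType) (f : X -> Y) :
  continuous f -> continuous (fun x : X * Z => f x.1).
Proof. by move=> cf x; apply: continuous_comp; [exact: cvg_fst|exact: cf]. Qed.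

Lemma continuous_sndf (X Y Z : topologicalType) (f : X -> Y) :
  continuous f -> continuous (fun x : Z * X => f x.2).
Proof. by move=> cf x; apply: continuous_comp; [exact: cvg_snd|exact: cf]. Qed.

Lemma continuous_addf (X : topologicalType) (f g : X -> R) :
  continuous f -> continuous g -> continuous (fun x => f x + g x).
Proof. by move=> cf cg x; apply: continuousD; [exact: cf|exact: cg]. Qed.

Lemma continuous_mulf (X : topologicalType) (f g : X -> R) :
  continuous f -> continuous g -> continuous (fun x => f x * g x).
Proof. by move=> cf cg x; apply: continuousM; [exact: cf|exact: cg]. Qed.

Lemma continuous_cstf (X Y : topologicalType) (y : Y) : continuous (fun _ : X => y).
Proof. by move=> x; exact: cst_continuous. Qed.

Lemma continuous_joinp (T : topologicalType) (p q : I -> T) :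
  continuous p -> continuous q -> p one = q zero -> continuous (joinp p q).
Proof.
move=> cp cq pq; apply: continuous_glue; first exact: ival_continuous.
- apply: (continuous_post cp); apply: clamp_comp_continuous.
  by apply: continuous_mulf; [exact: continuous_cstf|exact: ival_continuous].
- apply: (continuous_post cq); apply: clamp_comp_continuous.
  by apply: continuous_aff; exact: ival_continuous.
- move=> t ->; rewrite mulfV ?pnatr_eq0// subrr clamp0 clamp1; exact: pq.
Qed.

Lemma joinp0 (T : Type) (p q : I -> T) : joinp p q zero = p zero.
Proof. by rewrite /joinp ival0 invr_ge0 ler0n mulr0 clamp0. Qed.

Lemma joinp1 (T : Type) (p q : I -> T) : joinp p q one = q one.
Proof.
rewrite /joinp ival1 ifF; last by apply/negbTE; rewrite -ltNge; lra.
by rewrite mulr1 (_ : 2 - 1 = 1) ?clamp1//; lra.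
Qed.

Lemma continuous_revp (T : topologicalType) (p : I -> T) :
  continuous p -> continuous (revp p).
Proof.
move=> cp; apply: (continuous_post cp); apply: clamp_comp_continuous.
have -> : (fun x : I => 1 - ival x) = (fun x : I => -1 * ival x + 1).
  by apply/funext => x; rewrite mulN1r addrC.
by apply: continuous_aff; exact: ival_continuous.
Qed.

Lemma revp0 (T : Type) (p : I -> T) : revp p zero = p one.
Proof. by rewrite /revp ival0 subr0 clamp1. Qed.

Lemma revp1 (T : Type) (p : I -> T) : revp p one = p zero.
Proof. by rewrite /revp ival1 subrr clamp0. Qed.

(** The plane is convex: the straight-line homotopy between u and v, followed by g. *)
Lemma homotopic_plane (T : topologicalType) (g : R * R -> T) (u v : I -> R * R) :
  continuous g -> continuous u -> continuous v -> u zero = v zero -> u one = v one ->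
  homotopic_fun (g \o u) (g \o v).
Proof.
move=> cg cu cv e0 e1.
have c1 (w : I -> R * R) : continuous w -> continuous (fun x : I * I => (w x.2).1).
  by move=> cw; apply: (continuous_sndf (f := fun y => (w y).1)) => x;
     apply: continuous_comp; [exact: cw|exact: cvg_fst].
have c2 (w : I -> R * R) : continuous w -> continuous (fun x : I * I => (w x.2).2).
  by move=> cw; apply: (continuous_sndf (f := fun y => (w y).2)) => x;
     apply: continuous_comp; [exact: cw|exact: cvg_snd].
have ci : continuous (fun x : I * I => ival x.1) by exact: ival_fst_continuous.
have cj : continuous (fun x : I * I => -1 * ival x.1 + 1) by exact: continuous_aff.
exists (fun x => g ((-1 * ival x.1 + 1) * (u x.2).1 + ival x.1 * (v x.2).1,
                    (-1 * ival x.1 + 1) * (u x.2).2 + ival x.1 * (v x.2).2)).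
split.
- apply: (continuous_post cg); apply: continuous_pair; apply: continuous_addf;
    apply: continuous_mulf => //; by [exact: c1|exact: c2].
- by move=> t /=; rewrite ival0 !(mulr0, mul0r, add0r, addr0, mul1r) -surjective_pairing.
- by move=> t /=; rewrite ival1 !(mulr1, addNr, mul0r, add0r, mul1r) -surjective_pairing.
- move=> s /=; rewrite -e0 -e1 -!mulrDl !mulN1r addrAC addNr add0r !mul1r.
  by rewrite -!surjective_pairing.
Qed.

Definition plane_seg (a b : R * R) : I -> R * R := fun t =>
  ((b.1 - a.1) * ival t + a.1, (b.2 - a.2) * ival t + a.2).

Lemma continuous_plane_seg a b : continuous (plane_seg a b).
Proof. by apply: continuous_pair; apply: continuous_aff; exact: ival_continuous. Qed.

Lemma plane_seg0 a b : plane_seg a b zero = a.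
Proof. by rewrite /plane_seg ival0 !mulr0 !add0r -surjective_pairing. Qed.

Lemma plane_seg1 a b : plane_seg a b one = b.
Proof. by rewrite /plane_seg ival1 !mulr1 !subrK -surjective_pairing. Qed.

Section Facts.
Variables (T : topologicalType) (K : groupType) (h : (I -> T) -> K).
Hypothesis hT : transport h.

Lemma transport_plane (g : R * R -> T) (u v : I -> R * R) :
  continuous g -> continuous u -> continuous v -> u zero = v zero -> u one = v one ->
  h (g \o u) = h (g \o v).
Proof. by move=> *; apply: (transport_homotopic hT); exact: homotopic_plane. Qed.

(** Composition up to reparametrization, and every cancellation of a path against its
    inverse, are instances of this identity for a suitable map g from the plane. *)
Lemma transport_plane_join (g : R * R -> T) (u v w : I -> R * R) :
  continuous g -> continuous u -> continuous v -> continuous w ->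
  u zero = w zero -> u one = v zero -> v one = w one ->
  h (g \o w) = (h (g \o u) * h (g \o v))%g.
Proof.
move=> cg cu cv cw e0 e1 e2.
rewrite -(transport_join hT); [|exact: continuous_post..|by rewrite /= e1].
rewrite (_ : joinp _ _ = g \o joinp u v); last first.
  by apply/funext => t; rewrite /joinp /=; case: ifP.
apply: transport_plane => //; first exact: continuous_joinp.
  by rewrite joinp0.
by rewrite joinp1.
Qed.

Lemma transport_cst x : h (fun=> x) = 1%g.
Proof.
apply: (mulgI (h (fun=> x))); rewrite mulg1.
rewrite -(transport_join hT) //; do ?exact: continuous_cstf.
by congr h; apply/funext => t; rewrite /joinp; case: ifP.
Qed.

Lemma transport_rev p : continuous p -> h (revp p) = (h p)^-1%g.
Proof.
move=> cp; apply: (mulgI (h p)); rewrite mulgV.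
pose g (x : R * R) := p (clamp x.1).
have cg : continuous g.
  apply: (continuous_post cp); apply: clamp_comp_continuous => x; exact: cvg_fst.
have e1 : p = g \o plane_seg (0, 0) (1, 0).
  by apply/funext => t; rewrite /g /= subr0 mul1r addr0 ivalK.
have e2 : revp p = g \o plane_seg (1, 0) (0, 0).
  by apply/funext => t; rewrite /g /= /revp sub0r mulN1r addrC.
rewrite -(transport_cst (g (0, 0))) e2 {1}e1.
rewrite (_ : (fun=> g (0, 0)) = g \o (fun=> (0, 0))) //.
apply/esym/transport_plane_join => //; try exact: continuous_plane_seg.
- exact: continuous_cstf.
- by rewrite plane_seg0.
- by rewrite plane_seg0 plane_seg1.
- by rewrite plane_seg1.
Qed.

Lemma transport_square (g : R * R -> T) a b c d : continuous g ->
  (h (g \o plane_seg a b) * h (g \o plane_seg b d) = h (g \o plane_seg a c) * h (g \o plane_seg c d))%g.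
Proof.
move=> cg; rewrite -!(@transport_plane_join g _ _ (plane_seg a d)) //;
  by [exact: continuous_plane_seg|rewrite ?plane_seg0 ?plane_seg1].
Qed.

End Facts.

Section Holonomy.
Variables (T : topologicalType) (K : groupType) (P : T -> (T -> K) -> Prop).

Definition is_primitive (p : I -> T) (psi : R -> K) :=
  forall t, 0 <= t <= 1 -> pull_germs (p \o @clamp R) P t psi.

(** The ratio of the values of a primitive at the two ends does not depend on the
    primitive, since two of them differ by a left translation. *)
Definition hol (p : I -> T) : K :=
  if pselect (exists psi, is_primitive p psi) is left e then
    ((sval (cid e) 0%R)^-1 * sval (cid e) 1%R)%g else 1%g.

Hypothesis fP : flat P.

Lemma continuous_clamp_post (p : I -> T) : continuous p -> continuous (p \o @clamp R).
Proof. by move=> cp; apply: (continuous_post cp); exact: clamp_continuous. Qed.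

Lemma holE p psi : continuous p -> is_primitive p psi -> hol p = ((psi 0%R)^-1 * psi 1%R)%g.
Proof.
move=> cp ppsi; rewrite /hol; case: pselect => [e|[]]; last by exists psi.
case: cid => psi' /= ppsi'.
have [c cE] := flat_line_uniq (flat_pull_germs (continuous_clamp_post cp) fP) ppsi ppsi'.
by rewrite !cE ?lexx ?ler01// invgM mulgA mulgVK.
Qed.

(** A primitive over a larger parameter space computes the holonomy of every path
    traced inside it. *)
Lemma hol_sub (T' : topologicalType) (g : T' -> T) (psi : T' -> K) (D : set T')
    (sigma : R -> T') (p : I -> T) :
  continuous sigma -> (forall z, D z -> pull_germs g P z psi) ->
  (forall t, 0 <= t <= 1 -> D (sigma t)) ->
  continuous p -> (forall t, p (clamp t) = g (sigma t)) ->
  hol p = ((psi (sigma 0%R))^-1 * psi (sigma 1%R))%g.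
Proof.
move=> cs hpsi hD cp pg; apply: (holE (psi := psi \o sigma)) => // t t01.
have [phi h1 h2] := hpsi _ (hD _ t01).
exists phi; first by rewrite /= pg.
have := cs t _ h2 => /= n; near=> w; rewrite /= pg; near: w; exact: n.
Unshelve. all: by end_near. Qed.

Lemma hol_cst x : hol (fun=> x) = 1%g.
Proof.
rewrite (holE (psi := fun=> 1%g)) ?mulg1 ?invg1//; first exact: continuous_cstf.
move=> t t01 /=; have [phi h] := flat_ex fP x.
exists (fun z => (phi x)^-1 * phi z)%g.
  by apply: (flat_shift fP h); near=> w.
by near=> w; rewrite mulVg.
Unshelve. all: by end_near. Qed.

(** A primitive along a concatenation restricts to both halves; a primitive over the
    square of a homotopy is constant on the two sides where the homotopy is constant. *)
Lemma transport_hol : transport hol.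
Proof.
split.
- move=> p q cp cq pq; have cj := continuous_joinp cp cq pq.
  have [psi hpsi] := flat_line (flat_pull_germs (continuous_clamp_post cj) fP).
  pose D := [set t : R | 0 <= t <= 1].
  (* the halves of psi are clamped: beyond its end a path stays at its end point, while
     the concatenation moves on *)
  have ccl : continuous (fun t : R => ival (clamp t)).
    by move=> t; apply: continuous_comp; [exact: clamp_continuous|exact: ival_continuous].
  rewrite (holE cj hpsi).
  rewrite (@hol_sub R (joinp p q \o @clamp R) psi D (fun t => 2^-1 * ival (clamp t) + 0) p) //.
  + rewrite (@hol_sub R (joinp p q \o @clamp R) psi D
      (fun t => 2^-1 * ival (clamp t) + 2^-1) q) //.
    * rewrite !clampK ?lexx ?ler01// !mulr0 !mulr1 !addr0 !add0r.
      by rewrite (_ : 2^-1 + 2^-1 = 1 :> R) ?mulgA ?mulgK//; lra.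
    * exact: continuous_aff.
    * by move=> t t01; rewrite /D /= clampK//; lra.
    * move=> t; rewrite -[in LHS](ivalK (clamp t)); have := ival_bounds (clamp t).
      move: (ival (clamp t)) => u u01; rewrite /= /joinp clampK; last lra.
      case: ifP => h.
        have -> : u = 0 by lra.
        by rewrite mulr0 add0r mulfV ?pnatr_eq0// clamp1 clamp0 pq.
      by congr (q (clamp _)); lra.
  + exact: continuous_aff.
  + by move=> t t01; rewrite /D /= clampK//; lra.
  + move=> t; rewrite -[in LHS](ivalK (clamp t)); have := ival_bounds (clamp t).
    move: (ival (clamp t)) => u u01; rewrite /= /joinp clampK; last lra.
    by rewrite ifT; [congr (p (clamp _)); lra|lra].
- move=> p q [H [cH H0 H1 Hs]].
  pose g (x : R * R) := H (clamp x.1, clamp x.2).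
  have cg : continuous g.
    apply: (continuous_post cH); apply: continuous_pair; apply: clamp_comp_continuous => x.
      exact: cvg_fst.
    exact: cvg_snd.
  have [psi hpsi] := flat_square (flat_pull_germs cg fP).
  pose D := [set x : R * R | 0 <= x.1 <= 1 /\ 0 <= x.2 <= 1].
  have hD z : D z -> pull_germs g P z psi by case: z => s t [] /=; exact: hpsi.
  have cpair (f : I -> I * I) : continuous f -> continuous (H \o f).
    by move=> cf; apply: (continuous_post cH).
  have cp : continuous p.
    rewrite (_ : p = H \o (fun t => (zero, t))); last by apply/funext => t; rewrite /= H0.
    by apply: cpair; apply: continuous_pair; [exact: continuous_cstf|move=> ?; exact: cvg_id].
  have cq : continuous q.
    rewrite (_ : q = H \o (fun t => (one, t))); last by apply/funext => t; rewrite /= H1.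
    by apply: cpair; apply: continuous_pair; [exact: continuous_cstf|move=> ?; exact: cvg_id].
  have i01 : 0 <= (0 : R) <= 1 by rewrite lexx ler01.
  have i11 : 0 <= (1 : R) <= 1 by rewrite lexx ler01.
  have cid' : continuous (fun t : R => t) by move=> ?; exact: cvg_id.
  rewrite (@hol_sub _ g psi D (fun t => (0, t)) p) //; last 2 first.
  + by apply: (continuous_pair (f := fun=> 0 : R)) => //; exact: continuous_cstf.
  + by move=> t; rewrite /g /= clamp0 H0.
  rewrite (@hol_sub _ g psi D (fun t => (1, t)) q) //; last 2 first.
  + by apply: (continuous_pair (f := fun=> 1 : R)) => //; exact: continuous_cstf.
  + by move=> t; rewrite /g /= clamp1 H1.
  (* the sides of the homotopy are constant paths, which have trivial holonomy *)
  have side (b : R) x : 0 <= b <= 1 -> (forall s, H (s, clamp b) = x) ->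
      psi (0, b) = psi (1, b).
    move=> b01 hb.
    have := hol_cst x; rewrite (@hol_sub _ g psi D (fun t => (t, b)) (fun=> x)) //.
    + by move=> e; rewrite -[RHS](mulVKg (psi (0, b))) e mulg1.
    + by apply: (continuous_pair (g := fun=> b)) => //; exact: continuous_cstf.
    + exact: continuous_cstf.
    + by move=> t; rewrite /g /= hb.
  rewrite (side 0 (p zero)) //; last by move=> s; rewrite clamp0; case: (Hs s).
  by rewrite (side 1 (p one)) //; move=> s; rewrite clamp1; case: (Hs s).
Qed.

End Holonomy.
End Transport.

(** * Transports as flat structures, and their extension along a gluing map *)

Section Extension.
Local Open Scope ring_scope.
Variable R : realType.
Local Notation I := (unit_interval R).

(** Local path connectedness, and a weak form of semi-local simple connectedness: only
    the equality of the values of all transports is asked for, which is what a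
    contraction that moves the base point proves directly. *)
Record locally_simple (T : topologicalType) := LocallySimple {
  local_paths : forall (z : T) N, nbhs z N -> \forall v \near z,
    exists p : I -> T, [/\ continuous p, p zero = z, p one = v & forall t, N (p t)];
  local_homotopies : forall z : T, exists2 N, nbhs z N &
    forall (K : groupType) (h : (I -> T) -> K) (p q : I -> T),
      transport h -> continuous p -> continuous q ->
      (forall t, N (p t)) -> (forall t, N (q t)) ->
      p zero = q zero -> p one = q one -> h p = h q }.

(** The functions whose increments are given by h on short paths. *)
Definition germs (T : topologicalType) (K : groupType) (h : (I -> T) -> K)
    (z : T) (phi : T -> K) :=
  exists2 N, nbhs z N & forall q : I -> T, continuous q -> (forall t, N (q t)) ->
    h q = ((phi (q zero))^-1 * phi (q one))%g.

Section Germ.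
Variables (T : topologicalType) (K : groupType) (h : (I -> T) -> K).
Hypotheses (hT : transport h) (lT : locally_simple T).

(** A primitive at z is the value of h on a path from z, chosen inside a simple
    neighbourhood. *)
Lemma flat_germs : flat (germs h).
Proof.
split.
- move=> z; have [N Nz hN] := local_homotopies lT z.
  have lp := local_paths lT Nz.
  pose N' := [set v | exists p : I -> T,
    [/\ continuous p, p zero = z, p one = v & forall t, N (p t)]].
  pose path v := if pselect (N' v) is left e then sval (cid e) else fun=> z.
  exists (h \o path), (N `&` N'); first exact: filterI.
  move=> q cq qN; rewrite /= /path.
  case: pselect => [e0|[]]; last exact: (qN zero).2.
  case: pselect => [e1|[]]; last exact: (qN one).2.
  case: cid => p0 /= [c0 p00 p01 p0N]; case: cid => p1 /= [c1 p10 p11 p1N].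
  apply: (mulgI (h p0)); rewrite mulVKg -(transport_join hT)//.
  apply: hN => //.
  + exact: continuous_joinp.
  + by move=> t; rewrite /joinp; case: ifP => _; [exact: p0N|exact: (qN _).1].
  + by rewrite joinp0 p00.
  + by rewrite joinp1.
- move=> z phi [N Nz hN].
  by near=> w; exists N => //; near: w; exact: near_join.
- move=> z phi psi [N Nz hN] [N' Nz' hN'].
  exists (psi z * (phi z)^-1)%g.
  have nn : nbhs z (N `&` N') by exact: filterI.
  have lp := local_paths lT nn.
  near=> w; have [|p [cp p0 p1 pN]] := near lp w; first by [].
  rewrite -mulgA -{1}p0 -p1 -p0 -hN ?hN' ?mulVKg//; by move=> t; case: (pN t).
- move=> z phi psi c [N Nz hN] e; exists (N `&` [set w | psi w = (c * phi w)%g]).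
    exact: filterI.
  move=> q cq qN; rewrite hN //; last by move=> t; case: (qN t).
  by rewrite (qN zero).2 (qN one).2 invgM mulgA mulgVK.
Unshelve. all: by end_near. Qed.

(** The value of h on the initial segments of a path is a primitive along it. *)
Lemma hol_germs p : continuous p -> hol (germs h) p = h p.
Proof.
move=> cp.
pose sub a b (t : I) := p (clamp ((b - a) * ival t + a)).
pose g (x : R * R) := p (clamp x.1).
have cg : continuous g.
  by apply: (continuous_post cp); apply: clamp_comp_continuous => x; exact: cvg_fst.
have subE a b : sub a b = g \o plane_seg (a, 0) (b, 0) by [].
have subM a b c : h (sub a c) = (h (sub a b) * h (sub b c))%g.
  rewrite !subE; apply: (transport_plane_join hT) => //; try exact: continuous_plane_seg.
  - by rewrite !plane_seg0.
  - by rewrite plane_seg0 plane_seg1.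
  - by rewrite !plane_seg1.
have csub a b : continuous (sub a b).
  by rewrite subE; apply: (continuous_post cg); exact: continuous_plane_seg.
rewrite (holE flat_germs cp (psi := fun t => h (sub 0 t))); last first.
  move=> t t01; have [phi [N Nz hN]] := flat_ex flat_germs (p (clamp t)).
  exists (fun z => h (sub 0 t) * (phi (p (clamp t)))^-1 * phi z)%g.
    apply: (flat_shift flat_germs (phi := phi)); first by exists N.
    by near=> w.
  have [e e0 he] := near_line (continuous_clamp_post cp Nz).
  apply: (line_near e0) => w wt.
  rewrite (subM 0 t w) -!mulgA; congr (_ * _)%g.
  rewrite hN //.
    by rewrite /sub ival0 ival1 mulr0 mulr1 add0r subrK.
  move=> u; apply: he; rewrite addrK normrM.
  have /andP[u0 u1] := ival_bounds u.
  rewrite (ger0_norm u0); apply: le_lt_trans wt.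
  by rewrite ler_piMr.
rewrite (_ : sub 0 0 = fun=> p zero); last first.
  by apply/funext => t; rewrite /sub subrr mul0r addr0 clamp0.
rewrite (transport_cst hT) invg1 mul1g; congr h.
by apply/funext => t; rewrite /sub subr0 mul1r addr0 ivalK.
Unshelve. all: by end_near. Qed.

End Germ.

Lemma transport_post (Y Z : topologicalType) (K : groupType) (f : Y -> Z)
    (h : (I -> Z) -> K) :
  continuous f -> transport h -> transport (fun q => h (f \o q)).
Proof.
move=> cf th; split=> [q q' cq cq' qq'|q q' [H [cH H0 H1 Hs]]].
  rewrite -(transport_join th); [|exact: continuous_post..|by rewrite /= qq'].
  by congr h; apply/funext => t; rewrite /joinp /=; case: ifP.
apply: (transport_homotopic th); exists (f \o H); split=> /=.
- exact: continuous_post.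
- by move=> t; rewrite H0.
- by move=> t; rewrite H1.
- by move=> s; have [-> ->] := Hs s.
Qed.

(** A closed surjection with finite fibres that is injective away from a discrete set
    of values: the target is the source with finite sets of points identified, with
    the quotient topology. *)
Record gluing (Y Z : topologicalType) (f : Y -> Z) := Gluing {
  gluing_continuous : continuous f;
  gluing_surj : forall z, exists y, f y = z;
  gluing_finite : forall z, finite_set (f @^-1` [set z]);
  gluing_closed : forall z (O : set Y), (forall y, f y = z -> nbhs y O) ->
    \forall w \near z, forall y, f y = w -> O y;
  gluing_inj : forall z, \forall w \near z,
    w = z \/ forall y y', f y = w -> f y' = w -> y = y' }.

(** A function downstairs is a primitive when its pullback is one at every point of the
    fibre; at a glued point the primitives upstairs are thus required to take the same
    value, which is a normalization and not a restriction. *)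
Definition push_germs (Y Z : topologicalType) (K : groupType) (f : Y -> Z)
    (P : Y -> (Y -> K) -> Prop) (z : Z) (phi : Z -> K) :=
  forall y, f y = z -> P y (phi \o f).

Lemma hausdorff_separate (Y : topologicalType) (a : Y) (s : seq Y) :
  hausdorff_space Y -> a \notin s ->
  exists U V : set Y, [/\ nbhs a U, forall y, y \in s -> nbhs y V & U `&` V = set0].
Proof.
move=> hY; elim: s => [|b s IH].
  by move=> _; exists setT, set0; split; [exact: filterT| |rewrite setI0].
rewrite inE negb_or => /andP[ab as_]; have [U [V [aU sV UV]]] := IH as_.
move: hY; rewrite open_hausdorff => /(_ a b ab) [[A B] /= [aA bB] [oA oB AB]].
exists (U `&` A), (V `|` B); split.
- apply: filterI => //; apply: open_nbhs_nbhs; split => //; exact: set_mem.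
- move=> y; rewrite inE => /orP[/eqP->|ys].
    have nB : nbhs b B by apply: open_nbhs_nbhs; split => //; exact: set_mem.
    by apply: filterS nB => w; right.
  by apply: filterS (sV _ ys) => w; left.
- rewrite -subset0 => y [[Uy Ay] [Vy|By]]; first by rewrite -UV.
  by rewrite -(eqP AB).
Qed.

(** The points have disjoint neighbourhoods. *)
Lemma hausdorff_finite_glue (Y : topologicalType) (K : Type) (k0 : K) (F : set Y)
    (phi : Y -> Y -> K) : hausdorff_space Y -> finite_set F ->
  exists psi : Y -> K, forall y, F y -> \forall w \near y, psi w = phi y w.
Proof.
move=> hY /finite_seqP[s ->].
suff [psi h] : exists psi : Y -> K, forall y, y \in s -> \forall w \near y, psi w = phi y w.
  by exists psi.
elim: s => [|a s [psi hpsi]]; first by exists (fun=> k0).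
have [as_|as_] := boolP (a \in s).
  by exists psi => y; rewrite inE => /orP[/eqP->|]; exact: hpsi.
have [U [V [aU sV UV]]] := hausdorff_separate hY as_.
exists (fun w => if pselect (U w) then phi a w else psi w) => y.
rewrite inE => /orP[/eqP->|ys].
  by apply: filterS aU => w Uw; case: pselect.
have nV := sV _ ys; have np := hpsi _ ys.
apply: filterS2 nV np => w Vw e; case: pselect => [Uw|//].
suff : (set0 : set Y) w by [].
by rewrite -UV.
Qed.

Section Push.
Variables (Y Z : topologicalType) (K : groupType) (f : Y -> Z).
Hypotheses (gf : gluing f) (hY : hausdorff_space Y).

(** At z take the primitives upstairs that are equal to 1 at the points of the fibre;
    as they agree there, they descend to a neighbourhood of z. *)
Lemma flat_push_germs (P : Y -> (Y -> K) -> Prop) : flat P -> flat (push_germs f P).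
Proof.
move=> fP; have cf := gluing_continuous gf; split.
- move=> z; pose F := f @^-1` [set z].
  have phiP y : exists phi, P y phi /\ phi y = 1%g.
    have [phi h] := flat_ex fP y; exists (fun w => (phi y)^-1 * phi w)%g.
    by rewrite mulVg; split => //; apply: (flat_shift fP h); near=> w.
  pose phi y := sval (cid (phiP y)).
  have phi1 y : P y (phi y) by rewrite /phi; case: cid => ? [].
  have phi2 y : phi y y = 1%g by rewrite /phi; case: cid => ? [].
  have [psi hpsi] := hausdorff_finite_glue (1%g : K) phi hY (gluing_finite gf z).
  pose g w := sval (cid (gluing_surj gf w)).
  have gK w : f (g w) = w by rewrite /g; case: cid.
  exists (psi \o g) => y fy; apply: (flat_eq fP (phi1 y)).
  have n1 := hpsi y fy.
  have n2 : \forall w \near y, f w = z \/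
      forall y1 y2, f y1 = f w -> f y2 = f w -> y1 = y2.
    by move: (gluing_inj gf z); rewrite -fy => n; exact: (cf y _ n).
  apply: filterS2 n1 n2 => w e [fw|inj] /=; last by rewrite (inj (g (f w)) w).
  rewrite fw; have -> : psi (g z) = 1%g.
    by rewrite (nbhs_singleton (hpsi _ (gK z))) phi2.
  by rewrite -e (nbhs_singleton (hpsi w _)) ?phi2.
- move=> z phi Pphi.
  have n := gluing_closed gf (O := [set y | P y (phi \o f)]) (z := z).
  by apply: n => y fy; exact: (flat_open fP (Pphi y fy)).
- move=> z phi psi Pphi Ppsi; exists (psi z * (phi z)^-1)%g.
  have n := gluing_closed gf (z := z)
    (O := [set y | psi (f y) = (psi z * (phi z)^-1 * phi (f y))%g]).
  have {}n : \forall w \near z, forall y, f y = w ->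
      psi (f y) = (psi z * (phi z)^-1 * phi (f y))%g.
    apply: n => y fy; have [c cE] := flat_uniq fP (Pphi y fy) (Ppsi y fy).
    have := nbhs_singleton cE; rewrite /= fy => e.
    by near=> w; rewrite /= e mulgK; near: w.
  near=> w; have [y yw] := gluing_surj gf w.
  by rewrite -yw; apply: (near n w).
- move=> z phi psi c Pphi e y fy; apply: (flat_shift fP (c := c) (Pphi y fy)).
  by move: e; rewrite -fy => n; exact: (cf y _ n).
Unshelve. all: by end_near. Qed.

(** A primitive along the image of a path, for the pushed flat structure, is also a
    primitive along the path itself. *)
Lemma hol_push_germs (h : (I -> Y) -> K) (q : I -> Y) : transport h -> locally_simple Y ->
  continuous q -> hol (push_germs f (germs h)) (f \o q) = h q.
Proof.
move=> hT lY cq; have fg := flat_germs hT lY; have fp := flat_push_germs fg.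
have cfq : continuous (f \o q) by exact: (continuous_post (gluing_continuous gf)).
have [psi hpsi] := flat_line (flat_pull_germs (continuous_clamp_post cfq) fp).
rewrite (holE fp cfq hpsi) -(hol_germs hT lY cq) (holE fg cq (psi := psi)) // => t t01.
have [phi h1 h2] := hpsi t t01.
by exists (phi \o f) => //; exact: h1.
Qed.

(** The primitives of a transport of Z pull back to primitives upstairs, hence are
    primitives of the pushed flat structure, which depends only on the transport of
    Y. So both transports are the holonomy of the same structure. *)
Lemma transport_ext (h1 h2 : (I -> Z) -> K) : transport h1 -> transport h2 ->
  locally_simple Y -> locally_simple Z ->
  (forall q, continuous q -> h1 (f \o q) = h2 (f \o q)) ->
  forall p, continuous p -> h1 p = h2 p.
Proof.
move=> t1 t2 lY lZ h12 p cp; have cf := gluing_continuous gf.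
pose h q := h1 (f \o q).
have th : transport h := transport_post cf t1.
have fp := flat_push_germs (flat_germs th lY).
suff key h' : transport h' -> (forall q, continuous q -> h' (f \o q) = h q) ->
    h' p = hol (push_germs f (germs h)) p.
  by rewrite !key // => q cq; rewrite -h12.
move=> t' e; rewrite -(hol_germs t' lZ cp).
have [psi hpsi] := flat_line (flat_pull_germs (continuous_clamp_post cp) (flat_germs t' lZ)).
rewrite (holE (flat_germs t' lZ) cp hpsi) (holE fp cp (psi := psi)) // => t t01.
have [phi [N Nz hN] n2] := hpsi t t01; exists phi => // y fy.
exists (f @^-1` N); first by move: Nz; rewrite -fy => n; exact: (cf y _ n).
by move=> q cq qN; rewrite -e // hN //; exact: continuous_post.
Qed.

End Push.
End Extension.

(** * Conical charts *)

Section Charts.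
Local Open Scope ring_scope.
Variable R : realType.
Local Notation I := (unit_interval R).

(** Polar coordinates at p with link B, of which only the values at radii in the unit
    interval matter. The last three fields replace the quotient topology of the cone:
    small radii give small neighbourhoods, and balls and sets away from the vertex
    are open. *)
Record chart (X : topologicalType) (p : X) (B : topologicalType) (k : B * R -> X) :=
  Chart {
  chart_inhabited : inhabited B;
  chart_continuous : continuous k;
  chart_vertex : forall b, k (b, 0) = p;
  chart_inj : forall b b' t t', 0 <= t <= 1 -> 0 <= t' <= 1 -> k (b, t) = k (b', t') ->
    t = t' /\ (0 < t -> b = b');
  chart_small : forall N, nbhs p N -> exists2 e : R, 0 < e <= 1 &
    forall b t, 0 <= t <= e -> N (k (b, t));
  chart_ball : forall e : R, 0 < e <= 1 ->
    open [set x | exists b t, 0 <= t < e /\ x = k (b, t)];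
  chart_open : forall O : set (B * R), open O -> (forall u, O u -> 0 < u.2 < 1) ->
    open (k @` O) }.

Lemma chart_neq (X : topologicalType) (p : X) (B : topologicalType) (k : B * R -> X) b t :
  chart p k -> 0 < t <= 1 -> k (b, t) <> p.
Proof.
move=> ck te; rewrite -(chart_vertex ck b) => /(chart_inj ck)[||t0 _]; lra.
Qed.

Lemma set_val_inj (X : Type) (A : set X) : injective (@set_val X A).
Proof. by move=> u v; rewrite set_valE => /val_inj. Qed.

Lemma set_val_mk (X : Type) (A : set X) (x : X) (e : x \in A) :
  set_val (SigSub e : set_type A) = x.
Proof. by rewrite set_valE. Qed.

Lemma open_set_type (X : topologicalType) (A : set X) (W : set (set_type A)) :
  open A -> open W -> open (set_val @` W).
Proof.
move=> oA [V oV <-]; rewrite (_ : _ @` _ = A `&` V); first exact: openI.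
apply/seteqP; split=> [_ [w Vw <-]|x [Ax Vx]].
  by split; [exact: (set_valP w)|].
by exists (SigSub (mem_set Ax)) => //=; rewrite set_valE.
Qed.

Fact half_subproof (t : R) : 2^-1 * ival (clamp t) \in `[(0 : R), 1[%classic.
Proof.
have := ival_bounds (clamp t); rewrite inE /= in_itv /= => h.
by apply/andP; split; lra.
Qed.

(** Halving the radius turns the half-open cone into a chart defined up to radius 1,
    and the clamping makes it continuous on the whole real line. *)
Definition half_radius (t : R) : set_type `[(0 : R), 1[%classic := SigSub (half_subproof t).

Lemma half_radiusE t : 0 <= t <= 1 -> set_val (half_radius t) = 2^-1 * t.
Proof. by move=> t01; rewrite set_valE /= clampK. Qed.

Lemma continuous_half : continuous half_radius.
Proof.
apply: continuous_comp_initial.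
rewrite (_ : _ \o _ = fun t => 2^-1 * ival (clamp t)); last first.
  by apply/funext => t; rewrite /= set_valE.
apply: continuous_mulf; first exact: continuous_cstf.
by move=> t; apply: continuous_comp; [exact: clamp_continuous|exact: ival_continuous].
Qed.

(** Compactness of the link bounds from below the size of the neighbourhoods of the
    vertex, by the tube lemma. *)
Lemma chart_of_cone (X : topologicalType) (p : X) (B : topologicalType) :
  inhabited B -> compact [set: B] -> cone_neighbourhood R B p ->
  exists k : B * R -> X, chart p k.
Proof.
move=> iB cB [U [h [oU Up [hi [ch chi hK hiK]] hp]]].
pose k (u : B * R) := set_val (h (cone_pi (u.1, half_radius u.2))).
have sv : continuous (@set_val X U) by exact: initial_continuous.
have ck : continuous k.
  apply: (continuous_post sv); apply: (continuous_post ch).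
  have cpi : continuous (@cone_pi R B) by exact: pi_continuous.
  apply: (continuous_post cpi); apply: continuous_pair => u; first exact: cvg_fst.
  by apply: continuous_comp; [exact: cvg_snd|exact: continuous_half].
have kopen (W : set (cone R B)) : open W -> open ((set_val \o h) @` W).
  move=> oW; rewrite -image_comp; apply: open_set_type => //.
  rewrite (_ : h @` W = hi @^-1` W); first by move/continuousP : chi; apply.
  apply/seteqP; split=> [_ [w Ww <-]|w Ww] /=; first by rewrite hK.
  by exists (hi w) => //; rewrite hiK.
have copen (W : set (cone_cylinder R B)) : open W ->
    (forall u v, cone_rel u v -> W u -> W v) -> open (@cone_pi R B @` W).
  move=> oW sat; rewrite /open /= /quotient_open.
  rewrite (_ : _ @^-1` _ = W) //; apply/seteqP; split=> [u [v Wv]|u Wu]; last by exists u.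
  by move/eqquotP => e; apply: (sat v).
have csnd : continuous (fun u : cone_cylinder R B => set_val u.2 : R).
  by apply: continuous_sndf; exact: initial_continuous.
have cyl0 (u : cone_cylinder R B) : 0 <= set_val u.2 < 1.
  by have := set_valP u.2; rewrite /= in_itv.
have k0 b : k (b, 0) = p.
  by rewrite /k hp // half_radiusE ?lexx ?ler01// mulr0.
have kuniq u v : k u = k v -> cone_rel (u.1, half_radius u.2) (v.1, half_radius v.2).
  move/val_inj => e; have := congr1 hi e; rewrite !hK => /eqquotP; exact.
exists k; split => //.
- move=> b b' t t' t01 t01' /kuniq; rewrite /cone_rel /= => /orP[/eqP [-> e]|].
    by split => //; move: e; rewrite !clampK//; lra.
  rewrite !half_radiusE // => /andP[/eqP e1 /eqP e2]; have -> : t = 0 by lra.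
  have -> : t' = 0 by lra.
  by rewrite ltxx.
- move=> N Np.
  have := cB; rewrite compact_near_coveringP => /(_ R (nbhs (0 : R))
     (fun t b => N (k (b, t))) _).
  case=> [b _|e /= e0 he].
    have := ck (b, 0) N; rewrite k0 => /(_ Np) [[V W] /= [Vb W0] VW].
    by exists (V, W) => //= -[b' t'] [/= ? ?]; exact: (VW (b', t')).
  exists (Num.min (e / 2) 1).
    by rewrite lt_min ltr01 ge_min lexx orbT !andbT; lra.
  move=> b t; rewrite le_min => /andP[t0 /andP[te t1]].
  apply: (he t) => //=; rewrite sub0r normrN ger0_norm//.
  by apply: le_lt_trans te _; lra.
- move=> e /andP[e0 e1].
  pose W := [set u : cone_cylinder R B | set_val u.2 < 2^-1 * e].
  have oW : open W.
    by move/continuousP: csnd => /(_ _ (@open_lt R (2^-1 * e))).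
  rewrite (_ : mkset _ = (set_val \o h) @` (@cone_pi R B @` W)).
    apply: kopen; apply: copen => // u v; rewrite /cone_rel /W /=.
    by case/orP => [/eqP->//|/andP[_ /eqP-> _]]; lra.
  apply/seteqP; split=> [_ [b [t [/andP[t0 te] ->]]]|_ [_ [u Wu <-] <-]].
    exists (cone_pi (b, half_radius t)) => //; exists (b, half_radius t) => //.
    by rewrite /W /= half_radiusE; lra.
  exists u.1, (2 * set_val u.2); have := cyl0 u; move: Wu; rewrite /W /= => h1 h2.
  split; first lra.
  rewrite /k /=; congr (set_val (h (cone_pi _))); rewrite [LHS]surjective_pairing.
  congr pair; apply: val_inj.
  suff : set_val u.2 = set_val (half_radius (2 * set_val u.2)) by rewrite !set_valE.
  by rewrite half_radiusE; lra.
- move=> O oO O01.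
  pose dbl (u : cone_cylinder R B) : B * R := (u.1, 2 * set_val u.2 + 0).
  have cdbl : continuous dbl.
    by apply: continuous_pair; [move=> u; exact: cvg_fst|exact: continuous_aff].
  rewrite (_ : k @` O = (set_val \o h) @` (@cone_pi R B @` (dbl @^-1` O))).
    apply: kopen; apply: copen; first by move/continuousP: cdbl; apply.
    move=> u v; rewrite /cone_rel => /orP[/eqP->//|/andP[/eqP u0 /eqP v0]] /O01.
    by rewrite /dbl /= u0 mulr0 addr0 ltxx.
  apply/seteqP; split=> [_ [[b t] Obt <-]|_ [_ [u Wu <-] <-]].
    exists (cone_pi (b, half_radius t)) => //; exists (b, half_radius t) => //.
    have /= t01 := O01 _ Obt.
    by rewrite /dbl /= half_radiusE ?addr0 ?mulVKf ?mulrA ?mulfV ?mul1r//; lra.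
  exists (dbl u) => //; rewrite /k /=; congr (set_val (h (cone_pi _))).
  rewrite [RHS]surjective_pairing; congr pair; apply: val_inj.
  have := cyl0 u; have := O01 _ Wu; rewrite /dbl /= => h1 h2.
  suff : set_val (half_radius (2 * set_val u.2 + 0)) = set_val u.2 by rewrite !set_valE.
  by rewrite half_radiusE; lra.
Qed.

End Charts.

(** * Contraction of cones *)

Section LocalStructure.
Local Open Scope ring_scope.
Variable R : realType.
Local Notation I := (unit_interval R).

Definition unit_clamp (s : R) : R := ival (clamp s).

Lemma unit_clamp_bounds s : 0 <= unit_clamp s <= 1. Proof. exact: ival_bounds. Qed.

Lemma unit_clamp_id s : 0 <= s <= 1 -> unit_clamp s = s. Proof. exact: clampK. Qed.

Lemma continuous_unit_clamp : continuous unit_clamp.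
Proof. exact: (continuous_post (@ival_continuous R) (@clamp_continuous R)). Qed.

Lemma mul_unit_bounds (s t : R) : 0 <= s <= 1 -> 0 <= t -> 0 <= s * t <= t.
Proof. by move=> /andP[s0 s1] t0; rewrite mulr_ge0 //= ler_piMl. Qed.

Section Contraction.
Variables (X : topologicalType) (p : X) (B : topologicalType) (k : B * R -> X).
Hypothesis ck : chart p k.

Definition in_chart (x : X) := exists2 u : B * R, 0 <= u.2 < 1 & x = k u.

(** Radial contraction, the identity outside the chart. *)
Definition contract (s : R) (x : X) : X :=
  if pselect (in_chart x) is left e
  then let u := sval (cid2 e) in k (u.1, unit_clamp s * u.2) else x.

Lemma contractE s b t : 0 <= t < 1 -> contract s (k (b, t)) = k (b, unit_clamp s * t).
Proof.
move=> t01; rewrite /contract; case: pselect => [e|[]]; last by exists (b, t).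
case: cid2 => -[b' t'] /= t'01 /(chart_inj ck) [||<- bb]; [lra|lra|].
have [t0|t0] := ltP 0 t; first by rewrite (bb t0).
have -> : t = 0 by lra.
by rewrite mulr0 !(chart_vertex ck).
Qed.

Lemma nbhs_chart : nbhs p in_chart.
Proof.
have [b] := chart_inhabited ck.
apply: open_nbhs_nbhs; split.
  rewrite (_ : in_chart = [set x | exists b (t : R), 0 <= t < 1 /\ x = k (b, t)]).
    by apply: (chart_ball ck); rewrite ltr01 lexx.
  apply/seteqP; split=> [x [[b' t] /= h ->]|x [b' [t [h ->]]]]; first by exists b', t.
  by exists (b', t).
by exists (b, 0); rewrite ?(chart_vertex ck)//= lexx ltr01.
Qed.

(** Away from the vertex the chart is a local homeomorphism; at the vertex small balls
    are stable under contraction. *)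
Lemma contract_continuous (z : R * X) : in_chart z.2 ->
  {for z, continuous (fun z : R * X => contract z.1 z.2)}.
Proof.
case: z => s0 _ [[b0 t0] /= t01 ->] N /=; rewrite contractE // => nN.
have [t00|t0p] := eqVneq t0 0.
  move: nN; rewrite t00 mulr0 !(chart_vertex ck) => /(chart_small ck)[e /andP[e0 e1] he].
  exists (setT, [set x | exists b (t : R), 0 <= t < e /\ x = k (b, t)]).
    split; first exact: filterT.
    apply: open_nbhs_nbhs; split; first by apply: (chart_ball ck); rewrite e0.
    by exists b0, 0; rewrite lexx e0 (chart_vertex ck).
  move=> [s x] /= [_ [b [t [/andP[t0' te] ->]]]]; rewrite contractE; last by lra.
  apply: he; have := mul_unit_bounds (unit_clamp_bounds s) t0'; lra.
pose g (w : R * (B * R)) := k (w.2.1, unit_clamp w.1 * w.2.2).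
have cg : continuous g.
  apply: (continuous_post (chart_continuous ck)); apply: continuous_pair.
    by apply: (continuous_sndf (f := fst)) => u; exact: cvg_fst.
  apply: continuous_mulf; first by apply: continuous_fstf; exact: continuous_unit_clamp.
  by apply: (continuous_sndf (f := snd)) => u; exact: cvg_snd.
have [[A W] /= [As Wb] AW] := cg (s0, (b0, t0)) N nN.
pose V := W° `&` [set u : B * R | 0 < u.2 < 1].
have oV : open V.
  apply: openI; first exact: open_interior.
  rewrite (_ : mkset _ = snd @^-1` [set t : R | 0 < t] `&` snd @^-1` [set t : R | t < 1]).
    have cs : continuous (snd : B * R -> R) by move=> u; exact: cvg_snd.
    by apply: openI; move/continuousP: cs; apply; [exact: open_gt|exact: open_lt].
  by apply/seteqP; split=> u /=; [move/andP|move=> [-> ->]].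
exists (A, k @` V).
  split => //; apply: open_nbhs_nbhs; split.
    by apply: (chart_open ck) => // u [].
  exists (b0, t0) => //; split => /=; first exact: nbhs_singleton (nbhs_interior Wb).
  by move/andP: t01 => [h1 h2]; rewrite lt_def t0p h1.
move=> [s x] /= [sA [[b t] [/interior_subset Wbt /= bt01] <-]].
rewrite contractE; last by lra.
exact: (AW (s, (b, t))).
Qed.

(** Contracting a path of the cone to the vertex gives a square whose sides are the
    rays through its two ends, whatever the path is. *)
Lemma chart_homotopies (K : groupType) (h : (I -> X) -> K) : transport h ->
  exists r : X -> K, forall q : I -> X, continuous q -> (forall t, in_chart (q t)) ->
    h q = (r (q zero) * (r (q one))^-1)%g.
Proof.
(* the ray from x to the vertex *)
move=> hT; pose rad (x : X) (t : I) := contract (1 - ival t) x.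
exists (fun x => h (rad x)) => q cq qN.
pose g (u : R * R) := contract (- 1 * u.1 + 1) (q (clamp u.2)).
have cg : continuous g.
  move=> u; apply: (@continuous_comp _ _ _ (fun u : R * R => (- 1 * u.1 + 1, q (clamp u.2)))
     (fun z => contract z.1 z.2)); last first.
    by apply: contract_continuous; exact: qN.
  apply: continuous_pair.
    by apply: continuous_aff => v; exact: cvg_fst.
  by apply: (continuous_sndf (f := fun t => q (clamp t))); exact: continuous_clamp_post.
have := transport_square hT (0, 0) (0, 1) (1, 0) (1, 1) cg.
have uc0 : unit_clamp 0 = 0 by rewrite unit_clamp_id // lexx ler01.
have uc1 : unit_clamp 1 = 1 by rewrite unit_clamp_id // lexx ler01.
rewrite (_ : g \o plane_seg (0, 0) (0, 1) = q); last first.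
  apply/funext => t; rewrite /g /= subrr mul0r !addr0 mulr0 add0r subr0 mul1r ivalK.
  have [[b s] /= s01 ->] := qN t; rewrite contractE //.
  by rewrite uc1 mul1r.
rewrite (_ : g \o plane_seg (0, 1) (1, 1) = rad (q one)); last first.
  apply/funext => t; rewrite /g /rad /= subrr mul0r add0r subr0 mul1r addr0 clamp1.
  by congr contract; rewrite mulN1r addrC.
rewrite (_ : g \o plane_seg (0, 0) (1, 0) = rad (q zero)); last first.
  apply/funext => t; rewrite /g /rad /= subrr mul0r add0r subr0 mul1r addr0 clamp0.
  by congr contract; rewrite mulN1r addrC.
rewrite (_ : g \o plane_seg (1, 0) (1, 1) = fun=> p); last first.
  apply/funext => t; rewrite /g /= subrr mul0r add0r.
  have [[b s] /= s01 ->] := qN (clamp ((1 - 0) * ival t + 0)).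
  by rewrite mulN1r addNr contractE // uc0 mul0r (chart_vertex ck).
by rewrite (transport_cst hT) mulg1 => <-; rewrite mulgK.
Qed.

End Contraction.

Lemma locally_simple_charts (X : topologicalType) :
  (forall p : X, exists (B : topologicalType) (k : B * R -> X), chart p k) ->
  locally_simple R X.
Proof.
move=> hX; split=> [p N Np|p]; have [B [k ck]] := hX p.
  have [e /andP[e0 e1] he] := chart_small ck Np; have [b0] := chart_inhabited ck.
  have : nbhs p [set x | exists b (t : R), 0 <= t < e /\ x = k (b, t)].
    apply: open_nbhs_nbhs; split; first by apply: (chart_ball ck); rewrite e0.
    by exists b0, 0; rewrite lexx e0 (chart_vertex ck).
  apply: filterS => _ [b [t [/andP[t0 te] ->]]].
  exists (fun s : I => k (b, t * ival s + 0)); split.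
  - apply: (continuous_post (chart_continuous ck)); apply: continuous_pair.
      exact: continuous_cstf.
    by apply: continuous_aff; exact: ival_continuous.
  - by rewrite ival0 mulr0 add0r (chart_vertex ck).
  - by rewrite ival1 mulr1 addr0.
  - move=> s; apply: he; rewrite addr0 mulrC.
    by have := mul_unit_bounds (ival_bounds s) t0; lra.
exists (in_chart k) => [|K h q q' hT cq cq' qN q'N e0 e1]; first exact: (nbhs_chart ck).
have [r hr] := chart_homotopies ck hT.
by rewrite !hr // e0 e1.
Qed.

(** Shrinking the radius by a constant d moves a chart inside a given open set. *)
Lemma chart_open_subset (X : topologicalType) (A : set X) (z : set_type A)
    (B : topologicalType) (k : B * R -> X) : open A -> chart (set_val z) k ->
  exists k' : B * R -> set_type A, chart z k' /\
    exists2 d : R, 0 < d & forall b t, 0 <= t <= 1 -> set_val (k' (b, t)) = k (b, d * t).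
Proof.
move=> oA ck; have Az : nbhs (set_val z) A.
  by apply: open_nbhs_nbhs; split => //; exact: (set_valP z).
have [d /andP[d0 d1] hd] := chart_small ck Az.
have inA (u : B * R) : k (u.1, d * unit_clamp u.2) \in A.
  apply/mem_set/hd; rewrite mulrC.
  exact: mul_unit_bounds (unit_clamp_bounds _) (ltW d0).
pose k' (u : B * R) : set_type A := SigSub (inA u).
have k'E u : set_val (k' u) = k (u.1, d * unit_clamp u.2) by rewrite set_valE.
have k'E01 b t : 0 <= t <= 1 -> set_val (k' (b, t)) = k (b, d * t).
  by move=> t01; rewrite k'E /= unit_clamp_id.
have dt t : 0 <= t <= 1 -> 0 <= d * t <= 1.
  move=> /andP[t0 t1]; apply/andP; split; first by apply: mulr_ge0 => //; exact: ltW.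
  by apply: (le_trans _ d1); rewrite ler_piMr // ltW.
exists k'; split; last by exists d.
split.
- exact: chart_inhabited ck.
- apply: continuous_comp_initial.
  rewrite (_ : _ \o _ = fun u : B * R => k (u.1, d * unit_clamp u.2)); last first.
    by apply/funext => u; rewrite /= k'E.
  apply: (continuous_post (chart_continuous ck)); apply: continuous_pair.
    by move=> u; exact: cvg_fst.
  apply: continuous_mulf; first exact: continuous_cstf.
  by apply: continuous_sndf; exact: continuous_unit_clamp.
- move=> b; apply: set_val_inj.
  by rewrite k'E01 ?lexx ?ler01// mulr0 (chart_vertex ck).
- move=> b b' t t' t01 t'01 /(congr1 set_val); rewrite !k'E01 //.
  move=> /(chart_inj ck) [||/(mulfI (lt0r_neq0 d0)) tt h]; [exact: dt|exact: dt|].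
  by split=> // t0; apply: h; exact: mulr_gt0.
- move=> N [_ [[V oV <-] /= Vz] VN].
  have [e /andP[e0 e1] he] := chart_small ck (open_nbhs_nbhs (conj oV Vz)).
  exists e; first by rewrite e0.
  move=> b t t01; apply: VN; rewrite /= k'E01; last by lra.
  apply: he; have /andP[t0 te] := t01; rewrite mulr_ge0 ?(ltW d0)//=.
  by apply: le_trans te; rewrite ler_piMl.
- move=> e /andP[e0 e1].
  exists [set x | exists b (t : R), 0 <= t < d * e /\ x = k (b, t)].
    by apply: (chart_ball ck); rewrite mulr_gt0//= (le_trans _ d1)// ler_piMr// ltW.
  apply/seteqP; split=> [w /= [b [t [/andP[t0 te] wE]]]|_ [b [t [/andP[t0 te] ->]]]] /=.
    have te' : 0 <= d^-1 * t < e by rewrite mulr_ge0 ?invr_ge0 ?(ltW d0)//= ltr_pdivrMl.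
    exists b, (d^-1 * t); split => //; apply: set_val_inj; rewrite k'E01; last lra.
    by rewrite mulrA mulfV ?gt_eqF// mul1r.
  exists b, (d * t); rewrite k'E01 ?mulr_ge0 ?(ltW d0)//=; last by lra.
  by rewrite ltr_pM2l.
- move=> V oV V01.
  pose V' := (fun u : B * R => (u.1, d^-1 * u.2 + 0)) @^-1` V.
  exists (k @` V').
    apply: (chart_open ck).
      suff /continuousP : continuous (fun u : B * R => (u.1, d^-1 * u.2 + 0)) by apply.
      apply: continuous_pair; first by move=> u; exact: cvg_fst.
      by apply: continuous_aff => u; exact: cvg_snd.
    move=> [b t] /= /V01 /=; rewrite addr0 => /andP[h1 h2].
    have t0 : 0 < t by rewrite pmulr_rgt0 ?invr_gt0// in h1.
    rewrite t0 /=; apply: lt_le_trans d1.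
    by rewrite ltr_pdivrMl ?mulr1 in h2.
  apply/seteqP; split=> [w /= [[b t] Vt wE]|_ [[b t] Vt <-]] /=.
    have /= t01 := V01 _ Vt.
    exists (b, d^-1 * t + 0) => //; apply: set_val_inj; rewrite k'E01; last lra.
    by rewrite addr0 mulrA mulfV ?gt_eqF// mul1r.
  have /= t01 := V01 _ Vt.
  exists (b, d * t); first by rewrite /V' /= mulrA mulVf ?gt_eqF// mul1r addr0.
  by rewrite k'E01//; lra.
Qed.

End LocalStructure.

(** * Circles, discs and complements of finite sets *)

Section Sheets.
Local Open Scope ring_scope.
Variable R : realType.
Local Notation I := (unit_interval R).

Definition path_connected (T : topologicalType) := forall x y : T,
  exists p : I -> T, [/\ continuous p, p zero = x & p one = y].

Lemma locally_constant_path (T : topologicalType) (A : Type) (phi : T -> A) (p : I -> T) :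
  continuous p -> (forall t, \forall z \near p t, phi z = phi (p t)) ->
  phi (p zero) = phi (p one).
Proof.
move=> cp loc; rewrite -clamp0 -clamp1.
apply: (@interval_chain R (fun a b : R => phi (p (clamp a)) = phi (p (clamp b)))).
  by move=> a b c _ _ _ _ -> ->.
move=> t _ _; have [e e0 he] := near_line (continuous_clamp_post cp (loc (clamp t))).
by exists e => // a b _ _ _ /he ha /he hb; rewrite [LHS]ha [RHS]hb.
Qed.

Lemma continuous_row2 (T : topologicalType) (a b : T -> R) :
  continuous a -> continuous b ->
  continuous (fun t => \row_(j < 2) (if j == ord0 then a t else b t) : 'rV[R]_2).
Proof.
move=> ca cb t N [P /= hP PN].
have h : \forall w \near t, forall ij : 'I_1 * 'I_2,
    P ij.1 ij.2 ((\row_(j < 2) (if j == ord0 then a w else b w)) ij.1 ij.2).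
  apply: filter_forall => -[i j] /=; have := hP i j; rewrite mxE.
  have [j0|j0] := eqVneq j ord0 => h.
    have {}h : \forall w \near t, P i j (a w) := ca t _ h.
    by apply: filterS h => w; rewrite mxE j0 eqxx.
  have {}h : \forall w \near t, P i j (b w) := cb t _ h.
  by apply: filterS h => w; rewrite mxE (negbTE j0).
by apply: filterS h => w hw; apply: PN => i j; exact: (hw (i, j)).
Qed.

Fact circle_subproof (t : R) : \row_j (if j == ord0 then cos t else sin t) \in
  [set v : 'rV[R]_2 | \sum_i v ord0 i ^+ 2 = 1].
Proof.
by rewrite inE /= big_ord_recl big_ord1 !mxE /= cos2Dsin2.
Qed.

Definition circle_param (t : R) : sphere R 1 := SigSub (circle_subproof t).

Lemma continuous_circle_param : continuous circle_param.
Proof.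
apply: continuous_comp_initial.
rewrite (_ : _ \o _ = fun t => \row_(j < 2) (if j == ord0 then cos t else sin t)).
  by apply: continuous_row2; [exact: continuous_cos|exact: continuous_sin].
by apply/funext => t; rewrite /= set_valE.
Qed.

Lemma circle_param_surj (v : sphere R 1) :
  exists2 t : R, - pi <= t <= pi & circle_param t = v.
Proof.
have := set_valP v; rewrite /= big_ord_recl big_ord1 /= => e.
set a := set_val v ord0 ord0; set b := set_val v ord0 (lift ord0 ord0).
have ab : a ^+ 2 + b ^+ 2 = 1 by rewrite /a /b set_valE.
have a1 : -1 <= a <= 1.
  have a21 : a ^+ 2 <= 1 by rewrite -ab lerDl sqr_ge0.
  by apply/andP; split; nra.
have pi0 := pi_ge0 R.
have ac0 := acos_ge0 a1; have acp := acos_lepi a1.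
have cosa : cos (acos a) = a by apply: acosK; rewrite in_itv.
have b2 : 1 - a ^+ 2 = b ^+ 2 by rewrite -ab addrAC subrr add0r.
(* cases on the sign of the second coordinate, since acos only sees the upper half *)
have fin t : cos t = a -> sin t = b -> circle_param t = v.
  move=> ca sb; apply: val_inj; apply/rowP => j; rewrite mxE.
  case: (unliftP ord0 j) => [j' ->|->] /=; last by rewrite ca /a set_valE.
  by rewrite sb /b set_valE (ord1 j').
have [b0|b0] := leP 0 b.
  exists (acos a); first by apply/andP; split; lra.
  by apply: fin => //; rewrite sin_acos// b2 sqrtr_sqr ger0_norm.
exists (- acos a); first by apply/andP; split; lra.
apply: fin; first by rewrite cosN.
by rewrite sinN sin_acos// b2 sqrtr_sqr ltr0_norm// opprK.
Qed.

Lemma sphere1_path_connected : path_connected (sphere R 1).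
Proof.
move=> u v; have [s _ <-] := circle_param_surj u; have [t _ <-] := circle_param_surj v.
exists (fun x : I => circle_param ((t - s) * ival x + s)); split.
- apply: (continuous_post continuous_circle_param); apply: continuous_aff.
  exact: ival_continuous.
- by rewrite ival0 mulr0 add0r.
- by rewrite ival1 mulr1 subrK.
Qed.

Lemma sphere1_compact : compact [set: sphere R 1].
Proof.
rewrite (_ : setT = circle_param @` `[- pi, pi]).
  apply: continuous_compact; last exact: segment_compact.
  exact: continuous_subspaceT continuous_circle_param.
apply/seteqP; split=> // v _; have [t tp <-] := circle_param_surj v.
by exists t => //=; rewrite in_itv.
Qed.

Lemma circles_compact r : compact [set: circles R r].
Proof. by apply: sigT_compact => [|i]; [exact: finite_finset|exact: sphere1_compact]. Qed.

Lemma smooth_chart (X : topologicalType) (p : X) : smooth_point R 1 p ->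
  exists k : sphere R 1 * R -> X, chart p k.
Proof. by apply: chart_of_cone; [exact: (inhabits (circle_param 0))|exact: sphere1_compact]. Qed.

Lemma nbhs_finite_avoid (X : topologicalType) (F : set X) (z : X) :
  hausdorff_space X -> finite_set F -> \forall w \near z, w = z \/ ~ F w.
Proof.
move=> /hausdorff_accessible/accessible_finite_set_closed hX fF.
have cF : closed (F `\ z) by apply: hX; exact: finite_setD.
have : nbhs z (~` (F `\ z)).
  by apply: open_nbhs_nbhs; split; [exact: closed_openC|move=> [_]; apply].
apply: filterS => w h; have [->|wz] := pselect (w = z); first by left.
by right => Fw; apply: h; split.
Qed.

Lemma chart_path_over (X : topologicalType) (z : X) (B : topologicalType)
    (k : B * R -> X) (q : I -> B) (t t' : R) : chart z k -> continuous q ->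
  exists p : I -> X, [/\ continuous p, p zero = k (q zero, t), p one = k (q one, t') &
    forall u, exists2 s, p u = k (q u, s) & Num.min t t' <= s <= Num.max t t'].
Proof.
move=> ck cq; exists (fun u : I => k (q u, (t' - t) * ival u + t)); split.
- apply: (continuous_post (chart_continuous ck)); apply: continuous_pair => //.
  by apply: continuous_aff; exact: ival_continuous.
- by rewrite ival0 mulr0 add0r.
- by rewrite ival1 mulr1 subrK.
- move=> u; exists ((t' - t) * ival u + t) => //.
  have := ival_bounds u; move: (ival u) => s s01.
  by have [tt'|tt'] := leP t t'; apply/andP; split; nra.
Qed.

Lemma chart_path (X : topologicalType) (z : X) (B : topologicalType) (k : B * R -> X) :
  chart z k -> path_connected B -> forall b b' t t',
  exists p : I -> X, [/\ continuous p, p zero = k (b, t), p one = k (b', t') &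
    forall u, exists2 c, p u = k c & Num.min t t' <= c.2 <= Num.max t t'].
Proof.
move=> ck pB b b' t t'; have [q [cq <- <-]] := pB b b'.
have [p [cp p0 p1 hp]] := chart_path_over t t' ck cq; exists p; split => // u.
by have [s pu st] := hp u; exists (q u, s).
Qed.

(** The set of points near which everything outside F can be reached is open; so is its
    complement, because discs stay connected without their centre. *)
Lemma path_connected_minus (X : topologicalType) (F : set X) :
  hausdorff_space X -> connected [set: X] -> finite_set F ->
  (forall z : X, exists (B : topologicalType) (k : B * R -> X),
     chart z k /\ path_connected B) ->
  path_connected (set_type (~` F)).
Proof.
move=> hX cX fF hC y0 y1.
pose reach v := exists p : I -> X,
  [/\ continuous p, p zero = set_val y0, p one = v & forall t, ~ F (p t)].
have reach_trans v w (p : I -> X) : reach v -> continuous p -> p zero = v ->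
    p one = w -> (forall t, ~ F (p t)) -> reach w.
  move=> [q [cq q0 q1 qF]] cp p0 p1 pF; exists (joinp q p); split.
  - by apply: continuous_joinp => //; rewrite q1.
  - by rewrite joinp0.
  - by rewrite joinp1.
  - by move=> t; rewrite /joinp; case: ifP.
suff [p [cp p0 p1 pF]] : reach (set_val y1).
  have pF' t : p t \in ~` F by apply/mem_set/pF.
  pose p' t : set_type (~` F) := SigSub (pF' t).
  exists p'; split.
  - by apply: continuous_comp_initial; rewrite (_ : _ \o _ = p).
  - by apply: set_val_inj; rewrite -p0 set_valE.
  - by apply: set_val_inj; rewrite -p1 set_valE.
pose A : set X := fun z : X => \forall v \near z, (~ F v -> reach v).
have oA : open A by rewrite openE => z; exact: near_join.
have disc (z : X) : exists (B : topologicalType) (k : B * R -> X) (e : R),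
    [/\ chart z k, path_connected B, 0 < e <= 1 &
      forall b (t : R), 0 <= t <= e -> k (b, t) = z \/ ~ F (k (b, t))].
  have [B [k [ck pB]]] := hC z.
  have [e he h] := chart_small ck (nbhs_finite_avoid z hX fF).
  by exists B, k, e.
have discF (z : X) (B : topologicalType) (k : B * R -> X) (e : R) b (t : R) : chart z k -> 0 < e <= 1 ->
    (forall b (t : R), 0 <= t <= e -> k (b, t) = z \/ ~ F (k (b, t))) -> 0 < t <= e ->
    ~ F (k (b, t)).
  move=> ck e01 h te; have [|/(chart_neq ck)[]|//] := h b t; lra.
(* the punctured disc is path connected and misses F, so reaching one of its
   points reaches all of them *)
have spread (z : X) (B : topologicalType) (k : B * R -> X) (e : R) b (t : R) : chart z k -> path_connected B ->
    0 < e <= 1 -> (forall b (t : R), 0 <= t <= e -> k (b, t) = z \/ ~ F (k (b, t))) ->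
    0 < t < e -> reach (k (b, t)) -> A z.
  move=> ck pB e01 h te rbt.
  have hp b' (t' : R) : 0 <= t' < e -> ~ F (k (b', t')) -> reach (k (b', t')).
    move=> te' nF; have [p [cp p0 p1 hp]] := chart_path ck pB b b' t t'.
    apply: (reach_trans _ _ p rbt cp p0 p1) => u; have [[c s] -> /= hs] := hp u.
    have [s0|s0] := ltP 0 s.
      apply: (discF _ _ _ e _ _ ck e01 h); rewrite s0 /=.
      by move: hs; case: (leP t t') => tt'; lra.
    have s00 : s = 0 by move: hs; case: (leP t t') => tt'; lra.
    have t00 : t' = 0 by move: hs; case: (leP t t') => tt'; lra.
    by move: nF; rewrite s00 t00 !(chart_vertex ck).
  have : nbhs z [set x | exists b (t : R), 0 <= t < e /\ x = k (b, t)].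
    apply: open_nbhs_nbhs; split; first exact: (chart_ball ck).
    by exists b, 0; rewrite (chart_vertex ck); split => //; lra.
  by apply: filterS => _ [b' [t' [te' ->]]]; exact: hp.
have oC : open (~` A).
  rewrite openE => z nAz; have [B [k [e [ck pB e01 h]]]] := disc z.
  have [b0] := chart_inhabited ck.
  have nr b (t : R) : 0 < t < e -> ~ reach (k (b, t)).
    by move=> te r; apply: nAz; exact: (spread _ _ _ _ _ _ ck pB e01 h te r).
  have : nbhs z [set x | exists b (t : R), 0 <= t < e /\ x = k (b, t)].
    apply: open_nbhs_nbhs; split; first exact: (chart_ball ck).
    by exists b0, 0; rewrite (chart_vertex ck); split => //; lra.
  apply: filterS => _ [b [t [te ->]]] Ak.
  have [t0|t0] := ltP 0 t.
    have te' : 0 < t < e by lra.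
    apply: (nr b t te'); apply: (nbhs_singleton Ak).
    by apply: (discF _ _ _ e _ _ ck e01 h); lra.
  by apply: nAz; move: Ak; have -> : t = 0 by [lra]; rewrite (chart_vertex ck).
have A0 : A (set_val y0).
  have [B [k [e [ck pB e01 h]]]] := disc (set_val y0).
  have nF0 : ~ F (set_val y0) := set_valP y0.
  have [b0] := chart_inhabited ck.
  have te : 0 < e / 2 < e by lra.
  apply: (spread _ _ _ _ b0 (e / 2) ck pB e01 h te).
  have [p [cp p0 p1 hp]] := chart_path ck pB b0 b0 0 (e / 2).
  exists p; split => //; first by rewrite p0 (chart_vertex ck).
  move=> u; have [[c s] -> /= hs] := hp u.
  have /orP[/eqP->|s0] : (s == 0) || (0 < s).
    by rewrite eq_sym -le_eqVlt; move: hs; case: (leP 0 (e / 2)) => tt'; lra.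
    by rewrite (chart_vertex ck).
  apply: (discF _ _ _ e _ _ ck e01 h); rewrite s0 /=.
  by move: hs; case: (leP 0 (e / 2)) => tt'; lra.
have AT : A = [set: X].
  apply: cX; first by exists (set_val y0).
    by exists A; rewrite ?setTI.
  by exists A; rewrite ?setTI//; rewrite -(setCK A); exact: open_closedC.
have : A (set_val y1) by rewrite AT.
by move/nbhs_singleton; apply; exact: (set_valP y1).
Qed.

End Sheets.

(** * The points over a conic point *)

Section Fibre.
Local Open Scope ring_scope.
Variable R : realType.
Local Notation I := (unit_interval R).

(** Removing x cuts its neighbourhood into r sheets, and removing y from a small disc
    leaves it connected, so the disc around each y over x covers one sheet near x.
    Conversely the lift of a sheet close to x stays near the fibre, as f is closed, and
    is connected, so it clusters at one point only. The bijection sends a sheet to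
    that point. *)
Lemma fibre_sheets (Y X : topologicalType) (f : Y -> X) (x : X) (r : nat)
    (k : circles R r * R -> X) :
  gluing f -> hausdorff_space Y -> chart x k ->
  (forall y, f y = x -> exists (B : topologicalType) (k' : B * R -> Y),
     chart y k' /\ path_connected R B) ->
  exists y : 'I_r -> Y, injective y /\ range y = f @^-1` [set x].
Proof.
move=> gf hY ck hC; have cf := gluing_continuous gf.
pose F := f @^-1` [set x]; have fF : finite_set F := gluing_finite gf x.
have [y0 _] := gluing_surj gf x.
have [L hL] := hausdorff_finite_glue y0 (fun y _ => y) hY fF.
pose onX (x' : X) := exists2 u : circles R r * R, 0 < u.2 < 1 & x' = k u.
pose J (x' : X) : option 'I_r :=
  if pselect (onX x') is left e then Some (tag (sval (cid2 e)).1) else None.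
have JE b t : 0 < t < 1 -> J (k (b, t)) = Some (tag b).
  move=> t01; rewrite /J; case: pselect => [e|[]]; last by exists (b, t).
  case: cid2 => -[b' t'] /= t'01 /(chart_inj ck) [||_ bb]; [lra|lra|].
  by rewrite -bb//; lra.
have Jloc (x' : X) : onX x' -> \forall w \near x', J w = J x'.
  move=> [[b t] /= t01 ->].
  pose V := [set u : circles R r * R | tag u.1 = tag b /\ 0 < u.2 < 1].
  have oV : open V.
    have cs : continuous (snd : circles R r * R -> R) by move=> u; exact: cvg_snd.
    have ct : continuous (fst : circles R r * R -> circles R r) by move=> u; exact: cvg_fst.
    rewrite (_ : V = fst @^-1` [set c : circles R r | tag c = tag b] `&`
      (snd @^-1` [set t : R | 0 < t] `&` snd @^-1` [set t : R | t < 1])).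
      apply: openI; last by apply: openI; move/continuousP: cs; apply; [exact: open_gt|exact: open_lt].
      move/continuousP : ct; apply; apply/sigT_openP => i.
      have [->|ib] := pselect (i = tag b).
        by rewrite (_ : _ @^-1` _ = setT); [exact: openT|apply/seteqP; split].
      by rewrite (_ : _ @^-1` _ = set0); [exact: open0|apply/seteqP; split].
    by apply/seteqP; split=> u /=; [move=> [e1 /andP[]]|move=> [e1 [h1 h2]]; split=> //=; rewrite h1].
  have : nbhs (k (b, t)) (k @` V).
    apply: open_nbhs_nbhs; split; first by apply: (chart_open ck) => // u [].
    by exists (b, t).
  by apply: filterS => _ [[b' t'] [/= bb t'01] <-]; rewrite !JE// bb.
have dC y : exists B : topologicalType, F y -> exists (k' : B * R -> Y) (e : R),
    [/\ chart y k', path_connected R B, 0 < e <= 1 &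
      forall b (t : R), 0 < t <= e -> onX (f (k' (b, t)))].
  have [fy|] := pselect (F y); last by exists (Y : topologicalType).
  have [B [k' [ck' pB]]] := hC y fy; exists B => _.
  have n1 : nbhs y (f @^-1` in_chart k).
    by have := nbhs_chart ck; rewrite -fy => n; exact: (cf y _ n).
  have [e e01 he] := chart_small ck' (filterI n1 (nbhs_finite_avoid y hY fF)).
  exists k', e; split => // b t t0e; have t0e' : 0 <= t <= e by lra.
  have t01 : 0 < t <= 1 by lra.
  have [[u u01 fu] [/(chart_neq ck' t01)//|nF]] := he b t t0e'.
  exists u => //; have /andP[u0 ->] := u01; rewrite andbT lt_def u0 andbT.
  apply/eqP => u00; apply: nF; rewrite /F /= fu; case: (u) u00 => b' t' /= ->.
  exact: chart_vertex ck b'.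
(* the punctured disc around y is connected, so f maps it into one sheet *)
have Jy y : exists j : option 'I_r, F y -> exists2 D, nbhs y D &
    forall v, D v -> v <> y -> J (f v) = j.
  have [fy|] := pselect (F y); last by exists None.
  have [B /(_ fy) [k' [e [ck' pB e01 he]]]] := dC y; have [b0] := chart_inhabited ck'.
  exists (J (f (k' (b0, e)))) => _.
  exists [set v | exists b t, 0 <= t < e /\ v = k' (b, t)].
    apply: open_nbhs_nbhs; split; first exact: (chart_ball ck').
    by exists b0, 0; rewrite (chart_vertex ck'); split => //; lra.
  move=> _ [b [t [te ->]]] ky; have t0 : 0 < t.
    rewrite lt_def; have /andP[-> _] := te; rewrite andbT; apply/eqP => t0.
    by apply: ky; rewrite t0 (chart_vertex ck').
  have [p [cp p0 p1 hp]] := chart_path ck' pB b b0 t e.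
  rewrite -p0 -p1; apply: (locally_constant_path (phi := J \o f)) => // u.
  have [[c s] -> /= hs] := hp u.
  have se : 0 < s <= e by move: hs; case: (leP t e); lra.
  have := Jloc _ (he c s se) => n; exact: (cf _ _ n).
have [j jP] := choice Jy.
have DP y : exists D : set Y, F y -> nbhs y D /\
    forall v, D v -> v <> y -> J (f v) = j y.
  by have [/jP[D ? ?]|] := pselect (F y); [exists D|exists setT].
have [D hD] := choice DP.
have LF y : F y -> L y = y by move=> /hL/nbhs_singleton.
(* a neighbourhood of the fibre on which L is locally constant and the label j of the
     nearby disc applies *)
pose V : set Y := fun v => [/\ F (L v), (\forall w \near v, L w = L v) & D (L v) v].
have nV y : f y = x -> nbhs y V.
  move=> fy; have [n1 _] := hD y fy; have n2 := hL y fy.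
  apply: filterS3 n1 n2 (near_join n2) => v Dv Lv nv.
  by split; rewrite Lv.
have [e /andP[e0 e1] he] := chart_small ck (filterI (gluing_closed gf nV) (gluing_inj gf x)).
have knx b (t : R) : 0 < t <= e -> k (b, t) <> x.
  by move=> te; apply: (chart_neq ck); clear he; lra.
have hV b (t : R) v : 0 <= t <= e -> f v = k (b, t) -> V v.
  by move=> te; have [h _] := he b t te; exact: h.
have hU b (t : R) v v' : 0 < t <= e -> f v = k (b, t) -> f v' = k (b, t) -> v = v'.
  move=> te; have te' : 0 <= t <= e by lra.
  by have [_ [/(knx _ _ te)//|h]] := he b t te'; exact: h.
have [g gK] := choice (gluing_surj gf).
pose c0 := circle_param (0 : R); pose pt i c : circles R r := existT _ i c.
pose y i := L (g (k (pt i c0, e / 2))).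
(* the lift of a sheet clusters at one point, as L is constant along it *)
have yE i c (t : R) : 0 < t <= e -> L (g (k (pt i c, t))) = y i.
  move=> te; have [q [cq q0 q1]] := sphere1_path_connected c c0.
  have cq' : continuous (fun u => pt i (q u)).
    exact: (continuous_post (@existT_continuous _ (fun=> sphere R 1) i) cq).
  have [p [cp p0 p1 hp]] := chart_path_over t (e / 2) ck cq'.
  rewrite /y -q1 -p1 -q0 -p0.
  apply: (locally_constant_path (phi := L \o g)) => // u.
  have [s pu hs] := hp u.
  have se : 0 < s <= e by clear he; move: hs; case: (leP t (e / 2)); lra.
  have n : \forall w \near p u, forall v, f v = w -> L v = L (g (p u)).
    apply: (gluing_closed gf (O := fun v => L v = L (g (p u)))) => v fv.
    have se' : 0 <= s <= e by clear he; lra.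
    rewrite (_ : v = g (p u)); last first.
      by apply: (hU (pt i (q u)) s v (g (p u)) se); rewrite -pu ?gK.
    by have [] := hV (pt i (q u)) s (g (p u)) se'; rewrite ?gK.
  by apply: filterS n => w /(_ (g w)); rewrite gK => /(_ erefl).
have e2 : 0 < e / 2 <= e by clear he; lra.
have yF i : F (y i).
  by have [] := hV (pt i c0) (e / 2) (g (k (pt i c0, e / 2))); rewrite ?gK//; clear he; lra.
have jy i : j (y i) = Some i.
  set v := g (k (pt i c0, e / 2)).
  have [_ _ Dv] : V v by apply: (hV (pt i c0) (e / 2)); rewrite ?gK//; clear he; lra.
  have vy : v <> y i by move=> vy; have := yF i; rewrite -vy /F /= gK; exact: knx.
  have [_ h] := hD _ (yF i); rewrite -(h v Dv vy) gK JE //.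
  by clear he; lra.
exists y; split.
  by move=> i i' /(congr1 j); rewrite !jy => -[].
apply/seteqP; split=> [_ [i _ <-]|z fz]; first exact: yF.
have [B [k' [ck' pB]]] := hC z fz; have [b] := chart_inhabited ck'.
have nb : nbhs x [set w | exists c (t : R), 0 <= t < e /\ w = k (c, t)].
  apply: open_nbhs_nbhs; split; first by apply: (chart_ball ck); rewrite e0.
  by have [c] := chart_inhabited ck; exists c, 0; rewrite lexx e0 (chart_vertex ck).
have nz : nbhs z (f @^-1` [set w | exists c (t : R), 0 <= t < e /\ w = k (c, t)]).
  by move: nb; rewrite -fz => n; exact: (cf z _ n).
have [d /andP[d0 d1] hd] := chart_small ck' (filterI nz (hL z fz)).
have dd : 0 <= d <= d by rewrite (ltW d0) lexx.
have [[[i c] [t [te fv]]] Lv] := hd b d dd.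
have t0 : 0 < t.
  rewrite lt_def; have /andP[-> _] := te; rewrite andbT; apply/eqP => t0.
  have : F (k' (b, d)) by rewrite /F /= fv t0 (chart_vertex ck).
  by move/LF; rewrite Lv => /esym; apply: (chart_neq ck'); rewrite d0.
have te' : 0 < t <= e by rewrite t0 ltW//; case/andP: te.
exists i => //; rewrite -(yE i c t te') -Lv; congr L.
by apply: (hU (pt i c) t _ _ te'); rewrite ?gK.
Qed.

End Fibre.

(** * Normalizations as gluing maps *)

Section Normalization.
Local Open Scope ring_scope.
Variable R : realType.
Local Notation I := (unit_interval R).

Lemma nodefold_chart n (X : topologicalType) (p : X) : nodefold R n X ->
  exists (B : topologicalType) (k : B * R -> X), chart p k.
Proof.
move=> [_ _ _ /(_ p)[B [iB [_ _ cB _] cn]]]; exists B; exact: chart_of_cone.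
Qed.

Lemma chart_limit (X : topologicalType) (p : X) (B : topologicalType) (k : B * R -> X)
    (N : set X) : chart p k -> nbhs p N -> exists2 w, N w & w <> p.
Proof.
move=> ck /(chart_small ck)[e /andP[e0 e1] he]; have [b] := chart_inhabited ck.
exists (k (b, e)); first by apply: he; rewrite (ltW e0) lexx.
by apply: (chart_neq ck); rewrite e0.
Qed.

(** Compactness makes f closed. It is onto because conic points are not isolated. *)
Lemma normalization_gluing (X Y : topologicalType) (f : Y -> X) :
  closed_node_surface R X -> normalization R f ->
  gluing f /\ exists2 S, (forall p, S p -> conic_point R 1 p) &
    forall y y', f y = f y' -> ~ S (f y) -> y = y'.
Proof.
move=> [nX cX] [sY /(_ cX) cY [cf [S [fS Sc Sf [g [[gi [cg cgi gK giK]] gE]]]]]].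
have [hX _ _ _] := nX.
have inj y y' : f y = f y' -> ~ S (f y) -> y = y'.
  move=> e nS; have nS' : ~ S (f y') by rewrite -e.
  have my : y \in ~` (f @^-1` S) by apply/mem_set.
  have my' : y' \in ~` (f @^-1` S) by apply/mem_set.
  suff : (SigSub my : set_type (~` (f @^-1` S))) = SigSub my' by move/(congr1 set_val).
  apply: (can_inj gK); apply: set_val_inj; rewrite !gE; exact: e.
have surjS x : ~ S x -> exists y, f y = x.
  move=> nS; have mx : x \in ~` S by apply/mem_set.
  by exists (set_val (gi (SigSub mx : set_type (~` S)))); rewrite -gE giK.
have fclosed (C : set Y) : closed C -> closed (f @` C).
  move=> cC; apply: compact_closed => //; apply: continuous_compact.
    exact: continuous_subspaceT.
  exact: subclosed_compact cC cY _.
have surj x : exists y, f y = x.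
  have [Sx|] := pselect (S x); last exact: surjS.
  have [[y] //|nx] := pselect (exists y, f y = x); first by exists y.
  have nf : nbhs x (~` (f @` setT)).
    apply: open_nbhs_nbhs; split; first by apply/closed_openC/fclosed/closedT.
    by move=> [y _ fy]; apply: nx; exists y.
  have [B [k ck]] := nodefold_chart x nX.
  have [w [nw [//|nS]] wx] := chart_limit ck (filterI nf (nbhs_finite_avoid x hX fS)).
  by have [y fy] := surjS _ nS; case: nw; exists y.
split; last by exists S.
split => //.
- move=> x; have [Sx|nS] := pselect (S x); first exact: Sf.
  have [y fy] := surj x; apply: (@sub_finite_set _ _ [set y]); last exact: finite_set1.
  by move=> y' /= fy'; apply: inj; rewrite fy'.
- move=> x N hN.
  have : nbhs x (~` (f @` (~` N°))).
    apply: open_nbhs_nbhs; split.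
      by apply/closed_openC/fclosed/open_closedC; exact: open_interior.
    move=> [y nN fy]; apply: nN; exact: hN.
  apply: filterS => w nw y fy; apply: interior_subset.
  by apply: contrapT => nN; apply: nw; exists y.
- move=> x; apply: filterS (nbhs_finite_avoid x hX fS) => w [->|nS]; [by left|right].
  by move=> y y' fy fy'; apply: inj; rewrite fy.
Qed.

Lemma nbhs_set_type (X : topologicalType) (A : set X) (z : set_type A) (N : set X) :
  nbhs (set_val z) N -> nbhs z (set_val @^-1` N).
Proof. exact: initial_continuous. Qed.

Lemma gluing_restrict (X Y : topologicalType) (f : Y -> X) (A : set X) (A' : set Y) :
  gluing f -> open A -> (forall y, A' y <-> A (f y)) ->
  exists2 f' : set_type A' -> set_type A,
    gluing f' & forall y, set_val (f' y) = f (set_val y).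
Proof.
move=> gf oA AA'; have cf := gluing_continuous gf.
have oA' : open A'.
  rewrite (_ : A' = f @^-1` A); first by move/continuousP: cf; apply.
  by apply/seteqP; split=> y /AA'.
have mf (y : set_type A') : f (set_val y) \in A by apply/mem_set/AA'; exact: (set_valP y).
pose f' (y : set_type A') : set_type A := SigSub (mf y).
have f'E y : set_val (f' y) = f (set_val y) by rewrite set_valE.
have f'P y z : f' y = z <-> f (set_val y) = set_val z.
  by split=> [<-|e]; [rewrite f'E|apply: set_val_inj; rewrite f'E].
exists f' => //; split.
- apply: continuous_comp_initial; rewrite (_ : _ \o _ = f \o set_val).
    by apply: (continuous_post cf); exact: initial_continuous.
  by apply/funext => y; rewrite /= f'E.
- move=> z; have [y fy] := gluing_surj gf (set_val z).
  have my : y \in A' by apply/mem_set/AA'; rewrite fy; exact: (set_valP z).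
  by exists (SigSub my); apply/f'P; rewrite -fy set_valE.
- move=> z.
  apply: (sub_finite_set (B := set_val @^-1` (f @^-1` [set set_val z]))).
    by move=> y /f'P.
  apply: finite_preimage; last exact: gluing_finite.
  by move=> u v _ _; exact: set_val_inj.
- move=> z N hN; apply: (@filterS _ _ _ (set_val @^-1`
      [set w | forall y, f y = w -> (set_val @` N) y])).
    move=> w /= h y /f'P fy; have [y' Ny' /set_val_inj <-] := h _ fy; exact: Ny'.
  apply: nbhs_set_type; apply: (gluing_closed gf) => y fy.
  have my : y \in A' by apply/mem_set/AA'; rewrite fy; exact: (set_valP z).
  have yE : set_val (SigSub my : set_type A') = y by rewrite set_valE.
  have nN : nbhs (SigSub my : set_type A') N by apply: hN; apply/f'P; rewrite yE.
  apply: (@filterS _ _ _ (set_val @` (N° : set (set_type A')))).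
    by move=> _ [u Nu <-]; exists u => //; exact: interior_subset.
  apply: open_nbhs_nbhs; split; first exact: (open_set_type oA' (open_interior _)).
  by exists (SigSub my).
- move=> z; apply: filterS (nbhs_set_type (gluing_inj gf (set_val z))) => w /= [e|h].
    by left; exact: set_val_inj.
  right=> y y' /f'P fy /f'P fy'; apply: set_val_inj; exact: h.
Qed.

Lemma locally_simple_open (n : nat) (X : topologicalType) (A : set X) :
  nodefold R n X -> open A -> locally_simple R (set_type A).
Proof.
move=> nX oA; apply: locally_simple_charts => z.
have [B [k ck]] := nodefold_chart (set_val z) nX.
have [k' [ck' _]] := chart_open_subset oA ck.
by exists B, k'.
Qed.

(** The listed points are the pairs of a glued value and a preimage other than the
    chosen one. *)
Lemma extra_points (Y Z : Type) (f : Y -> Z) (sec : Z -> Y) (l : nat)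
    (x : 'I_l -> Z) (r : 'I_l -> nat) (y : forall i, 'I_(r i) -> Y) :
  (forall z, f (sec z) = z) -> injective x ->
  (forall i, injective (y i) /\ range (y i) = f @^-1` [set x i]) ->
  (forall u v, f u = f v -> ~ range x (f u) -> u = v) ->
  exists e : 'I_(\sum_(i < l) r i - l)%N -> Y,
    injective e /\ range e = [set v | v <> sec (f v)].
Proof.
move=> fs xI yP fI.
have [j0 hj0] : {j0 : forall i, 'I_(r i) & forall i, y i (j0 i) = sec (x i)}.
  suff h i : {j : 'I_(r i) | y i j = sec (x i)}.
    by exists (fun i => sval (h i)) => i; exact: svalP (h i).
  apply: cid; have [_ rg] := yP i.
  by have : range (y i) (sec (x i)) by [rewrite rg]; move=> [j _]; exists j.
have fy i j : f (y i j) = x i.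
  have [_ rg] := yP i; suff : (f @^-1` [set x i]) (y i j) by [].
  by rewrite -rg; exists j.
pose T := {i : 'I_l & 'I_(r i)}.
pose P := [pred u : T | tagged u != j0 (tag u)].
have cP : #|P| = (\sum_(i < l) r i - l)%N.
  rewrite -sum1_card (eq_bigl (fun u : T => xpredT (tag u) && (tagged u != j0 (tag u)))) //.
  rewrite -(@sig_big_dep _ _ _ _ _ xpredT (fun i j => j != j0 i) (fun _ _ => 1%N)) /=.
  have r0 i : (0 < r i)%N by apply: leq_ltn_trans (ltn_ord (j0 i)).
  rewrite (eq_bigr (fun i => (r i - 1)%N)); last first.
    move=> i _; rewrite sum1_card.
    have e : (1 + #|predC (pred1 (j0 i))| = r i)%N.
      by rewrite -[RHS](card_ord (r i)) -(cardC (pred1 (j0 i))) card1.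
    transitivity (1 + #|predC (pred1 (j0 i))| - 1)%N; last by rewrite e.
    by rewrite addKn; apply: eq_card.
  by rewrite sumnB // sum1_card card_ord.
rewrite -cP; exists (fun i => y (tag (enum_val i)) (tagged (enum_val i))); split.
  move=> a b e; apply: enum_val_inj.
  have := congr1 f e; rewrite !fy => /xI.
  move: e; case: (enum_val a) => i j; case: (enum_val b) => i' j' /= + ii.
  case: i' / ii j' => j' /(proj1 (yP i)) <- //.
apply/seteqP; split=> [_ [a _ <-]|v nv] /=.
  have := enum_valP a; case: (enum_val a) => i j /=; rewrite inE /= fy -hj0 => jj.
  by move/(proj1 (yP i)) => e; move: jj; rewrite e eqxx.
have [[i _ xi]|nx] := pselect (range x (f v)); last first.
  by case: nv; apply: fI; rewrite // fs.
have : range (y i) v by rewrite (proj2 (yP i)) /= xi.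
move=> [j _ yj].
have uP : Tagged (fun i => 'I_(r i)) j \in P.
  by rewrite inE /=; apply/eqP => jj; apply: nv; rewrite -xi -hj0 -jj.
by exists (enum_rank_in uP (Tagged (fun i => 'I_(r i)) j)) => //; rewrite enum_rankK_in.
Qed.

End Normalization.

(** * The Hilbert basis theorem *)

Section HilbertBasis.
Import (canonicals, coercions) mpoly.
Local Open Scope ring_scope.

Record is_ideal (A : comNzRingType) (S : set A) : Prop := IsIdeal {
  ideal_zero : S 0;
  ideal_add : forall p q, S p -> S q -> S (p + q);
  ideal_mul : forall a p, S p -> S (a * p) }.

Definition ideal_span (A : comNzRingType) (S : set A) : set A :=
  fun p => forall K, is_ideal K -> S `<=` K -> K p.

Definition noetherian_ring (A : comNzRingType) := forall S : set A, is_ideal S ->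
  exists2 s : seq A, (forall p, p \in s -> S p) & S `<=` ideal_span [set` s].

Lemma ideal_span_ideal (A : comNzRingType) (S : set A) : is_ideal (ideal_span S).
Proof.
split=> [K iK _|p q hp hq K iK SK|a p hp K iK SK].
- exact: ideal_zero.
- by apply: ideal_add => //; [exact: hp|exact: hq].
- by apply: ideal_mul => //; exact: hp.
Qed.

Lemma sub_ideal_span (A : comNzRingType) (S : set A) : S `<=` ideal_span S.
Proof. by move=> p Sp K _; apply. Qed.

Lemma ideal_spanS (A : comNzRingType) (S T : set A) :
  S `<=` T -> ideal_span S `<=` ideal_span T.
Proof. by move=> ST p hp K iK TK; apply: hp => // q /ST /TK. Qed.

(** The union of the ideals spanned by the initial segments is itself an ideal, so it is
    already reached at a finite stage. *)
Lemma noetherian_sequence (A : comNzRingType) (a : nat -> A) : noetherian_ring A ->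
  exists N, ideal_span [set a i | i in [set i | (i < N)%N]] (a N).
Proof.
move=> nA; pose S N := [set a i | i in [set i | (i < N)%N]].
have SS N M : (N <= M)%N -> S N `<=` S M.
  by move=> NM _ [i /= iN <-]; exists i => //=; exact: leq_trans NM.
pose U : set A := fun p => exists N, ideal_span (S N) p.
have iU : is_ideal U.
  split.
  - by exists 0%N; exact: ideal_zero (ideal_span_ideal _).
  - move=> p q [N hN] [M hM]; exists (maxn N M).
    by apply: (ideal_add (ideal_span_ideal _));
      [move: p hN|move: q hM]; apply: ideal_spanS; apply: SS; rewrite ?leq_maxl ?leq_maxr.
  - by move=> b p [N hN]; exists N; exact: ideal_mul (ideal_span_ideal _) _ _ hN.
have [s sU Us] := nA U iU.
have [N hN] : exists N, forall p, p \in s -> ideal_span (S N) p.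
  elim: s sU {Us} => [|b s IH] sU; first by exists 0%N.
  have [N hN] := IH (fun p ps => sU p (mem_behead (s := b :: s) ps)).
  have [M hM] := sU b (mem_head _ _).
  exists (maxn N M) => p; rewrite inE => /orP[/eqP->|ps].
    by move: b hM {sU}; apply: ideal_spanS; apply: SS; exact: leq_maxr.
  by move: p ps (hN p ps) => p _; apply: ideal_spanS; apply: SS; exact: leq_maxl.
exists N; have : U (a N).
  by exists N.+1; apply: sub_ideal_span; exists N => //=.
by move/Us; apply; [exact: ideal_span_ideal|exact: hN].
Qed.

(** Hilbert's argument: choose successively polynomials of least degree outside the
    ideal spanned by the previous ones. Some leading coefficient lies in the ideal
    spanned by the earlier ones, and cancelling it contradicts minimality. *)
Lemma noetherian_poly (A : comNzRingType) : noetherian_ring A -> noetherian_ring {poly A}.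
Proof.
move=> nA S iS; apply: contrapT => nS.
have step (s : seq {poly A}) : exists p, (forall q, q \in s -> S q) ->
    [/\ S p, ~ ideal_span [set` s] p &
      forall q, S q -> ~ ideal_span [set` s] q -> (size p <= size q)%N].
  have [hs|ns] := pselect (forall q, q \in s -> S q); last by exists 0.
  pose E := fun d => `[< exists p, [/\ S p, ~ ideal_span [set` s] p & size p = d] >].
  have exE : exists d, E d.
    apply: contrapT => nE; apply: nS; exists s => // p Sp.
    by apply: contrapT => np; apply: nE; exists (size p); apply/asboolP; exists p.
  have [d /asboolP[p [Sp np dp]] min] := ex_minnP exE; exists p => _; split => // q Sq nq.
  by rewrite dp; apply: min; apply/asboolP; exists q.
have [next nextP] := choice step.
pose pre i := iter i (fun s => rcons s (next s)) [::].
pose a i := next (pre i).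
have preE i p : p \in pre i <-> exists2 j, (j < i)%N & p = a j.
  elim: i => [|i IH] /=; first by split=> // -[].
  rewrite mem_rcons inE; split=> [/orP[/eqP->|pi]|[j]].
  - by exists i.
  - by have [j ji ->] := IH.1 pi; exists j => //; exact: ltnW.
  - rewrite ltnS leq_eqVlt => /orP[/eqP->|ji] pE; first by rewrite pE eqxx.
    by apply/orP; right; apply/IH; exists j.
have preS i q : q \in pre i -> S q.
  elim: i q => // i IH q /=; rewrite mem_rcons inE => /orP[/eqP->|]; last exact: IH.
  by have [] := nextP (pre i) (IH).
have aP i : [/\ S (a i), ~ ideal_span [set` pre i] (a i) &
    forall q, S q -> ~ ideal_span [set` pre i] q -> (size (a i) <= size q)%N].
  exact: nextP (preS i).
have a0 i : a i != 0.
  by apply/eqP => ai; have [_ + _] := aP i; apply; rewrite ai; exact: ideal_zero (ideal_span_ideal _).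
have amono i j : (i < j)%N -> (size (a i) <= size (a j))%N.
  move=> ij; have [_ _ min] := aP i; have [Sj nj _] := aP j; apply: min => // h; apply: nj.
  move: (a j) h; apply: ideal_spanS => p /preE[m mi ->] /=; apply/preE.
  by exists m => //; exact: ltn_trans ij.
have [N hN] := noetherian_sequence (fun i => lead_coef (a i)) nA.
(* the coefficients in degree deg (a N) of the elements of the span of degree at most
     deg (a N); multiplying by powers of X shows that they include the earlier leading
     coefficients *)
pose K : set A := fun c => exists b, [/\ ideal_span [set` pre N] b,
  (size b <= size (a N))%N & b`_(size (a N)).-1 = c].
have iK : is_ideal K.
  split.
  - exists 0; rewrite size_poly0 coef0; split => //; exact: ideal_zero (ideal_span_ideal _).
  - move=> c c' [b [hb sb <-]] [b' [hb' sb' <-]]; exists (b + b'); split.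
    + exact: ideal_add (ideal_span_ideal _) _ _ hb hb'.
    + by apply: leq_trans (size_polyD _ _) _; rewrite geq_max sb.
    + by rewrite coefD.
  - move=> c c' [b [hb sb <-]]; exists (c%:P * b); split.
    + exact: ideal_mul (ideal_span_ideal _) _ _ hb.
    + apply: leq_trans (size_polyMleq _ _) _; apply: leq_trans sb.
      by rewrite -subn1 leq_subLR leq_add2r size_polyC leq_b1.
    + by rewrite coefCM.
have [|b [hb sb cb]] := hN K iK.
  move=> _ [i /= iN <-]; exists ('X^(size (a N) - size (a i)) * a i); split.
  - apply: ideal_mul (ideal_span_ideal _) _ _ _; apply: sub_ideal_span => /=.
    by apply/preE; exists i.
  - by rewrite mulrC size_mulXn // subnK // amono.
  - rewrite coefXnM ifF; last first.
      apply/negbTE; rewrite -leqNgt -subn1 -(subnK (amono _ _ iN)) addnK.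
      by rewrite -addnBA ?leq_addr// size_poly_gt0.
    congr (_`_ _); have := size_poly_gt0 (a i); rewrite a0; have := amono _ _ iN; lia.
have [Sa na min] := aP N.
have Sab : S (a N - b).
  apply: ideal_add => //; rewrite -mulN1r; apply: ideal_mul => //.
  by apply: hb => // q /=; exact: preS.
have nab : ~ ideal_span [set` pre N] (a N - b).
  move=> h; apply: na; rewrite -(subrK b (a N)).
  exact: ideal_add (ideal_span_ideal _) _ _ h hb.
have := min _ Sab nab; apply/negP; rewrite -ltnNge.
have aN0 : (0 < size (a N))%N by rewrite size_poly_gt0.
rewrite -(prednK aN0) ltnS; apply/leq_sizeP => j; rewrite leq_eqVlt => /orP[/eqP<-|hj].
  by rewrite coefB cb lead_coefE subrr.
rewrite coefB !nth_default ?subrr//; last by rewrite -(prednK aN0).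
by apply: leq_trans sb _; rewrite -(prednK aN0).
Qed.

Lemma noetherian_surj (A B : comNzRingType) (phi : {rmorphism A -> B}) :
  (forall b, exists a, phi a = b) -> noetherian_ring A -> noetherian_ring B.
Proof.
move=> sphi nA S iS.
have [|s sS Ss] := nA (phi @^-1` S).
  split=> /= [|p q|a p] /=; first by rewrite rmorph0; exact: ideal_zero.
    by rewrite rmorphD; exact: ideal_add.
  by rewrite rmorphM; exact: ideal_mul.
exists (map phi s) => [_ /mapP[p ps ->]|b Sb K iK sK]; first exact: sS ps.
have [a ab] := sphi b; have Sa : (phi @^-1` S) a by rewrite /= ab.
rewrite -ab; apply: (Ss a Sa (phi @^-1` K)).
  split=> /= [|p q|c p] /=; first by rewrite rmorph0; exact: ideal_zero.
    by rewrite rmorphD; exact: ideal_add.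
  by rewrite rmorphM; exact: ideal_mul.
by move=> p /= ps; apply: sK; exact: map_f.
Qed.

Lemma noetherian_field (F : fieldType) : noetherian_ring F.
Proof.
move=> S iS; have [[a Sa a0]|h] := pselect (exists2 a, S a & a != 0).
  exists [:: a] => [p|p Sp K iK sK]; first by rewrite inE => /eqP->.
  rewrite -(mulfVK a0 p); apply: ideal_mul => //; apply: sK; rewrite /= inE; exact: eqxx.
exists [::] => // p Sp K iK _; have [->|p0] := eqVneq p 0; first exact: ideal_zero.
by case: h; exists p.
Qed.

Lemma mpoly_alg_ind (k : comNzRingType) n (P : mpoly.mpoly n k -> Prop) :
  (forall c, P (mpoly.mpolyC n c)) ->
  (forall i : 'I_n, P (mpoly.mpolyX k (mpoly.mnm1 i))) ->
  (forall p q, P p -> P q -> P (p + q)) -> (forall p q, P p -> P q -> P (p * q)) ->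
  forall p, P p.
Proof.
move=> PC PX PD PM; elim/mpoly.mpolyind => [|c m p _ _ Pp]; first by rewrite -mpoly.mpolyC0; exact: PC.
apply: PD => //; rewrite -mpoly.mul_mpolyC; apply: (PM) => //.
rewrite mpoly.mpolyXE_id; apply: (big_ind P _ PM) => [|i _]; first by rewrite -mpoly.mpolyC1.
elim: (m i) => [|d IH]; first by rewrite expr0 -mpoly.mpolyC1.
by rewrite exprS; apply: PM.
Qed.

Lemma noetherian_mpoly (k : fieldType) n : noetherian_ring (mpoly.mpoly n k).
Proof.
elim: n => [|n IH].
  apply: (@noetherian_surj k (mpoly.mpoly 0 k) (@mpoly.mpolyC 0 k)); last exact: noetherian_field.
  elim/mpoly_alg_ind => [c|[]//|p q [a <-] [b <-]|p q [a <-] [b <-]]; first by exists c.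
    by exists (a + b); rewrite rmorphD.
  by exists (a * b); rewrite rmorphM.
have cu : commr_rmorph (@mpoly.mwiden n k) (mpoly.mpolyX k (mpoly.mnm1 ord_max)).
  by move=> p; exact: mulrC.
apply: (@noetherian_surj {poly (mpoly.mpoly n k)} (mpoly.mpoly n.+1 k) (horner_morph cu)); last exact: noetherian_poly.
elim/mpoly_alg_ind => [c|i|p q [a <-] [b <-]|p q [a <-] [b <-]].
- by exists (mpoly.mpolyC n c)%:P; apply: etrans (horner_morphC cu _) _; exact: mpoly.mwidenC.
- case: (unliftP ord_max i) => [j ->|->]; last by exists 'X; exact: horner_morphX.
  exists (mpoly.mpolyX k (mpoly.mnm1 j))%:P; apply: etrans (horner_morphC cu _) _.
  rewrite [LHS](_ : _ = mpoly.mwiden (mpoly.mpolyX k (mpoly.mnm1 (j : 'I_n)))) // mpoly.mwidenX.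
  congr mpoly.mpolyX; rewrite mpoly.mnmwiden1; congr mpoly.mnm1.
  by apply: val_inj; rewrite /= /bump leqNgt ltn_ord.
- by exists (a + b); rewrite rmorphD.
- by exists (a * b); rewrite rmorphM.
Qed.

(** The polynomials vanishing on the locus form an ideal; its generators need not be
    taken from J. *)
Lemma zero_locus_finite (k : closedFieldType) n (J : set (mpoly.mpoly n k)) :
  exists s : seq (mpoly.mpoly n k), zero_locus J = zero_locus [set` s].
Proof.
pose S : set (mpoly.mpoly n k) := fun p => forall v, zero_locus J v -> mpoly.meval v p = 0.
have iS : is_ideal S.
  split=> [v _|p q hp hq v Jv|a p hp v Jv]; first by rewrite rmorph0.
    by rewrite rmorphD /= hp // hq // addr0.
  by rewrite rmorphM /= hp // mulr0.
have [s sS Ss] := noetherian_mpoly iS; exists s; apply/seteqP; split=> v hv p.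
  by move=> /sS; apply.
move=> Jp; have Sp : S p by move=> w; apply.
apply: (Ss p Sp (fun q => mpoly.meval v q = 0)); last by move=> q; exact: hv.
split=> [|a b|a b] /=; first by rewrite rmorph0.
  by rewrite rmorphD /= => -> ->; rewrite addr0.
by rewrite rmorphM /= => ->; rewrite mulr0.
Qed.

End HilbertBasis.

(** * Locally closed subsets of varieties *)

Section Varieties.
Import (canonicals, coercions) mpoly.
Local Open Scope ring_scope.
Variable k : closedFieldType.
Implicit Types X Y T : funSpaceType k.

Lemma alg_morphism_id X : alg_morphism (@id X).
Proof. by split=> [x|x h //]; exact: cvg_id. Qed.

Lemma alg_morphism_comp X Y T (f : X -> Y) (g : Y -> T) :
  alg_morphism f -> alg_morphism g -> alg_morphism (g \o f).
Proof.
move=> [cf rf] [cg rg]; split; first exact: (continuous_post cg cf).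
by move=> x h /rg /rf.
Qed.

(** A map identifying T, as a space with functions, with its image in X. Subsets of
    subsets are treated at once by composing embeddings. *)
Definition embedding T X (i : T -> X) :=
  [/\ injective i, (forall D : set T, open D <-> exists2 V, open V & D = i @^-1` V) &
    forall t f, regular_at t f <->
      exists2 F, regular_at (i t) F & \forall y \near t, f y = F (i y)].

Lemma embedding_set_val X (A : set X) : embedding (@set_val X A : set_type A -> X).
Proof.
split=> [|D|t f //]; first exact: set_val_inj.
by split=> [[V oV <-]|[V oV ->]]; exists V.
Qed.

Lemma embedding_comp T Y X (i : T -> Y) (j : Y -> X) :
  embedding i -> embedding j -> embedding (j \o i).
Proof.
move=> [inji oi ri] [injj oj rj]; split.
- exact: inj_comp.
- move=> D; rewrite oi; split=> [[V /oj[W oW ->] ->]|[W oW ->]]; first by exists W.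
  by exists (j @^-1` W) => //; apply/oj; exists W.
have ci : continuous i by apply/continuousP => V oV; apply/oi; exists V.
move=> t f; rewrite ri; split=> [[F /rj[H rH FH] fF]|[H rH fH]]; last first.
  by exists (H \o j) => //; apply/rj; exists H => //; near=> y.
exists H => //; have n : \forall y \near t, F (i y) = H (j (i y)) := ci _ _ FH.
by apply: filterS2 fF n => y -> ->.
Unshelve. all: by end_near. Qed.

Lemma embedding_morphism T X (i : T -> X) : embedding i -> alg_morphism i.
Proof.
move=> [_ oi ri]; split; first by apply/continuousP => V oV; apply/oi; exists V.
by move=> t h rh; apply/ri; exists h => //; near=> y.
Unshelve. all: by end_near. Qed.

Lemma embedding_lift T X Y (i : T -> X) (f : Y -> T) :
  embedding i -> alg_morphism (i \o f) -> alg_morphism f.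
Proof.
move=> [_ oi ri] [cf rf].
have c : continuous f.
  by apply/continuousP => D /oi[V oV ->]; move/continuousP: cf; apply.
split=> // y h /ri[F rF hF]; have := rf _ _ rF; apply: regular_at_germ.
have n : \forall z \near y, h (f z) = F (i (f z)) := c _ _ hF.
by apply: filterS n => z /= ->.
Qed.

Lemma alg_morphism_val X (A : set X) : alg_morphism (@set_val X A : set_type A -> X).
Proof. exact/embedding_morphism/embedding_set_val. Qed.

Lemma alg_morphism_sub X Y (A : set X) (f : Y -> set_type A) :
  alg_morphism ((@set_val X A : set_type A -> X) \o f) -> alg_morphism f.
Proof. exact/embedding_lift/embedding_set_val. Qed.

Definition extend_coord n (v : 'I_n -> k) (s : k) : 'I_n.+1 -> k :=
  fun i => if unlift ord_max i is Some j then v j else s.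

Lemma extend_coord_lift n (v : 'I_n -> k) s j : extend_coord v s (lift ord_max j) = v j.
Proof. by rewrite /extend_coord liftK. Qed.

Lemma extend_coord_max n (v : 'I_n -> k) s : extend_coord v s ord_max = s.
Proof. by rewrite /extend_coord unlift_none. Qed.

Lemma widen_lift n (j : 'I_n) : widen_ord (leqnSn n) j = lift ord_max j.
Proof. by apply: val_inj; rewrite /= /bump leqNgt ltn_ord. Qed.

Lemma meval_mwiden n (v : 'I_n -> k) s p :
  mpoly.meval (extend_coord v s) (mpoly.mwiden p) = mpoly.meval v p.
Proof.
elim/mpoly_alg_ind: p => [c|i|p q hp hq|p q hp hq].
- by rewrite mpoly.mwidenC !mpoly.mevalC.
- rewrite mpoly.mwidenX mpoly.mnmwiden1 mpoly.mevalXU.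
  by rewrite [widen_ord _ _]widen_lift extend_coord_lift mpoly.mevalXU.
- by rewrite mpoly.mwidenD !mpoly.mevalD hp hq.
- by rewrite mpoly.mwidenM !mpoly.mevalM hp hq.
Qed.

(** A polynomial in the coordinates and in 1/h becomes a polynomial in the coordinates
    after multiplication by any large enough power of h. *)
Lemma clear_denominator n (h : mpoly.mpoly n k) (p : mpoly.mpoly n.+1 k) :
  exists d0, forall d, (d0 <= d)%N -> exists p', forall v, mpoly.meval v h != 0 ->
    mpoly.meval v p' =
      mpoly.meval v h ^+ d * mpoly.meval (extend_coord v (mpoly.meval v h)^-1) p.
Proof.
elim/mpoly_alg_ind: p => [c|i|p q [d hd] [e he]|p q [d hd] [e he]].
- exists 0%N => d _; exists (h ^+ d * mpoly.mpolyC n c) => v _.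
  by rewrite mpoly.mevalM rmorphXn /= !mpoly.mevalC.
- case: (unliftP ord_max i) => [j ->|->].
    exists 0%N => d _; exists (h ^+ d * mpoly.mpolyX k (mpoly.mnm1 (j : 'I_n))) => v _.
    by rewrite mpoly.mevalM rmorphXn /= !mpoly.mevalXU extend_coord_lift.
  exists 1%N => -[//|d] _; exists (h ^+ d) => v h0.
  by rewrite rmorphXn /= mpoly.mevalXU extend_coord_max exprSr mulfK.
- exists (maxn d e) => m; rewrite geq_max => /andP[/hd[p' hp'] /he[q' hq']].
  exists (p' + q') => v h0; rewrite !mpoly.mevalD hp' // hq' //.
  by rewrite mulrDr.
- exists (d + e)%N => m dem; have [p' hp'] := hd d (leqnn d).
  have [|q' hq'] := he (m - d)%N; first by rewrite leq_subRL // (leq_trans _ dem) ?leq_addr.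
  exists (p' * q') => v h0; rewrite !mpoly.mevalM hp' // hq' //.
  rewrite -{2}(subnKC (leq_trans (leq_addr e d) dem)) exprD.
  by rewrite mulrACA.
Qed.

(** Coordinates of an affine open subset U, expressed on the ambient space X so that
    no element of the subtype U appears. *)
Record affine_chart X (U : set X) n (xi : X -> 'I_n -> k) (J : set (mpoly.mpoly n k)) :=
  AffineChart {
  achart_open : open U;
  achart_inj : forall x y, U x -> U y -> xi x = xi y -> x = y;
  achart_closed : forall C, closed C -> exists J', forall x, U x ->
    (C x <-> zero_locus J' (xi x));
  achart_zero : forall J', exists2 C, closed C & forall x, U x ->
    (C x <-> zero_locus J' (xi x));
  achart_regular : forall x f, U x -> (regular_at x f <-> exists p q,
    mpoly.meval (xi x) q != 0 /\
    \forall y \near x, f y * mpoly.meval (xi y) q = mpoly.meval (xi y) p);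
  achart_range : forall v, zero_locus J v <-> exists2 x, U x & xi x = v }.

Lemma affine_chart_exists X (U : set X) : open U -> affine (set_type U : funSpaceType k) ->
  exists n (xi : X -> 'I_n -> k) J, affine_chart U xi J.
Proof.
move=> oU [n [xi [J [[injxi clxi rxi] rg]]]].
pose xi' x := if pselect (x \in U) is left e then xi (SigSub e) else fun=> 0.
have xiE (u : set_type U) : xi' (set_val u) = xi u.
  rewrite /xi'; case: pselect => [e|[]]; last by apply/mem_set; exact: (set_valP u).
  by congr xi; apply: set_val_inj; exact: set_val_mk.
have subU x : U x -> exists u : set_type U, set_val u = x.
  by move=> Ux; exists (SigSub (mem_set Ux)); exact: set_val_mk.
have nearU (u : set_type U) (Q : X -> Prop) :
    (\forall x \near set_val u, Q x) <-> (\forall y \near u, Q (set_val y)).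
  split; first exact: nbhs_set_type.
  move=> h; pose W : set (set_type U) := [set y | Q (set_val y)].
    have n1 : nbhs (set_val u) (set_val @` W°).
      apply: open_nbhs_nbhs; split; first exact: open_set_type oU (open_interior _).
    by exists u.
  by apply: filterS n1 => _ [y /interior_subset /= Qy <-].
exists n, xi', J; split => //.
- by move=> _ _ /subU[u <-] /subU[v <-]; rewrite !xiE => /injxi ->.
- move=> C cC; have : closed ((@set_val X U) @^-1` C).
    by apply: preimage_closed => //; move=> u _; exact: initial_continuous.
  move=> /clxi[J' CJ]; exists J' => _ /subU[u <-].
  by rewrite xiE -[C _]/((set_val @^-1` C) u) CJ.
- move=> J'; have : closed (xi @^-1` zero_locus J') by apply/clxi; exists J'.
  move=> /closed_openC[V oV VE]; exists (~` V); first exact: open_closedC.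
  move=> _ /subU[u <-]; rewrite xiE -[zero_locus _ _]/((xi @^-1` zero_locus J') u).
  rewrite -[xi @^-1` _]setCK -VE; split => h; exact: h.
- move=> _ f /subU[u <-].
  have rE : regular_at (set_val u) f <-> regular_at u (f \o set_val).
    split=> [rf|[F rF fF]]; first by exists f => //; near=> y.
    apply: regular_at_germ rF; apply/nearU.
    by apply: filterS fF => y /= ->.
  rewrite rE rxi; split=> -[p [q [q0 h]]]; exists p, q; split; rewrite ?xiE // in q0 *.
    by apply/nearU; apply: filterS h => y; rewrite xiE.
  by move/nearU: h; apply: filterS => y; rewrite xiE.
- move=> v; rewrite -rg; split=> [[u _ <-]|[_ /subU[u <-] <-]].
    by exists (set_val u); rewrite ?xiE//; exact: (set_valP u).
  by exists u; rewrite ?xiE.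
Unshelve. all: by end_near. Qed.

(** Rabinowitsch trick: the locally closed piece where h does not vanish is closed in an
    affine space of one more dimension, with last coordinate 1/h. *)
Lemma affine_piece X (U : set X) n (xi : X -> 'I_n -> k) J T (i : T -> X)
    (h : mpoly.mpoly n k) (C : set X) :
  affine_chart U xi J -> embedding i -> closed C ->
  (forall x, range i x <-> [/\ U x, mpoly.meval (xi x) h != 0 & C x]) -> affine T.
Proof.
move=> ac ei cC rgi; have [inji oi ri] := ei; have [ci _] := embedding_morphism ei.
have iP t : [/\ U (i t), mpoly.meval (xi (i t)) h != 0 & C (i t)] by apply/rgi; exists t.
have iU t : U (i t) by have [] := iP t.
pose eta t := extend_coord (xi (i t)) (mpoly.meval (xi (i t)) h)^-1.
have etaW t p : mpoly.meval (eta t) (mpoly.mwiden p) = mpoly.meval (xi (i t)) p.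
  exact: meval_mwiden.
have etaI : injective eta.
  move=> t u e; apply: inji; apply: (achart_inj ac) => //; apply/funext => j.
  by have := congr1 (fun f => f (lift ord_max j)) e; rewrite /eta !extend_coord_lift.
have clT p : closed [set t | mpoly.meval (eta t) p = 0].
  have [d hd] := clear_denominator h p; have [p' hp'] := hd d (leqnn d).
  have [D cD DE] := achart_zero ac [set p'].
  rewrite (_ : mkset _ = i @^-1` D).
    by apply: preimage_closed => // t _; exact: ci.
  apply/seteqP; split=> t /=; have [Ut h0 _] := iP t; rewrite DE //.
    by move=> e q ->; rewrite hp' // -/(eta t) e mulr0.
  move/(_ p' erefl); rewrite hp' // => /eqP; rewrite mulf_eq0 expf_eq0 (negbTE h0) andbF.
  by move/eqP.
have [JC CJ] := achart_closed ac cC.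
exists n.+1, eta, ([set mpoly.mwiden p | p in J] `|` [set mpoly.mwiden p | p in JC] `|`
  [set mpoly.mpolyX k (mpoly.mnm1 ord_max) * mpoly.mwiden h - 1]); split; first split=> //.
- move=> A; split=> [/closed_openC/oi[V oV VE]|[J' ->]]; last first.
    rewrite (_ : _ @^-1` _ = \bigcap_(p in J') [set t | mpoly.meval (eta t) p = 0]).
      by apply: closed_bigI => p _; exact: clT.
    by [].
  have [J' hJ] := achart_closed ac (open_closedC oV).
  exists [set mpoly.mwiden p | p in J'].
  apply/seteqP; split=> t /=.
    move=> At _ [p Jp <-]; rewrite etaW.
    have /hJ : (~` V) (i t) by move=> Vt; have : (~` A) t by [rewrite VE]; apply.
    by apply.
  move=> hz; apply: contrapT => nA; have Vt : V (i t) by have : (~` A) t by []; rewrite VE.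
  suff : (~` V) (i t) by apply.
  by apply/hJ => // p Jp; rewrite -etaW; apply: hz; exists p.
- move=> t f; rewrite ri; split=> [[F /(achart_regular ac _ (iU t))[p [q [q0 FE]]] fF]|].
    exists (mpoly.mwiden p), (mpoly.mwiden q); rewrite etaW; split=> //.
    have n1 : \forall y \near t, F (i y) * mpoly.meval (xi (i y)) q = mpoly.meval (xi (i y)) p
      := ci _ _ FE.
    by apply: filterS2 fF n1 => y -> e; rewrite !etaW.
  move=> [p [q [q0 fE]]].
  have [d1 hd1] := clear_denominator h p; have [d2 hd2] := clear_denominator h q.
  have [p' hp'] := hd1 _ (leq_maxl d1 d2); have [q' hq'] := hd2 _ (leq_maxr d1 d2).
  have q'0 u : (mpoly.meval (xi (i u)) q' == 0) = (mpoly.meval (eta u) q == 0).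
    have [_ h0 _] := iP u; rewrite hq' // mulf_eq0 expf_eq0 (negbTE h0) andbF //.
  pose F x := mpoly.meval (xi x) p' / mpoly.meval (xi x) q'.
  have [D cD DE] := achart_zero ac [set q'].
  exists F.
    apply/(achart_regular ac _ (iU t)); exists p', q'; rewrite q'0; split=> //.
    have nU : nbhs (i t) (U `&` ~` D).
      apply: open_nbhs_nbhs; split.
        by apply: openI; [exact: achart_open ac|exact: closed_openC].
      split=> //; rewrite /setC /= DE // => /(_ q' erefl)/eqP; rewrite q'0.
      exact/negP.
    apply: filterS nU => x [Ux]; rewrite /setC /= DE // => nz; rewrite /F mulfVK //.
    by apply/eqP => qx; apply: nz => _ ->.
  have nq : nbhs t (~` [set u | mpoly.meval (eta u) q = 0]).
    apply: open_nbhs_nbhs; split; first exact: closed_openC.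
    exact/eqP.
  apply: filterS2 fE nq => u fu /eqP qu; have [_ h0 _] := iP u.
  have hn0 : mpoly.meval (xi (i u)) h ^+ maxn d1 d2 != 0 by rewrite expf_neq0.
  rewrite /F hp' // hq' // -/(eta u) -fu -mulf_div divff // mul1r mulfK //.
- apply/seteqP; split=> [_ [t _ <-]|v hv].
    have [Ut h0 Ct] := iP t.
    move=> _ [[[p Jp <-]|[p Jp <-]]|->].
    + by rewrite etaW; have /(achart_range ac) : exists2 x, U x & xi x = xi (i t) by [exists (i t)]; apply.
    + by rewrite etaW; have := (CJ _ Ut).1 Ct; apply.
    + rewrite mpoly.mevalB mpoly.mevalM mpoly.mevalXU etaW /eta extend_coord_max.
      by rewrite mpoly.meval1 mulVf // subrr.
  pose w j := v (lift ord_max j).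
  have vE : v = extend_coord w (v ord_max).
    apply/funext => j; rewrite /extend_coord.
    by case: unliftP => [j' ->|->].
  have wJ : zero_locus J w.
    move=> p Jp; rewrite -(meval_mwiden w (v ord_max)) -vE; apply: hv.
    by left; left; exists p.
  have /(achart_range ac)[x Ux xw] := wJ.
  have hx : v ord_max * mpoly.meval w h = 1.
    apply/eqP; rewrite -subr_eq0; apply/eqP.
    rewrite -(meval_mwiden w (v ord_max)) -vE -{1}mpoly.mevalXU -mpoly.mevalM.
    rewrite -(mpoly.meval1 v) -mpoly.mevalB; apply: hv; by right.
  have h0 : mpoly.meval w h != 0.
    by apply/eqP => e; move: hx; rewrite e mulr0 => /eqP; rewrite eq_sym oner_eq0.
  have : range i x.
    apply/rgi; split=> //; first by rewrite xw.
    apply/CJ => // p Jp; rewrite xw -(meval_mwiden w (v ord_max)) -vE; apply: hv.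
    by left; right; exists p.
  move=> [t _ tx]; exists t => //; rewrite /eta tx xw [RHS]vE; congr extend_coord.
  by apply: (mulIf h0); rewrite hx mulVf.
Qed.

Lemma embedding_set_val2 X (A : set X) (W : set (set_type A : funSpaceType k)) :
  embedding (fun t : set_type W => set_val (set_val t) : X).
Proof.
exact: (embedding_comp (@embedding_set_val (set_type A : funSpaceType k) W) (@embedding_set_val X A)).
Qed.

(** In each affine chart the open condition is a union of finitely many principal open
    sets, by the Hilbert basis theorem. *)
Lemma prevariety_sub X (A : set X) : prevariety X -> subvariety A ->
  prevariety (set_type A : funSpaceType k).
Proof.
move=> [n [U [oU cU aU]]] [V [C [oV cC AE]]].
pose S := (set_type A : funSpaceType k).
have step i : exists mW : {m : nat & 'I_m -> set S},
    [/\ forall j, open (tagged mW j), forall j, affine (set_type (tagged mW j) : funSpaceType k) &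
      forall a : S, U i (set_val a) -> exists j, tagged mW j a].
  have [m [xi [J ac]]] := affine_chart_exists (oU i) (aU i).
  have [J' hJ] := achart_closed ac (open_closedC oV).
  have [s sJ] := zero_locus_finite J'.
  pose D j := [set x | U i x /\ mpoly.meval (xi x) (tnth (in_tuple s) j) != 0].
  have oD j : open (D j).
    have [E cE hE] := achart_zero ac [set tnth (in_tuple s) j].
    rewrite (_ : D j = U i `&` ~` E); first by apply: openI; [exact: oU|exact: closed_openC].
    apply/seteqP; split=> x [Ux h]; split=> //.
      by rewrite /setC /= hE // => /(_ _ erefl)/eqP; exact/negP.
    by apply/eqP => e; apply: h; apply/hE => // _ ->.
  exists (Tagged (fun m => 'I_m -> set S) (fun j : 'I_(size s) => (@set_val X A) @^-1` D j)).
  have VD x : U i x -> V x <-> exists j, D j x.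
    move=> Ux; split=> [Vx|[j [_ h]]].
      apply: contrapT => nD; suff /hJ : zero_locus J' (xi x) by move/(_ Ux); apply.
      rewrite sJ => p /= ps; apply: contrapT => /eqP p0; apply: nD.
      have [j jp] : exists j, tnth (in_tuple s) j = p.
        by have /tnthP[j ->] : p \in in_tuple s by []; exists j.
      by exists j; split=> //; rewrite jp.
    apply: contrapT => nV; have /(hJ _ Ux) : (~` V) x by [].
    by rewrite sJ => /(_ (tnth (in_tuple s) j) (mem_tnth _ _)) e; move: h; rewrite e eqxx.
  split=> /= [j|j|a Ua].
  - by exists (D j).
  - apply: (affine_piece (h := tnth (in_tuple s) j) (C := C) ac (embedding_set_val2 _)) => //.
    move=> x; split=> [[t _ <-]|[Ux h Cx]].
      have [Ut ht] : D j (set_val (set_val t)) := set_valP t.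
      by split=> //; have := set_valP (set_val t); rewrite {1}AE => -[].
    have Ax : A x by rewrite AE; split=> //; apply/(VD _ Ux); exists j.
    have mA : x \in A by exact/mem_set.
    have mD : (SigSub mA : S) \in (@set_val X A) @^-1` D j.
      by apply/mem_set; rewrite /= set_val_mk.
    by exists (SigSub mD) => //; rewrite !set_val_mk.
  - have /(VD _ Ua)[j Dj] : V (set_val a) by have := set_valP a; rewrite {1}AE => -[].
    by exists j.
have [mW hmW] := choice step.
pose idx := {i : 'I_n & 'I_(tag (mW i))}.
pose W (u : idx) := tagged (mW (tag u)) (tagged u).
exists #|{: idx}|, (fun a => W (enum_val a)); split.
- by move=> a; have [+ _ _] := hmW (tag (enum_val a)); apply.
- apply/seteqP; split=> // a _.
  have [i _ Ui] : (\bigcup_i U i) (set_val a) by rewrite cU.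
  have [_ _ /(_ a Ui)[j Wj]] := hmW i.
  by exists (enum_rank (Tagged (fun i => 'I_(tag (mW i))) j : idx)) => //; rewrite enum_rankK.
- by move=> a; have [_ + _] := hmW (tag (enum_val a)); apply.
Qed.

Lemma variety_sub X (A : set X) : is_variety X -> subvariety A ->
  is_variety (set_type A : funSpaceType k).
Proof.
move=> [pX sX] sA; split; first exact: prevariety_sub.
move=> Y f g pY mf mg.
have h (u : Y -> set_type A) : alg_morphism u -> alg_morphism ((@set_val X A) \o u : Y -> X).
  by move=> mu; exact: alg_morphism_comp mu (alg_morphism_val _).
have := sX Y _ _ pY (h f mf) (h g mg).
rewrite (_ : mkset _ = [set y | f y = g y]) //.
by apply/seteqP; split=> y /= => [/set_val_inj|->].
Qed.

Lemma subvariety_closed X (A : set X) : closed A -> subvariety A.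
Proof. by move=> cA; exists setT, A; split; [exact: openT| |rewrite setTI]. Qed.

Lemma subvariety_setI X (A B : set X) : subvariety A -> subvariety B -> subvariety (A `&` B).
Proof.
move=> [U [C [oU cC ->]]] [V [D [oV cD ->]]]; exists (U `&` V), (C `&` D).
by split; [exact: openI|exact: closedI|rewrite setIACA].
Qed.

Lemma subvariety_preimage X Y (f : X -> Y) (A : set Y) :
  continuous f -> subvariety A -> subvariety (f @^-1` A).
Proof.
move=> cf [U [C [oU cC ->]]]; exists (f @^-1` U), (f @^-1` C); split=> //.
  by move/continuousP: cf; apply.
by apply: preimage_closed => // x _; exact: cf.
Qed.

Lemma regular_cst X (c : k) (x : X) : prevariety X -> regular_at x (fun=> c).
Proof.
move=> [n [U [oU cU aU]]]; have [i _ Ui] : (\bigcup_i U i) x by rewrite cU.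
have [m [xi [J ac]]] := affine_chart_exists (oU i) (aU i).
apply/(achart_regular ac _ Ui); exists (mpoly.mpolyC m c), 1.
rewrite mpoly.meval1 oner_neq0; split=> //.
by near=> y; rewrite mpoly.meval1 mpoly.mevalC mulr1.
Unshelve. all: by end_near. Qed.

Lemma alg_morphism_cst X Y (y : Y) : prevariety X -> alg_morphism (fun _ : X => y).
Proof.
by move=> pX; split=> [x|x h _]; [exact: cst_continuous|exact: regular_cst].
Qed.

Lemma closed_fibre X Y (f : X -> Y) (y : Y) : prevariety X -> Defs.separated Y ->
  alg_morphism f -> closed [set x | f x = y].
Proof.
move=> pX sY mf; exact: (sY X f (fun=> y) pX mf (alg_morphism_cst y pX)).
Qed.

(** The universal property, tested on a one-point variety, separates points. *)
Lemma alg_product_ext n (X : 'I_n -> funSpaceType k) (P : funSpaceType k)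
    (pr : forall i, P -> X i) (p q : P) :
  alg_product pr -> (forall i, pr i p = pr i q) -> p = q.
Proof.
move=> [[pP sP] mpr uP] pq.
have vpt : is_variety (set_type [set p] : funSpaceType k).
  apply: variety_sub => //; apply: subvariety_closed.
  exact: (closed_fibre (y := p) pP sP (alg_morphism_id P)).
have [h [_ uh]] := uP _ (fun i _ => pr i p) vpt (fun i => alg_morphism_cst _ vpt.1).
have hp : h = fun=> p by apply: uh; split=> //; exact: alg_morphism_cst vpt.1.
have hq : h = fun=> q.
  apply: uh; split; first exact: alg_morphism_cst vpt.1.
  by move=> i; apply/funext => x; rewrite /= pq.
have e : p \in [set p] by rewrite inE.
by have := congr1 (fun f => f (SigSub e : set_type [set p])) hp; rewrite hq.
Qed.

End Varieties.

(** * Products with powers of an algebraic group *)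

Section Powers.
Variables (k : closedFieldType) (G : algGroupType k).
Implicit Types V X Y T Z : funSpaceType k.

Lemma alg_morphism_mul T (f g : T -> G) : is_variety T -> alg_morphism f ->
  alg_morphism g -> alg_morphism (fun t => f t * g t)%g.
Proof.
move=> vT mf mg; have [P [pr [[vP mpr uP] mm]]] := alg_group_mul (s := G).
have [|h [[mh hE] _]] := uP T (fun i : 'I_2 => if i == ord0 then f else g) vT.
  by move=> i; case: ifP.
rewrite (_ : (fun t => f t * g t)%g = (fun x : P => pr ord0 x * pr ord_max x)%g \o h).
  exact: alg_morphism_comp mh mm.
apply/funext => t /=.
by rewrite -[pr ord0 _]/((pr ord0 \o h) t) -[pr ord_max _]/((pr ord_max \o h) t) !hE.
Qed.

Lemma alg_morphism_inv T (f : T -> G) : alg_morphism f -> alg_morphism (fun t => (f t)^-1)%g.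
Proof. by move=> mf; apply: (alg_morphism_comp mf); exact: alg_group_inv. Qed.

(** Z is the categorical product of V and n copies of G. The universal property alone is
    used, so no product of varieties has to be constructed. *)
Definition power_product Z V n (a : Z -> V) (b : 'I_n -> Z -> G) :=
  [/\ is_variety Z, alg_morphism a, forall i, alg_morphism (b i) &
    forall T (f : T -> V) (g : 'I_n -> T -> G), is_variety T -> alg_morphism f ->
      (forall i, alg_morphism (g i)) -> exists! h : T -> Z,
      alg_morphism h /\ (forall t, a (h t) = f t) /\ forall i t, b i (h t) = g i t].

Lemma meq_prod2 (Z Z1 Z2 : variety k) (p1 : Z -> Z1) (p2 : Z -> Z2) :
  alg_morphism p1 -> alg_morphism p2 ->
  (forall T (f1 : T -> Z1) (f2 : T -> Z2), is_variety T -> alg_morphism f1 ->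
    alg_morphism f2 -> exists! h : T -> Z,
    alg_morphism h /\ (forall t, p1 (h t) = f1 t) /\ forall t, p2 (h t) = f2 t) ->
  motive_eq G [class Z] ([class Z1] * [class Z2]).
Proof.
move=> m1 m2 u.
pose pr (i : 'I_2) : Z -> if i == ord0 then Z1 else Z2 :=
  if i == ord0 as b return Z -> if b then Z1 else Z2 then p1 else p2.
have I2 (Q : 'I_2 -> Prop) : Q ord0 -> Q ord_max -> forall i, Q i.
  move=> Q0 Q1 i; have [->//|i0] := eqVneq i ord0; suff -> : i = ord_max by [].
  by apply: val_inj; case: i i0 => -[|[|]].
apply: (@meq_prod _ _ _ _ _ pr); split; first exact: varietyP.
  by apply: I2.
move=> Y f vY mf.
have [h [[mh [h1 h2]] hu]] := u Y (f ord0) (f ord_max) vY (mf ord0) (mf ord_max).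
exists h; split.
  by split=> //; apply: I2; apply/funext => t; [exact: h1|exact: h2].
move=> h' [mh' hE]; apply: hu; split=> //.
by split=> t; [have := congr1 (fun v => v t) (hE ord0)|have := congr1 (fun v => v t) (hE ord_max)].
Qed.

Local Open Scope motive_scope.

Lemma meq_mul1r (a : motive k) : motive_eq G (a * 1) a.
Proof. by apply: meq_trans (meq_mulC _ _ _) _; exact: meq_mul1. Qed.

(** The locus where the last coordinate is 1 is a product of V and one copy of G less,
    and Z is the product of this locus and G. *)
Lemma power_product_class n Z V (hZ : is_variety Z) (hV : is_variety V)
    (a : Z -> V) (b : 'I_n -> Z -> G) : power_product a b ->
  motive_eq G [class (Variety hZ)] ([class (Variety hV)] * [class (alg_group_variety G)] ^+ n).
Proof.
elim: n Z hZ a b => [|n IH] Z hZ a b [vZ ma mb up].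
  apply: meq_trans (meq_sym (meq_mul1r _)); apply: meq_iso.
  have [h [[mh [hE _]] _]] := up V (@id V) (fun i _ => 1%g) hV (alg_morphism_id V)
    (fun i => alg_morphism_cst _ hV.1).
  exists a, h; split=> //; move=> z.
  have [h' [_ uh']] := up Z a (fun i _ => 1%g) hZ ma (fun i => alg_morphism_cst _ hZ.1).
  have e1 : h' = h \o a.
    apply: uh'; split; first exact: alg_morphism_comp.
    by split=> [t|[]//]; rewrite /= hE.
  have e2 : h' = id by apply: uh'; split; [exact: alg_morphism_id|split=> // -[]].
  by rewrite -[h (a z)]/((h \o a) z) -e1 e2.
have [vG sG] := varietyP (alg_group_variety G).
pose A : set Z := [set z | b ord_max z = 1%g].
have cA : closed A by exact: closed_fibre hZ.1 sG (mb ord_max).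
pose W := (set_type A : funSpaceType k).
have vW : is_variety W by apply: variety_sub hZ _; exact: subvariety_closed.
pose b' (j : 'I_n) (w : W) := b (lift ord_max j) (set_val w).
pose a' (w : W) := a (set_val w).
have mval : alg_morphism (@set_val Z A : W -> Z) by exact: alg_morphism_val.
have ma' : alg_morphism a' by exact: (alg_morphism_comp mval ma).
have mb' j : alg_morphism (b' j) by exact: (alg_morphism_comp mval (mb _)).
(* g0 in the last position and g in the others *)
pose cons_max T (g : 'I_n -> T -> G) (g0 : T -> G) (i : 'I_n.+1) :=
  if unlift ord_max i is Some j then g j else g0.
have mcons T (g : 'I_n -> T -> G) g0 : (forall i, alg_morphism (g i)) ->
    alg_morphism g0 -> forall i, alg_morphism (cons_max T g g0 i).
  by move=> mg mg0 i; rewrite /cons_max; case: unliftP.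
have consE T (g : 'I_n -> T -> G) g0 (h : T -> Z) :
    (forall i t, b i (h t) = cons_max T g g0 i t) <->
    (forall j t, b (lift ord_max j) (h t) = g j t) /\ forall t, b ord_max (h t) = g0 t.
  split=> [e|[e e0] i t].
    split=> [j|] t; rewrite e /cons_max; first by rewrite liftK.
    by rewrite unlift_none.
  by rewrite /cons_max; case: unliftP => [j ->|->].
have pW : power_product a' b'.
  split=> // T f g vT mf mg.
  have m1 : alg_morphism (fun _ : T => 1%g : G) by exact: alg_morphism_cst vT.1.
  have [h [[mh [hf /consE[hg h1]]] uh]] := up T f _ vT mf (mcons T g _ mg m1).
  have hA t : h t \in A by rewrite inE /A /= h1.
  exists (fun t => SigSub (hA t)); split.
    split; first by apply: alg_morphism_sub; rewrite (_ : _ \o _ = h).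
    by split=> [t|i t]; rewrite /a' /b' set_val_mk.
  move=> h' [mh' [hf' hg']]; apply/funext => t; apply: set_val_inj; rewrite set_val_mk.
  rewrite (uh ((@set_val Z A) \o h')) //; split; first exact: (alg_morphism_comp mh' mval).
  by split=> //; apply/consE; split=> // u; exact: (set_valP (h' u)).
have [_ _ _ upW] := pW.
have [pi [[mpi [pia pib]] _]] := upW Z a (fun j => b (lift ord_max j)) hZ ma (fun j => mb _).
apply: (meq_trans (b := [class (alg_group_variety G)] * [class (Variety vW)])).
  apply: (@meq_prod2 (Variety hZ) (alg_group_variety G) (Variety vW) (b ord_max) pi) => //.
  move=> T f1 f2 vT m1 m2.
  have mf : alg_morphism (a' \o f2) by exact: (alg_morphism_comp m2 ma').
  have mg j : alg_morphism (b' j \o f2) by exact: (alg_morphism_comp m2 (mb' j)).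
  have [h [[mh [hf /consE[hg h1]]] uh]] := up T _ _ vT mf (mcons T _ _ mg m1).
  have [h2 [_ uh2]] := upW T _ _ vT mf mg.
  have toW (h' : T -> Z) : alg_morphism h' -> (forall t, pi (h' t) = f2 t) <->
      (forall t, a (h' t) = a' (f2 t)) /\ (forall j t, b (lift ord_max j) (h' t) = b' j (f2 t)).
    move=> mh'; split=> [e|[ea eb] t].
      by split=> [t|j t]; rewrite -e ?pia ?pib.
    have e1 : h2 = pi \o h'.
      apply: uh2; split; first exact: (alg_morphism_comp mh' mpi).
      by split=> [u|j u]; rewrite /= ?pia ?pib.
    have e2 : h2 = f2 by apply: uh2; split.
    by rewrite -[pi (h' t)]/((pi \o h') t) -e1 e2.
  exists h; split; first by split=> //; split=> //; apply/toW.
  move=> h' [mh' [h1' /(toW _ mh')[ha hb]]]; apply: uh; split=> //.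
  by split=> //; apply/consE.
apply: meq_trans (meq_mul (meq_refl _ _) (IH W vW a' b' pW)) _.
apply: meq_trans (meq_mulA _ _ _ _) _.
apply: meq_trans (meq_mul (meq_mulC _ _ _) (meq_refl _ _)) _.
exact: meq_sym (meq_mulA _ _ _ _).
Qed.

(** The algebraic families of elements of G parametrized by T, a group under the
    pointwise law. *)
Definition morphisms (T : variety k) := {f : T -> G | alg_morphism f}.

HB.instance Definition _ (T : variety k) := gen_eqMixin (morphisms T).
HB.instance Definition _ (T : variety k) := gen_choiceMixin (morphisms T).

Section MorphismGroup.
Variable T : variety k.
Local Notation M := (morphisms T).

Definition morphisms_one : M :=
  exist _ (fun=> 1%g) (alg_morphism_cst (1%g : G) (varietyP T).1).
Definition morphisms_mul (f g : M) : M :=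
  exist _ (fun t => sval f t * sval g t)%g
    (alg_morphism_mul (varietyP T) (svalP f) (svalP g)).
Definition morphisms_inv (f : M) : M :=
  exist _ (fun t => (sval f t)^-1)%g (alg_morphism_inv (svalP f)).

Lemma morphismsP (f g : M) : (forall t, sval f t = sval g t) -> f = g.
Proof. by case: f g => [f mf] [g mg] /= /funext fg; apply: eq_exist. Qed.

Fact morphisms_mulA : associative morphisms_mul.
Proof. by move=> f g h; apply: morphismsP => t; exact: mulgA. Qed.
Fact morphisms_mul1 : left_id morphisms_one morphisms_mul.
Proof. by move=> f; apply: morphismsP => t; exact: mul1g. Qed.
Fact morphisms_1mul : right_id morphisms_one morphisms_mul.
Proof. by move=> f; apply: morphismsP => t; exact: mulg1. Qed.
Fact morphisms_mulV : left_inverse morphisms_one morphisms_inv morphisms_mul.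
Proof. by move=> f; apply: morphismsP => t; exact: mulVg. Qed.
Fact morphisms_Vmul : right_inverse morphisms_one morphisms_inv morphisms_mul.
Proof. by move=> f; apply: morphismsP => t; exact: mulgV. Qed.

HB.instance Definition _ := isGroup.Build M
  morphisms_mulA morphisms_mul1 morphisms_1mul morphisms_mulV morphisms_Vmul.
End MorphismGroup.

End Powers.

(** * The fundamental group as a transport *)

Section BasedTransport.
Variable R : realType.
Local Notation I := (unit_interval R).
Variables (T : topologicalType) (x0 : T).
Local Notation loop := {path I from x0 to x0 in T}.

Definition path_of (a b : T) (p : I -> T) (cp : continuous p) (p0 : p zero = a)
  (p1 : p one = b) : {path I from a to b in T} := mk_path cp p0 p1.

Lemma loop_class_mul (p q : loop) :
  (loop_class p * loop_class q)%g = loop_class (path_concat p q).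
Proof. exact: pi1_mulE. Qed.

Lemma path_cts (a b : T) (p : {path I from a to b in T}) : continuous p.
Proof. exact: cts_fun. Qed.

Lemma homotopic_of_fun (a b : T) (p q : {path I from a to b in T}) :
  homotopic_fun p q -> homotopic p q.
Proof.
move=> [H [cH H0 H1 Hs]]; exists H; split=> // s.
by have := Hs s; rewrite path_zero path_one.
Qed.

Lemma homotopic_fun_of (a b : T) (p q : {path I from a to b in T}) :
  homotopic p q -> homotopic_fun p q.
Proof.
move=> [H [cH H01 Hs]]; exists H; split=> // [t|t|s]; [exact: (H01 t).1|exact: (H01 t).2|].
by rewrite path_zero path_one.
Qed.

Hypothesis pcT : path_connected R T.

Lemma based_paths : exists S : forall z : T, {path I from x0 to z in T},
  homotopic (S x0) (path_cst R x0).
Proof.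
have h z : exists p : {path I from x0 to z in T}, True.
  by have [p [cp p0 p1]] := pcT x0 z; exists (path_of cp p0 p1).
pose S z := sval (cid (h z)).
exists (fun z => path_concat (path_rev (S x0)) (S z)).
exact: homotopic_rev_concat.
Qed.

(** A path is closed up to a loop by fixed paths from the base point to its ends. The
    path to the base point itself is chosen null-homotopic, so that loops keep their
    class. *)
Lemma transport_base : exists gamma : (I -> T) -> pi1 R x0,
  transport gamma /\ forall c : loop, gamma c = loop_class c.
Proof.
have [S S0] := based_paths.
pose based a b (q : {path I from a to b in T}) : pi1 R x0 :=
  loop_class (path_concat (S a) (path_concat q (path_rev (S b)))).
pose gamma (q : I -> T) : pi1 R x0 := if pselect (continuous q) is left cq
  then based _ _ (path_of cq (erefl (q zero)) (erefl (q one))) else 1%g.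
have gammaE a b (q : {path I from a to b in T}) : gamma q = based a b q.
  have key (p : I -> T) (cp : continuous p) (p0 : p zero = a) (p1 : p one = b) :
      gamma p = based a b (path_of cp p0 p1).
    rewrite /gamma; case: pselect => // cp'; move: p0 p1; case: _ /; case: _ /.
    by congr based; apply/path_eqP.
  rewrite (key q (path_cts (p := q)) (path_zero (s := q)) (path_one (s := q))); congr based.
  exact/path_eqP.
have basedM a b c (p : {path I from a to b in T}) (q : {path I from b to c in T}) :
    based a c (path_concat p q) = (based a b p * based b c q)%g.
  rewrite loop_class_mul; apply/loop_classP; apply: homotopic_sym.
  apply: homotopic_trans (homotopic_sym (homotopic_concatA _ _ _)) _.
  apply: homotopic_concat; first exact: homotopic_refl.
  apply: homotopic_trans (homotopic_sym (homotopic_concatA _ _ _)) _.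
  apply: homotopic_trans; last exact: homotopic_concatA.
  apply: homotopic_concat; first exact: homotopic_refl.
  apply: homotopic_trans (homotopic_concatA _ _ _) _.
  apply: homotopic_trans; last exact: homotopic_cst_concat.
  apply: homotopic_concat; last exact: homotopic_refl.
  exact: homotopic_rev_concat.
exists gamma; split; first split.
- move=> p q cp cq pq.
  pose p' := path_of cp erefl pq; pose q' := path_of cq erefl erefl.
  have := basedM _ _ _ p' q'; rewrite -!gammaE => <-.
  by congr gamma.
- move=> p q pq; have [H [cH H0 H1 Hs]] := pq.
  have cs (s : I) : continuous (fun t : I => H (s, t)).
    apply: (continuous_post cH); apply: continuous_pair; first exact: continuous_cstf.
    by move=> t; exact: cvg_id.
  have cp : continuous p.
    by rewrite (_ : p = fun t => H (zero, t)); [exact: cs|apply/funext => t; rewrite H0].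
  have cq : continuous q.
    by rewrite (_ : q = fun t => H (one, t)); [exact: cs|apply/funext => t; rewrite H1].
  have q0 : q zero = p zero by have [e _] := Hs one; rewrite -e H1.
  have q1 : q one = p one by have [_ e] := Hs one; rewrite -e H1.
  rewrite -[gamma p]/(gamma (path_of cp erefl erefl)) -[gamma q]/(gamma (path_of cq q0 q1)).
  rewrite !gammaE; apply/loop_classP/homotopic_concat; first exact: homotopic_refl.
  apply: homotopic_concat; last exact: homotopic_refl.
  exact: homotopic_of_fun.
- move=> c; rewrite gammaE; apply/loop_classP.
  apply: homotopic_trans.
    apply: homotopic_concat; first exact: S0.
    apply: homotopic_concat; first exact: homotopic_refl.
    exact: homotopic_rev S0.
  apply: homotopic_trans (homotopic_cst_concat _) _.
  apply: homotopic_trans; last exact: homotopic_concat_cst.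
  apply: homotopic_concat; first exact: homotopic_refl.
  by apply: homotopic_of_fun; exists (fun=> x0); split=> //; exact: continuous_cstf.
Qed.

(** Any path becomes trivial for gamma after composition with a suitable loop. *)
Lemma trivial_paths (gamma : (I -> T) -> pi1 R x0) : transport gamma ->
  (forall c : loop, gamma c = loop_class c) ->
  exists theta : T -> I -> T, forall z,
    [/\ continuous (theta z), theta z zero = x0, theta z one = z & gamma (theta z) = 1%g].
Proof.
move=> tg gl; suff h z : exists p : I -> T,
    [/\ continuous p, p zero = x0, p one = z & gamma p = 1%g].
  by have [theta h'] := choice h; exists theta.
have [p [cp p0 p1]] := pcT x0 z; pose c := repr (gamma p)^-1%g.
exists (joinp c p); have cpe : c one = p zero by rewrite path_one p0.
split.
- by apply: continuous_joinp => //; exact: path_cts.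
- by rewrite joinp0 path_zero.
- by rewrite joinp1.
- rewrite (transport_join tg) //; last exact: path_cts.
  by rewrite gl /loop_class reprK mulVg.
Qed.

(** Closing a path with the trivial paths turns it into a loop with the same value
    under gamma; any other transport h changes by its values on the trivial paths. *)
Lemma close_path (gamma : (I -> T) -> pi1 R x0) (theta : T -> I -> T)
    (K : groupType) (h : (I -> T) -> K) (q : I -> T) :
  transport gamma -> (forall c : loop, gamma c = loop_class c) ->
  (forall z, [/\ continuous (theta z), theta z zero = x0, theta z one = z &
    gamma (theta z) = 1%g]) ->
  transport h -> continuous q -> exists2 c : loop, gamma q = loop_class c &
    h c = (h (theta (q zero)) * h q * (h (theta (q one)))^-1)%g.
Proof.
move=> tg gl ht th cq; have [c0 z0 o0 t0] := ht (q zero); have [c1 z1 o1 t1] := ht (q one).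
have cr := continuous_revp c1.
have cj : continuous (joinp q (revp (theta (q one)))).
  by apply: continuous_joinp => //; rewrite revp0 o1.
have cc : continuous (joinp (theta (q zero)) (joinp q (revp (theta (q one))))).
  by apply: continuous_joinp => //; rewrite joinp0 o0.
have e0 : joinp (theta (q zero)) (joinp q (revp (theta (q one)))) zero = x0.
  by rewrite joinp0 z0.
have e1 : joinp (theta (q zero)) (joinp q (revp (theta (q one)))) one = x0.
  by rewrite !joinp1 revp1 z1.
have E (L : groupType) (h' : (I -> T) -> L) : transport h' ->
    h' (path_of cc e0 e1) = (h' (theta (q zero)) * h' q * (h' (theta (q one)))^-1)%g.
  move=> t'; rewrite -[path_of _ _ _ : I -> T]/(joinp _ _).
  rewrite (transport_join t') ?joinp0 ?o0//.
  rewrite (transport_join t') ?revp0 ?o1// (transport_rev t') //.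
  by rewrite mulgA.
exists (path_of cc e0 e1); last exact: E.
by rewrite -gl E // t0 t1 mul1g invg1 mulg1.
Qed.

Lemma transport_conjugate (v w : T) (L : groupType) (h : (I -> T) -> L)
    (p : {path I from v to w in T}) (q : {path I from w to w in T}) : transport h ->
  h (path_concat p (path_concat q (path_rev p))) = (h p * h q * (h p)^-1)%g.
Proof.
move=> th; rewrite -[path_concat _ _ : I -> T]/(joinp p (joinp q (revp p))).
have cp := path_cts (p := p); have cq := path_cts (p := q).
have cr := continuous_revp cp.
have cj : continuous (joinp q (revp p)).
  by apply: continuous_joinp => //; rewrite revp0 !path_one.
rewrite (transport_join th) ?joinp0 ?path_one ?path_zero//.
rewrite (transport_join th) ?revp0 ?path_one ?path_zero// (transport_rev th)//.
by rewrite mulgA.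
Qed.

Lemma transport_repr (L : groupType) (h : (I -> T) -> L) (c : loop) :
  transport h -> h (repr (loop_class c)) = h c.
Proof.
move=> th; apply: (transport_homotopic th); apply: homotopic_fun_of.
exact: homotopic_repr.
Qed.

End BasedTransport.

Lemma transport_morph (R : realType) (T : topologicalType) (K L : groupType)
    (h : (unit_interval R -> T) -> K) (rho : K -> L) :
  {morph rho : a b / (a * b)%g} -> transport h -> transport (rho \o h).
Proof.
move=> mr [hj hh]; split=> [p q cp cq pq|p q pq] /=; first by rewrite hj // mr.
by rewrite (hh _ _ pq).
Qed.

(** Change of trivialization of the fibres. *)
Lemma transport_gauge (R : realType) (T : topologicalType) (K : groupType)
    (h : (unit_interval R -> T) -> K) (d : T -> K) :
  transport h -> transport (fun p => d (p zero) * h p * (d (p one))^-1)%g.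
Proof.
move=> [hj hh]; split=> [p q cp cq pq|p q [H [cH H0 H1 Hs]]].
  by rewrite joinp0 joinp1 hj // pq !mulgA mulgVK.
rewrite (hh p q); last by exists H.
have [e0 e1] := Hs one; by rewrite -e0 -e1 !H1.
Qed.

Lemma morph_one (K L : groupType) (rho : K -> L) :
  {morph rho : a b / (a * b)%g} -> rho 1%g = 1%g.
Proof. by move=> mr; apply: (mulgI (rho 1%g)); rewrite -mr !mulg1. Qed.

Lemma morph_inv (K L : groupType) (rho : K -> L) a :
  {morph rho : a b / (a * b)%g} -> rho a^-1%g = (rho a)^-1%g.
Proof. by move=> mr; apply: (mulgI (rho a)); rewrite -mr !mulgV morph_one. Qed.

(** * The fundamental group of a glued space *)

Section GluedGroup.
Variables (R : realType) (Y Z : topologicalType) (f : Y -> Z) (y0 : Y) (x0 : Z).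
Local Notation I := (unit_interval R).
Variable sec : Z -> Y.
Hypotheses (gf : gluing f) (hY : hausdorff_space Y) (lY : locally_simple R Y)
  (lZ : locally_simple R Z) (pY : path_connected R Y)
  (fsec : forall z, f (sec z) = z) (sec0 : sec (f y0) = y0).

Lemma path_connected_glued : path_connected R Z.
Proof.
move=> u v; have [p [cp p0 p1]] := pY (sec u) (sec v); exists (f \o p); split.
- exact: continuous_post (gluing_continuous gf) cp.
- by rewrite /= p0 fsec.
- by rewrite /= p1 fsec.
Qed.

(** Here phi is induced by f, and beta sends a point y to the loop that runs to y upstairs
    and comes back from the chosen point over the same value. The extension and
    uniqueness fields say that the group of Z is the free product of the group of Y
    and the free group on the beta y for the points y that are not chosen. *)
Record glued_pi1 (phi : pi1 R y0 -> pi1 R x0) (beta : Y -> pi1 R x0) := GluedPi1 {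
  glued_morph : {morph phi : a b / (a * b)%g};
  glued_sec : forall z, beta (sec z) = 1%g;
  glued_conj : forall (u : Y) (z : Z) (a' : {path I from y0 to u in Y})
      (c' : {path I from u to u in Y}) (a : {path I from x0 to z in Z})
      (c : {path I from z to z in Z}), (forall t, c t = f (c' t)) ->
    exists d, loop_class (path_concat a (path_concat c (path_rev a))) =
      (phi (loop_class (path_concat a' (path_concat c' (path_rev a')))) ^ d)%g;
  glued_ext : forall (K : groupType) (rho' : pi1 R y0 -> K) (b : Y -> K),
    {morph rho' : a b / (a * b)%g} -> (forall z, b (sec z) = 1%g) ->
    exists rho : pi1 R x0 -> K, [/\ {morph rho : a b / (a * b)%g},
      forall c, rho (phi c) = rho' c & forall y, rho (beta y) = b y];
  glued_uniq : forall (K : groupType) (rho1 rho2 : pi1 R x0 -> K),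
    {morph rho1 : a b / (a * b)%g} -> {morph rho2 : a b / (a * b)%g} ->
    (forall c, rho1 (phi c) = rho2 (phi c)) ->
    (forall y, rho1 (beta y) = rho2 (beta y)) -> forall c, rho1 c = rho2 c }.

(** Over Y, the data rho' and b define a transport in which the values of b regauge the
    paths, so that points identified by f are trivialized compatibly. Its extension
    to Z is the transport of the required homomorphism, up to the change of base point. *)
Lemma pi1_glued : exists phi beta, glued_pi1 phi beta.
Proof.
have cf := gluing_continuous gf; have pZ := path_connected_glued.
have [gY [tY gYl]] := transport_base y0 pY.
have [gZ [tZ gZl]] := transport_base x0 pZ.
have [thY hthY] := trivial_paths pY tY gYl.
have [thZ hthZ] := trivial_paths pZ tZ gZl.
have cfq (q : I -> Y) : continuous q -> continuous (f \o q).
  by move=> cq; exact: (continuous_post cf cq).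
pose phi (c : pi1 R y0) := gZ (f \o repr c).
have tfZ : transport (fun q => gZ (f \o q)) by exact: transport_post.
pose beta y := (gZ (f \o thY y) * (gZ (f \o thY (sec (f y))))^-1)%g.
have mphi : {morph phi : a b / (a * b)%g}.
  elim/loop_class_ind=> p; elim/loop_class_ind=> q; rewrite loop_class_mul /phi.
  rewrite !(transport_repr _ tfZ) -(transport_join tfZ) //; try exact: path_cts.
  by rewrite path_one path_zero.
have phi_loop (c : {path I from y0 to y0 in Y}) : phi (loop_class c) = gZ (f \o c).
  exact: transport_repr tfZ.
exists phi, beta; split=> //.
- by move=> z; rewrite /beta fsec mulgV.
- move=> u z a' c' a c cE.
  rewrite -gZl transport_conjugate // phi_loop (transport_conjugate _ _ tfZ).
  have -> : gZ (f \o c') = gZ c by congr gZ; apply/funext => t; rewrite cE.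
  exists (gZ (f \o a') * (gZ a)^-1)%g.
  by rewrite conjgE invgM invgK !mulgA mulgVK mulgVK.
- move=> K rho' b mr bs.
  have b0 : b y0 = 1%g by rewrite -sec0.
  (* the gauge by b makes the paths to y and to the chosen point over f y differ by b y *)
  pose h (q : I -> Y) := ((b (q zero))^-1 * rho' (gY q) * b (q one))%g.
  have th : transport h.
    have := transport_gauge (fun y => (b y)^-1%g) (transport_morph mr tY).
    rewrite (_ : (fun _ => _) = h) //; apply/funext => q; by rewrite /h invgK.
  have thol := transport_hol R (flat_push_germs gf hY (flat_germs th lY)).
  set H := hol _ in thol.
  have HE q : continuous q -> H (f \o q) = h q by move=> cq; exact: (hol_push_germs gf hY th lY).
  pose A z := H (thZ z); pose d := A (f y0).
  have HZ (p : I -> Z) : continuous p ->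
      H (repr (gZ p)) = (A (p zero) * H p * (A (p one))^-1)%g.
    move=> cp; have [c -> Hc] := close_path tZ gZl hthZ thol cp.
    by rewrite transport_repr.
  have hloop (q : I -> Y) : continuous q -> gY q = 1%g -> h q = ((b (q zero))^-1 * b (q one))%g.
    by move=> cq gq; rewrite /h gq morph_one // mulg1.
  (* conjugation by d moves the base point from x0 to f y0, where phi is computed *)
  exists (fun c : pi1 R x0 => d^-1 * H (repr c) * d)%g; split.
  + elim/loop_class_ind=> p; elim/loop_class_ind=> q; rewrite loop_class_mul.
    rewrite !transport_repr // -[path_concat p q : I -> Z]/(joinp p q).
    rewrite (transport_join thol); [|exact: path_cts|exact: path_cts|by rewrite path_one path_zero].
    by rewrite !mulgA mulgK.
  + elim/loop_class_ind=> c; rewrite phi_loop HZ; last exact/cfq/path_cts.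
    rewrite /= path_zero path_one -/d HE; last exact: path_cts.
    rewrite /h path_zero path_one b0 invg1 mul1g mulg1 gYl.
    by rewrite !mulgA mulVg mul1g mulgVK.
  + have HZM (u v : pi1 R x0) : H (repr (u * v)%g) = (H (repr u) * H (repr v))%g.
      move: u v; elim/loop_class_ind=> p; elim/loop_class_ind=> q; rewrite loop_class_mul.
      rewrite !transport_repr // -[path_concat p q : I -> Z]/(joinp p q).
      rewrite (transport_join thol) //; try exact: path_cts.
      by rewrite path_one path_zero.
    move=> y; have [cy zy oy ty] := hthY y; have [cs zs os ts] := hthY (sec (f y)).
    rewrite /beta HZM (morph_inv _ HZM) !HZ; try exact: cfq.
    rewrite /= zy oy zs os fsec !HE // !hloop // zy zs oy os.
    rewrite b0 !bs ?(invg1, mul1g, mulg1) -/d.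
    rewrite !invgM !invgK -!mulgA !mulKg.
    by rewrite mulVg mulg1.
- move=> K rho1 rho2 m1 m2 e1 e2 c.
  pose h1 := rho1 \o gZ; pose h2 := rho2 \o gZ.
  have t1 : transport h1 := transport_morph m1 tZ.
  have t2 : transport h2 := transport_morph m2 tZ.
  (* gauging by D makes both transports agree on the paths that come from Y *)
  pose D (h : (I -> Z) -> K) z := h (f \o thY (sec z)).
  pose g (h : (I -> Z) -> K) p := (D h (p zero) * h p * (D h (p one))^-1)%g.
  have tg h : transport h -> transport (g h) by exact: transport_gauge.
  have A12 (rho : pi1 R x0 -> K) : {morph rho : a b / (a * b)%g} -> forall y,
      (rho \o gZ) (f \o thY y) = (rho (beta y) * D (rho \o gZ) (f y))%g.
    by move=> mr y; rewrite /beta mr (morph_inv _ mr) mulgVK.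
  have gE (rho : pi1 R x0 -> K) : {morph rho : a b / (a * b)%g} -> forall q, continuous q ->
      g (rho \o gZ) (f \o q) = ((rho (beta (q zero)))^-1 * rho (phi (gY q)) *
        rho (beta (q one)))%g.
    move=> mr q cq.
    have th := transport_post cf (transport_morph mr tZ).
    have [c' gq hc] := close_path tY gYl hthY th cq.
    rewrite gq phi_loop; move: hc; rewrite !(A12 _ mr) /= => ->.
    by rewrite /g /= !invgM -!mulgA !mulKg mulVg mulg1.
  have eq12 p : continuous p -> g h1 p = g h2 p.
    apply: (transport_ext gf hY (tg _ t1) (tg _ t2) lY lZ) => q cq.
    by rewrite !gE // e1 !e2.
  have [cz zz oz tz] := hthZ (f y0).
  have D0 (rho : pi1 R x0 -> K) : {morph rho : a b / (a * b)%g} -> D (rho \o gZ) (f y0) = 1%g.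
    move=> mr; rewrite /D sec0 /=; have [c0 z0 o0 gy0] := hthY y0.
    rewrite -(morph_one mr) -(morph_one mphi) -gy0; congr rho.
    rewrite -[thY y0 : I -> Y]/(path_of c0 z0 o0 : I -> Y) gYl phi_loop.
    by [].
  have Dx : D h1 x0 = D h2 x0.
    have := eq12 _ cz; rewrite /g zz oz !D0 // invg1 !mulg1 /h1 /h2 /= tz.
    by rewrite (morph_one m1) (morph_one m2) !mulg1.
  move: c; elim/loop_class_ind => c; have := eq12 _ (path_cts (p := c)).
  rewrite /g path_zero path_one Dx => /mulIg/mulgI.
  by rewrite /h1 /h2 /= gZl.
Qed.

End GluedGroup.

(** * Meridians and representation sets *)

Section Meridians.
Local Open Scope ring_scope.
Variables (R : realType) (k : closedFieldType) (G : algGroupType k).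
Local Notation I := (unit_interval R).

Lemma circle_point_norm (rho t : R) : \sum_m (circle_point rho t) ord0 m ^+ 2 = rho ^+ 2.
Proof.
by rewrite big_ord_recl big_ord1 !mxE /= !exprMn -mulrDr cos2Dsin2 mulr1.
Qed.

Lemma circle_point_closed (rho : R) : circle_point rho 0 = circle_point rho 1.
Proof.
apply/rowP => j; rewrite !mxE !mulr0 !mulr1 cos0 sin0.
by rewrite mulr_natl cos2pi sin2pi.
Qed.

Lemma continuous_circle_point (T : topologicalType) (a b : T -> R) :
  continuous a -> continuous b -> continuous (fun t => circle_point (a t) (b t)).
Proof.
move=> ca cb.
have cb' : continuous (fun t => 2 * pi * b t).
  by apply: continuous_mulf => //; exact: continuous_cstf.
apply: continuous_row2; apply: continuous_mulf => //.
  exact: (continuous_post (@continuous_cos R) cb').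
exact: (continuous_post (@continuous_sin R) cb').
Qed.

Section Surface.
Variables (X : topologicalType) (s : nat) (Q : parabolic R G X s).

(** The circle stays in the disc, which contains the puncture i only, at its centre. *)
Lemma disc_avoid (i : 'I_s) (rho : R) (v : 'rV[R]_2) : 
  (forall (v : 'rV[R]_2) j, \sum_m v ord0 m ^+ 2 <= rho ^+ 2 ->
     disc Q i v = puncture Q j -> j = i) ->
  0 < \sum_m v ord0 m ^+ 2 -> \sum_m v ord0 m ^+ 2 <= rho ^+ 2 ->
  disc Q i v \in ~` range (puncture Q).
Proof.
move=> h v0 vr; apply/mem_set => -[j _ jE].
have ji := h v j vr (esym jE); move: jE; rewrite ji -disc_center.
have [_ inj _] := disc_embedding Q i => /inj v00; move: v0; rewrite -v00.
by rewrite big1 ?ltxx // => m _; rewrite mxE expr0n.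
Qed.

(** The annulus between the two circles is a square whose two sides coincide. *)
Lemma meridian_conj (x0 : punctured Q) (i : 'I_s) (g1 g2 : pi1 R x0) :
  path_connected R (punctured Q) -> meridian i g1 -> meridian i g2 ->
  exists d, g2 = (g1 ^ d)%g.
Proof.
move=> pQ [r1 [x1 [a1 [c1 [r10 h1 c1E ->]]]]] [r2 [x2 [a2 [c2 [r20 h2 c2E ->]]]]].
have [gm [tg gl]] := transport_base x0 pQ.
pose r t := (r2 - r1) * unit_clamp t + r1.
have r0 t : 0 < r t by have := unit_clamp_bounds t; rewrite /r; nra.
have rle t : r t <= r1 \/ r t <= r2.
  by have := unit_clamp_bounds t; rewrite /r; case: (leP r1 r2) => h; [right|left]; nra.
have gP (u : R * R) : disc Q i (circle_point (r u.1) u.2) \in ~` range (puncture Q).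
  have sq (a : R) : r u.1 <= a -> r u.1 ^+ 2 <= a ^+ 2.
    by move=> ra; have := r0 u.1; nra.
  have p0 : 0 < r u.1 ^+ 2 by rewrite exprn_gt0.
  by have [/sq ra|/sq ra] := rle u.1; [apply: (disc_avoid h1)|apply: (disc_avoid h2)];
    rewrite circle_point_norm.
pose g (u : R * R) : punctured Q := SigSub (gP u).
have gE u : set_val (g u) = disc Q i (circle_point (r u.1) u.2) by exact: set_val_mk.
have cg : continuous g.
  apply: continuous_comp_initial.
  rewrite (_ : _ \o _ = fun u : R * R => disc Q i (circle_point (r u.1) u.2)); last first.
    by apply/funext => u; rewrite /= gE.
  have [cd _ _] := disc_embedding Q i; apply: (continuous_post cd).
  apply: continuous_circle_point; last by move=> u; exact: cvg_snd.
  apply: (continuous_fstf (f := r)); apply: continuous_aff; exact: continuous_unit_clamp.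
have u0 : unit_clamp (0 : R) = 0 by rewrite unit_clamp_id // lexx ler01.
have u1 : unit_clamp (1 : R) = 1 by rewrite unit_clamp_id // lexx ler01.
have := transport_square tg (0, 0) (0, 1) (1, 0) (1, 1) cg.
have -> : g \o plane_seg (0, 0) (0, 1) = c1.
  apply/funext => t; apply: set_val_inj; rewrite c1E /= gE /= /r.
  by rewrite subrr mul0r !addr0 u0 mulr0 add0r subr0 mul1r.
have -> : g \o plane_seg (1, 0) (1, 1) = c2.
  apply/funext => t; apply: set_val_inj; rewrite c2E /= gE /= /r.
  by rewrite subrr mul0r add0r addr0 u1 mulr1 subrK subr0 mul1r.
have -> : g \o plane_seg (0, 1) (1, 1) = g \o plane_seg (0, 0) (1, 0).
  apply/funext => t; apply: set_val_inj; rewrite /= !gE /= !subrr !mul0r !add0r.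
  by rewrite circle_point_closed.
set sg := gm (g \o _) => e.
exists (gm a1 * sg * (gm a2)^-1)%g.
have -> : loop_class (path_concat a2 (path_concat c2 (path_rev a2))) =
    (gm a2 * (sg^-1 * gm c1 * sg) * (gm a2)^-1)%g.
  by rewrite -gl (transport_conjugate _ _ tg) -[(sg^-1 * _ * _)%g]mulgA e mulKg.
by rewrite -gl (transport_conjugate _ _ tg) conjgE !invgM invgK !mulgA !mulgVK.
Qed.

Lemma representation_conj (x0 : punctured Q) (rho : pi1 R x0 -> G) (i : 'I_s) a d :
  {morph rho : a b / (a * b)%g} -> holonomy Q i (rho a) -> holonomy Q i (rho (a ^ d)%g).
Proof.
move=> mr h; rewrite conjgE !mr (morph_inv _ mr) -conjgE; exact: holonomy_conj.
Qed.

Lemma subvariety_bigI (k' : closedFieldType) (P : funSpaceType k') (n : nat) (A : 'I_n -> set P) :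
  (forall i, subvariety (A i)) -> subvariety [set v | forall i, A i v].
Proof.
elim: n A => [|n IH] A hA.
  rewrite (_ : mkset _ = setT); first by apply: subvariety_closed; exact: closedT.
  by apply/seteqP; split=> // v _ [].
rewrite (_ : mkset _ = A ord_max `&` [set v | forall i, A (lift ord_max i) v]).
  by apply: subvariety_setI => //; exact: (IH (fun i => A (lift ord_max i))).
apply/seteqP; split=> v /=; first by move=> h; split=> // i; exact: h.
by move=> [h h'] i; case: (unliftP ord_max i) => [j ->|->].
Qed.

Lemma representation_determined (x0 : punctured Q) n (g : 'I_n -> pi1 R x0)
    (K : groupType) (rho1 rho2 : pi1 R x0 -> K) :
  generates g -> {morph rho1 : a b / (a * b)%g} -> {morph rho2 : a b / (a * b)%g} ->
  (forall i, rho1 (g i) = rho2 (g i)) -> forall c, rho1 c = rho2 c.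
Proof.
move=> gg m1 m2 e c; have : [set c | rho1 c = rho2 c] = setT.
  apply: gg => //= [|a b ea eb|a ea]; first by rewrite !morph_one.
    by rewrite m1 m2 ea eb.
  by rewrite (morph_inv _ m1) (morph_inv _ m2) ea.
by move=> h; have : [set c | rho1 c = rho2 c] c by rewrite h.
Qed.

(** The pairs of an element c of the group and a morphism that computes rho c from the
    coordinates are generated by the pairs of g i and pr i. A point comes from a
    homomorphism when all the morphisms attached to 1 take the value 1 there; this is a
    closed condition. One meridian for each puncture then suffices. *)
Lemma subvariety_representation_set (x0 : punctured Q) n (g : 'I_n -> pi1 R x0)
    (P : funSpaceType k) (pr : 'I_n -> P -> G) :
  path_connected R (punctured Q) -> generates g -> alg_product pr ->
  subvariety (representation_set g pr).
Proof.
move=> pQ gg [vP mpr _].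
pose V := Variety vP; pose M := morphisms G V.
pose prM i : M := exist _ (pr i) (mpr i).
pose W (c : pi1 R x0) (m : M) := forall rel : pi1 R x0 -> M -> Prop,
  rel 1%g 1%g -> (forall i, rel (g i) (prM i)) ->
  (forall a b m m', rel a m -> rel b m' -> rel (a * b)%g (m * m')%g) ->
  (forall a m, rel a m -> rel a^-1%g m^-1%g) -> rel c m.
have W1 : W 1%g 1%g by move=> rel.
have Wg i : W (g i) (prM i) by move=> rel _ h _ _; exact: h.
have WM a b m m' : W a m -> W b m' -> W (a * b)%g (m * m')%g.
  by move=> ha hb rel h1 hg hm hi; apply: (hm); [exact: ha|exact: hb].
have WV a m : W a m -> W a^-1%g m^-1%g.
  by move=> ha rel h1 hg hm hi; apply: (hi); exact: ha.
have Wex c : exists m, W c m.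
  suff h : [set c | exists m, W c m] = setT by have : [set c | exists m, W c m] c by rewrite h.
  apply: gg => [|a b [m hm] [m' hm']|a [m hm]|i].
  - by exists 1%g.
  - by exists (m * m')%g; exact: WM.
  - by exists m^-1%g; exact: WV.
  - by exists (prM i).
have Wrho (rho : pi1 R x0 -> G) v : {morph rho : a b / (a * b)%g} ->
    (forall i, pr i v = rho (g i)) -> forall c m, W c m -> sval m v = rho c.
  move=> mr prE c m Wcm; apply: (Wcm (fun a m => sval m v = rho a)) => [|i|a b m1 m2 e1 e2|a m1 e1] /=.
  - by rewrite morph_one.
  - exact: prE.
  - by rewrite mr -e1 -e2.
  - by rewrite (morph_inv _ mr) -e1.
have [ev hev] := choice Wex.
have [vG sG] := varietyP (alg_group_variety G).
pose A : set P := [set v | forall m, W 1%g m -> sval m v = 1%g].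
have cA : closed A.
  rewrite (_ : A = \bigcap_(m in W 1%g) [set v | sval m v = 1%g]) //.
  by apply: closed_bigI => m _; exact: (closed_fibre (y := 1%g : G) vP.1 sG (svalP m)).
have Wuniq v c m m' : A v -> W c m -> W c m' -> sval m v = sval m' v.
  move=> Av hm hm'; have w : W 1%g (m^-1 * m')%g.
    by rewrite -(mulVg c); apply: WM => //; exact: WV.
  by have /= e := Av _ w; apply/esym/(mulgI (sval m v)^-1%g); rewrite e mulVg.
have evM v : A v -> {morph (fun c => sval (ev c) v) : a b / (a * b)%g}.
  by move=> Av a b; apply: (Wuniq v (a * b)%g _ (ev a * ev b)%g) => //; exact: WM.
have evG v : A v -> forall i, pr i v = sval (ev (g i)) v.
  by move=> Av i; apply: (Wuniq v (g i) (prM i)).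
pose B (i : 'I_s) : set P := [set v | forall c, meridian i c -> A v ->
  holonomy Q i (sval (ev c) v)].
have sB i : subvariety (A `&` B i).
  have [[c hc]|nm] := pselect (exists c, @meridian R k G X s Q x0 i c); last first.
    rewrite (_ : A `&` B i = A); first exact: subvariety_closed.
    by apply/seteqP; split=> [v []//|v Av]; split=> // c hc; case: nm; exists c.
  rewrite (_ : A `&` B i = A `&` (sval (ev c) @^-1` holonomy Q i)).
    apply: subvariety_setI; first exact: subvariety_closed.
    by apply: subvariety_preimage (holonomy_subvariety Q i); have [] := svalP (ev c).
  apply/seteqP; split=> v [Av h]; split=> //=; first exact: h.
  move=> c' hc' _; have [d ->] := meridian_conj pQ hc hc'.
  exact: (representation_conj d (evM v Av) h).
rewrite (_ : representation_set g pr = A `&` [set v | forall i, (A `&` B i) v]).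
  by apply: subvariety_setI; [exact: subvariety_closed|exact: subvariety_bigI].
apply/seteqP; split=> v.
  move=> [rho [mr hr] prE]; have Av : A v.
    by move=> m /(Wrho rho v mr prE) ->; exact: morph_one.
  split=> // i; split=> // c hc _; rewrite (Wrho rho v mr prE c _ (hev c)).
  exact: hr.
move=> [Av hB]; exists (fun c => sval (ev c) v); last exact: evG.
by split=> [|i c hc]; [exact: evM|have [_ h] := hB i; exact: h].
Qed.

End Surface.
End Meridians.

(** * The representation variety of the glued space as a product *)

Section Algebraic.
Variables (R : realType) (k : closedFieldType) (G : algGroupType k).
Variables (X Sigma : topologicalType) (s : nat).
Variables (Q : parabolic R G X s) (Q' : parabolic R G Sigma s).
Variables (x0 : punctured Q) (y0 : punctured Q').
Variables (f : punctured Q' -> punctured Q) (sec : punctured Q -> punctured Q').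
Variables (phi : pi1 R y0 -> pi1 R x0) (beta : punctured Q' -> pi1 R x0).
Hypothesis gl : glued_pi1 f sec phi beta.
Hypothesis hol_eq : forall i, holonomy Q' i = holonomy Q i.
Hypothesis meridian_lift : forall i c, meridian i c ->
  exists c' d, meridian i c' /\ c = (phi c' ^ d)%g.
Hypothesis meridian_image : forall i c', meridian i c' ->
  exists c d, meridian i c /\ c = (phi c' ^ d)%g.

(** The elements at which evaluation is a morphism form a subgroup containing the
    generators. *)
Lemma alg_morphism_evaluation (V : funSpaceType k) (Gam : groupType) n (g : 'I_n -> Gam)
    (rho : V -> Gam -> G) :
  is_variety V -> generates g -> (forall v, {morph rho v : a b / (a * b)%g}) ->
  (forall i, alg_morphism (fun v => rho v (g i))) ->
  forall c, alg_morphism (fun v => rho v c).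
Proof.
move=> vV gg mrho mg c; suff h : [set c | alg_morphism (fun v => rho v c)] = setT.
  by have : [set c | alg_morphism (fun v => rho v c)] c by rewrite h.
apply: gg => //= [|a b ma mb|a ma].
- rewrite (_ : (fun _ => _) = fun=> 1%g); first exact: alg_morphism_cst vV.1.
  by apply/funext => v; rewrite morph_one.
- rewrite (_ : (fun _ => _) = fun v => (rho v a * rho v b)%g); first exact: alg_morphism_mul.
  by apply/funext => v; rewrite mrho.
- rewrite (_ : (fun _ => _) = fun v => (rho v a)^-1%g); first exact: alg_morphism_inv.
  by apply/funext => v; rewrite (morph_inv _ (mrho v)).
Qed.

Lemma representation_glued (rho : pi1 R x0 -> G) : {morph rho : a b / (a * b)%g} ->
  representation rho <-> representation (rho \o phi).
Proof.
move=> mr; have [mphi _ _ _ _] := gl; split=> -[_ h]; split=> //=.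
- by move=> a b /=; rewrite mphi mr.
- move=> i c' /meridian_image[c [d [hc cE]]]; rewrite hol_eq.
  have /(representation_conj d^-1%g mr) := h i c hc.
  by rewrite cE conjgK.
- move=> i c /meridian_lift[c' [d [hc' ->]]].
  by apply: representation_conj => //; rewrite -hol_eq; exact: h.
Qed.

(** The projections restrict a representation along phi and evaluate it at the loops of
    the extra points. To construct the map from T with given projections, the
    universal property of the group is applied to the group of morphisms from T to G. *)
Lemma representations_power_product (n : nat) (g : 'I_n -> pi1 R x0)
    (n' : nat) (g' : 'I_n' -> pi1 R y0) (P : funSpaceType k) (pr : 'I_n -> P -> G)
    (P' : funSpaceType k) (pr' : 'I_n' -> P' -> G) (N : nat) (e : 'I_N -> punctured Q') :
  generates g -> generates g' -> alg_product pr -> alg_product pr' ->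
  is_variety (set_type (representation_set g pr) : funSpaceType k) ->
  is_variety (set_type (representation_set g' pr') : funSpaceType k) ->
  injective e -> range e = [set y | y <> sec (f y)] -> (forall z, f (sec z) = z) ->
  exists a b, @power_product k G (set_type (representation_set g pr))
    (set_type (representation_set g' pr')) N a b.
Proof.
move=> gg gg' ap ap' vV vV' eI eE fsec; have [mphi bsec _ ext uniq] := gl.
set V := set_type (representation_set g pr) in vV *.
set V' := set_type (representation_set g' pr') in vV' *.
have [vP mpr uP] := ap; have [vP' mpr' uP'] := ap'.
have repV (v : V) : exists rho, representation rho /\ forall i, pr i (set_val v) = rho (g i).
  by have [rho h1 h2] := set_valP v; exists rho.
have repV' (v : V') : exists rho, representation rho /\ forall i, pr' i (set_val v) = rho (g' i).
  by have [rho h1 h2] := set_valP v; exists rho.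
have [rho hrho] := choice repV; have [rho' hrho'] := choice repV'.
have mrho v : {morph rho v : a b / (a * b)%g} by have [[]] := hrho v.
have mrho' v : {morph rho' v : a b / (a * b)%g} by have [[]] := hrho' v.
have evV c : alg_morphism (fun v : V => rho v c : G).
  apply: (alg_morphism_evaluation vV gg mrho) => i.
  rewrite (_ : (fun _ => _) = pr i \o set_val).
    exact: (alg_morphism_comp (alg_morphism_val _) (mpr i)).
  by apply/funext => v /=; have [_ ->] := hrho v.
have evV' c : alg_morphism (fun v : V' => rho' v c : G).
  apply: (alg_morphism_evaluation vV' gg' mrho') => i.
  rewrite (_ : (fun _ => _) = pr' i \o set_val).
    exact: (alg_morphism_comp (alg_morphism_val _) (mpr' i)).
  by apply/funext => v /=; have [_ ->] := hrho' v.
have [h [[mh hE] _]] := uP' V (fun i v => rho v (phi (g' i))) vV (fun i => evV _).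
have hE' i v : pr' i (h v) = rho v (phi (g' i)).
  exact: (congr1 (fun u => u v) (hE i)).
have hV v : h v \in representation_set g' pr'.
  apply/mem_set; exists (rho v \o phi); last by move=> i; rewrite hE'.
  by apply/representation_glued => //; have [] := hrho v.
pose a (v : V) : V' := SigSub (hV v).
have aE v : set_val (a v) = h v by exact: set_val_mk.
have ma : alg_morphism a.
  by apply: alg_morphism_sub; rewrite (_ : _ \o _ = h)//; apply/funext => v; rewrite /= aE.
have rho_a v c : rho' (a v) c = rho v (phi c).
  apply: (representation_determined gg' (mrho' _) (rho2 := rho v \o phi)).
    by move=> c1 c2 /=; rewrite mphi mrho.
  by move=> i /=; rewrite -hE' -aE; have [_ ->] := hrho' (a v).
exists a, (fun j v => rho v (beta (e j))); split=> // T ft gt vT mf mg.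
(* the universal representation, with values in the group of morphisms T -> G *)
pose M := morphisms G (Variety vT).
pose rhoT' (c : pi1 R y0) : M := exist _ (fun t => rho' (ft t) c) (alg_morphism_comp mf (evV' c)).
pose B (y : punctured Q') : M :=
  if [pick j | e j == y] is Some j then exist _ (gt j) (mg j) else 1%g.
have Be j : B (e j) = exist _ (gt j) (mg j).
  rewrite /B; case: pickP => [i /eqP/eI ->//|/(_ j)]; by rewrite eqxx.
have Bsec z : B (sec z) = 1%g.
  rewrite /B; case: pickP => // j /eqP ej.
  have : [set y | y <> sec (f y)] (sec z) by rewrite -eE; exists j.
  by rewrite /= fsec.
have mrT' : {morph rhoT' : c d / (c * d)%g}.
  by move=> c d; apply: morphismsP => t /=; rewrite mrho'.
have [rhoT [mrT rT1 rT2]] := ext M rhoT' B mrT' Bsec.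
pose rT t c := sval (rhoT c) t.
have mT t : {morph rT t : c d / (c * d)%g} by move=> c d; rewrite /rT mrT.
have rTphi t c : rT t (phi c) = rho' (ft t) c by rewrite /rT rT1.
have repT t : representation (rT t).
  apply/representation_glued => //.
  rewrite (_ : _ \o _ = rho' (ft t)); first by have [] := hrho' (ft t).
  by apply/funext => c; rewrite /= rTphi.
have [H [[mH HE] _]] := uP T (fun i t => rT t (g i)) vT (fun i => svalP (rhoT (g i))).
have HE' i t : pr i (H t) = rT t (g i).
  exact: (congr1 (fun u => u t) (HE i)).
have HV t : H t \in representation_set g pr by apply/mem_set; exists (rT t).
pose hT t : V := SigSub (HV t).
have hTE t : set_val (hT t) = H t by exact: set_val_mk.
have rho_hT t c : rho (hT t) c = rT t c.
  apply: (representation_determined gg) => // i.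
  by have [_ <-] := hrho (hT t); rewrite hTE HE'.
have V'ext (v w : V') : (forall c, rho' v c = rho' w c) -> v = w.
  move=> vw; apply: set_val_inj; apply: (alg_product_ext ap') => i.
  by have [_ ->] := hrho' v; have [_ ->] := hrho' w.
exists hT; split.
  split; first by apply: alg_morphism_sub; rewrite (_ : _ \o _ = H)//; apply/funext => t; rewrite /= hTE.
  split=> [t|j t]; last by rewrite rho_hT /rT rT2 Be.
  by apply: V'ext => c; rewrite rho_a rho_hT rTphi.
move=> h' [mh' [h'a h'b]]; apply/funext => t; apply: set_val_inj.
apply: (alg_product_ext ap) => i; rewrite hTE HE'; have [_ ->] := hrho (h' t).
apply: (uniq G) => // [c|y]; first by rewrite rTphi -rho_a h'a.
have [[j _ <-]|ny] := pselect (range e y); first by rewrite h'b /rT rT2 Be.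
have -> : y = sec (f y) by apply: contrapT => yn; apply: ny; rewrite eE.
by rewrite bsec !morph_one.
Qed.

End Algebraic.

(** * The normalization of a punctured node-surface *)

Section PuncturedNormalization.
Local Open Scope ring_scope.
Variables (R : realType) (k : closedFieldType) (G : algGroupType k).
Local Notation I := (unit_interval R).

Lemma hausdorff_set_type (T : topologicalType) (A : set T) :
  hausdorff_space T -> hausdorff_space (set_type A).
Proof.
rewrite !open_hausdorff => hT u v uv.
have [|[B C] /= [uB vC] [oB oC BC]] := hT (set_val u) (set_val v).
  by apply: contra uv => /eqP/set_val_inj ->.
exists (set_val @^-1` B, set_val @^-1` C) => /=.
  by rewrite !inE in uB vC *.
split; [by exists B|by exists C|apply/eqP; rewrite -subset0 => w [Bw Cw]].
by have : (set0 : set T) (set_val w) by rewrite -(eqP BC).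
Qed.

Lemma cone_link_inhabited (X : topologicalType) (p : X) (B : topologicalType) :
  cone_neighbourhood R B p -> inhabited B.
Proof.
move=> [U [h [_ Up [hi _] _]]].
by have c := hi (SigSub (mem_set Up)); exact: (inhabits (repr c).1).
Qed.

Section Setup.
Variables (X Sigma : topologicalType) (f : Sigma -> X).
Variables (s : nat) (Q : parabolic R G X s) (Q' : parabolic R G Sigma s).
Hypotheses (nX : closed_node_surface R X) (nf : normalization R f).
Hypotheses (cS : connected [set: Sigma]) (pb : is_pullback f Q Q').

Lemma smooth_value_inj y y' : f y = f y' -> smooth_point R 1 (f y) -> y = y'.
Proof.
have [_ [S Sc Sinj]] := normalization_gluing nX nf.
by move=> e sm; apply: Sinj => // /Sc; apply.
Qed.

(** Punctures are smooth, so f is injective over them. *)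
Lemma pullback_puncture y i : f y = puncture Q i -> y = puncture Q' i.
Proof.
have [fp _ _] := pb; move=> e; apply: smooth_value_inj; rewrite ?fp// e.
exact: puncture_smooth.
Qed.

Lemma pullback_complement y :
  (~` range (puncture Q')) y <-> (~` range (puncture Q)) (f y).
Proof.
have [fp _ _] := pb; split=> h [i _ e]; apply: h; exists i => //.
  by apply/esym/pullback_puncture.
by rewrite -e fp.
Qed.

Lemma open_complement (T : topologicalType) (P : parabolic R G T s) :
  hausdorff_space T -> open (~` range (puncture P)).
Proof.
move=> /hausdorff_accessible/accessible_finite_set_closed hT.
apply: closed_openC; apply: hT. apply: finite_image; exact: finite_finset.
Qed.

Lemma punctured_gluing : exists2 fY : punctured Q' -> punctured Q,
  gluing fY & forall y, set_val (fY y) = f (set_val y).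
Proof.
have [gf _] := normalization_gluing nX nf; have [[hX _ _ _] _] := nX.
exact: (gluing_restrict gf (open_complement Q hX) pullback_complement).
Qed.

Lemma punctured_path_connected : path_connected R (punctured Q').
Proof.
have [[[hS _ _ _] sm] _ _] := nf; apply: path_connected_minus => //.
  by apply: finite_image; exact: finite_finset.
move=> z; have [c cc] := smooth_chart (sm z).
by exists (sphere R 1), c; split=> //; exact: sphere1_path_connected.
Qed.

Lemma punctured_locally_simple :
  locally_simple R (punctured Q') /\ locally_simple R (punctured Q).
Proof.
have [[nS _] _ _] := nf; have [hS _ _ _] := nS; have [nX' _] := nX; have [hX _ _ _] := nX'.
by split; apply: locally_simple_open; try exact: open_complement; [exact: nS|exact: nX'].
Qed.

(** Circles around the punctures of X lift to Sigma, because the discs do; the paths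
    leading to them need not lift, but only affect the meridian by conjugation. *)
Lemma meridian_pullback (x0 : punctured Q) (y0 : punctured Q')
    (fY : punctured Q' -> punctured Q) (sec : punctured Q -> punctured Q')
    (phi : pi1 R y0 -> pi1 R x0) (beta : punctured Q' -> pi1 R x0) (i : 'I_s) :
  gluing fY -> (forall z, fY (sec z) = z) ->
  (forall y, set_val (fY y) = f (set_val y)) -> glued_pi1 fY sec phi beta ->
  (forall c, meridian i c -> exists c' d, meridian i c' /\ c = (phi c' ^ d)%g) /\
  (forall c', meridian i c' -> exists c d, meridian i c /\ c = (phi c' ^ d)%g).
Proof.
move=> gf fsec fYE gl; have [fp fd _] := pb; have [_ _ gconj _ _] := gl.
have pY := punctured_path_connected.
have pZ : path_connected R (punctured Q) := path_connected_glued gf pY fsec.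
have [hcts _ _] := disc_embedding Q' i.
have condE (rho : R) :
    (forall (v : 'rV[R]_2) j, \sum_m v ord0 m ^+ 2 <= rho ^+ 2 ->
      disc Q i v = puncture Q j -> j = i) <->
    (forall (v : 'rV[R]_2) j, \sum_m v ord0 m ^+ 2 <= rho ^+ 2 ->
      disc Q' i v = puncture Q' j -> j = i).
  split=> h v j vr e; apply: (h v j vr); first by rewrite -fd e fp.
  by apply: pullback_puncture; rewrite fd.
split.
- move=> c0 [rho [z [a [c [rho0 cond cE ->]]]]].
  have cond' := (condE rho).1 cond.
  have mem t : disc Q' i (circle_point rho t) \in ~` range (puncture Q').
    by apply: (disc_avoid cond'); rewrite circle_point_norm ?exprn_gt0.
  pose c'f (t : I) : punctured Q' := SigSub (mem (ival t)).
  have c'E t : set_val (c'f t) = disc Q' i (circle_point rho (ival t)) by exact: set_val_mk.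
  have cc' : continuous c'f.
    apply: continuous_comp_initial.
    rewrite (_ : _ \o _ = fun t => disc Q' i (circle_point rho (ival t))); last first.
      by apply/funext => t; rewrite /= c'E.
    apply: (continuous_post hcts); apply: continuous_circle_point.
      exact: continuous_cstf.
    exact: ival_continuous.
  have c'1 : c'f one = c'f zero.
    by apply: set_val_inj; rewrite !c'E ival0 ival1 circle_point_closed.
  pose c' := path_of cc' erefl c'1.
  have [af [ca a0 a1]] := pY y0 (c'f zero); pose a' := path_of ca a0 a1.
  have cf t : c t = fY (c' t).
    by apply: set_val_inj; rewrite cE fYE -[c' t]/(c'f t) c'E fd.
  have [d dE] := gconj _ _ a' c' a c cf.
  exists (loop_class (path_concat a' (path_concat c' (path_rev a')))), d; split=> //.
  by exists rho, (c'f zero), a', c'.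
- move=> c0 [rho [z [a' [c' [rho0 cond' cE ->]]]]].
  have cf : continuous (fY \o c') by exact: (continuous_post (gluing_continuous gf) (path_cts (p := c'))).
  have c0E : (fY \o c') zero = fY z by rewrite /= path_zero.
  have c1E : (fY \o c') one = fY z by rewrite /= path_one.
  pose c := path_of cf c0E c1E.
  have [af [ca a0 a1]] := pZ x0 (fY z); pose a := path_of ca a0 a1.
  have [d dE] := gconj _ _ a' c' a c (fun t => erefl).
  exists (loop_class (path_concat a (path_concat c (path_rev a)))), d; split=> //.
  exists rho, (fY z), a, c; split=> //; first exact/condE.
  by move=> t; rewrite -[c t]/(fY (c' t)) fYE cE fd.
Qed.

(** Values with several preimages are conic, and the fibre of a conic point is counted by
    its sheets. *)
Lemma extra_preimages (l : nat) (x : 'I_l -> X) (r : 'I_l -> nat)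
    (fY : punctured Q' -> punctured Q) (sec : punctured Q -> punctured Q') :
  injective x -> range x = [set p | conic_point R 1 p] ->
  (forall i, cone_neighbourhood R (circles R (r i)) (x i)) ->
  (forall y, set_val (fY y) = f (set_val y)) -> (forall z, fY (sec z) = z) ->
  exists e : 'I_(\sum_(i < l) r i - l)%N -> punctured Q',
    injective e /\ range e = [set y | y <> sec (fY y)].
Proof.
move=> xI rx xc fYE fsec; have [gf _] := normalization_gluing nX nf.
have [[[hS _ _ _] sm] _ _] := nf.
have conic i : conic_point R 1 (x i).
  by have : range x (x i) by [exists i]; rewrite rx.
have xP i : x i \in ~` range (puncture Q).
  apply/mem_set => -[j _ e]; apply: (conic i); rewrite -e; exact: puncture_smooth.
pose x' i : punctured Q := SigSub (xP i).
have x'E i : set_val (x' i) = x i by exact: set_val_mk.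
have fib i : exists y : 'I_(r i) -> Sigma, injective y /\ range y = f @^-1` [set x i].
  have [c cc] := chart_of_cone (cone_link_inhabited (xc i)) (@circles_compact R _) (xc i).
  apply: fibre_sheets gf hS cc _ => y _.
  have [c' cc'] := smooth_chart (sm y).
  by exists (sphere R 1), c'; split=> //; exact: sphere1_path_connected.
pose y i := sval (cid (fib i)).
have yI i : injective (y i) by rewrite /y; case: cid => ? [].
have yR i : range (y i) = f @^-1` [set x i] by rewrite /y; case: cid => ? [].
have fy i j : f (y i j) = x i.
  have : range (y i) (y i j) by exists j.
  by rewrite yR.
have yP i j : y i j \in ~` range (puncture Q').
  by apply/mem_set/pullback_complement; rewrite fy; exact: set_mem.
pose y' i j : punctured Q' := SigSub (yP i j).
have y'E i j : set_val (y' i j) = y i j by exact: set_val_mk.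
apply: (extra_points (x := x') (y := y')) => //.
- by move=> i j /(congr1 set_val); rewrite !x'E => /xI.
- move=> i; split=> [j j' /(congr1 set_val)|]; first by rewrite !y'E => /yI.
  apply/seteqP; split=> [_ [j _ <-]|u fu] /=.
    by apply: set_val_inj; rewrite fYE y'E fy x'E.
  have : range (y i) (set_val u) by rewrite yR /= -fYE fu x'E.
  by move=> [j _ yj]; exists j => //; apply: set_val_inj; rewrite y'E.
- move=> u v uv nr; apply: set_val_inj; apply: smooth_value_inj; first by rewrite -!fYE uv.
  apply: contrapT => nsm; apply: nr; rewrite -fYE in nsm.
  have : range x (set_val (fY u)) by rewrite rx.
  by move=> [i _ xi]; exists i => //; apply: set_val_inj; rewrite x'E.
Qed.

End Setup.
End PuncturedNormalization.

Theorem mainTheorem3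
  (R : realType) (k : closedFieldType) (G : algGroupType k)
  (X : topologicalType) (l : nat) (x : 'I_l -> X) (r : 'I_l -> nat)
  (s : nat) (Q : parabolic R G X s)
  (Sigma : topologicalType) (f : Sigma -> X) (Q' : parabolic R G Sigma s)
  (x0 : punctured Q) (y0 : punctured Q')
  (n : nat) (g : 'I_n -> pi1 R x0)
  (n' : nat) (g' : 'I_n' -> pi1 R y0)
  (P : funSpaceType k) (pr : 'I_n -> P -> G)
  (P' : funSpaceType k) (pr' : 'I_n' -> P' -> G) :
  closed_node_surface R X ->
  injective x -> range x = [set p | conic_point R 1 p] ->
  (forall i, cone_neighbourhood R (circles R (r i)) (x i)) ->
  normalization R f -> connected [set: Sigma] ->
  is_pullback f Q Q' ->
  generates g -> generates g' ->
  alg_product pr -> alg_product pr' ->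
  exists (hV : is_variety (set_type (representation_set g pr) : funSpaceType k))
         (hV' : is_variety (set_type (representation_set g' pr') : funSpaceType k)),
    motive_eq G [class (Variety hV)]
      ([class (Variety hV')] *
       [class (alg_group_variety G)] ^+ (\sum_(i < l) r i - l)%N).
Proof.
move=> nX xI rx xc nf cS pb gg gg' ap ap'.
have [fY gf fYE] := punctured_gluing nX nf pb.
have hY : hausdorff_space (punctured Q').
  by have [[[hS _ _ _] _] _ _] := nf; exact: hausdorff_set_type.
have [lY lZ] := punctured_locally_simple Q Q' nX nf.
have pY : path_connected R (punctured Q') := punctured_path_connected nf cS.
(* the base point is its own representative, as it may lie over a conic point *)
have [sec fsec sec0] : exists2 sec : punctured Q -> punctured Q',
    (forall z, fY (sec z) = z) & sec (fY y0) = y0.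
  have h z : exists y, fY y = z /\ (z = fY y0 -> y = y0).
    have [->|nz] := pselect (z = fY y0); first by exists y0.
    by have [y fy] := gluing_surj gf z; exists y.
  have [sec hsec] := choice h; exists sec => [z|]; first exact: (hsec z).1.
  exact: (hsec _).2.
have pZ : path_connected R (punctured Q) := path_connected_glued gf pY fsec.
have [phi [beta gl]] := pi1_glued x0 gf hY lY lZ pY fsec sec0.
have [e [eI eE]] := extra_preimages nX nf pb xI rx xc fYE fsec.
have [vP _ _] := ap; have [vP' _ _] := ap'.
have vV : is_variety (set_type (representation_set g pr) : funSpaceType k).
  by apply: variety_sub => //; exact: subvariety_representation_set.
have vV' : is_variety (set_type (representation_set g' pr') : funSpaceType k).
  by apply: variety_sub => //; exact: subvariety_representation_set.
have mer i := meridian_pullback nX nf cS pb i gf fsec fYE gl.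
have [_ _ hol_eq] := pb.
have [a [b ab]] := representations_power_product gl hol_eq (fun i => (mer i).1)
  (fun i => (mer i).2) gg gg' ap ap' vV vV' eI eE fsec.
exists vV, vV'; exact: power_product_class ab.
Qed.
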